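(* Let $\alpha\in(1,2)$. There exists a constant $C_\alpha>0$ depending only on $\alpha$ with the following property. Let $\Omega$ and $\mathcal A$ be as in the context, let $\beta\ge 0$, let $u_0,u_1\in\mathcal D(\mathcal A^\beta)$, and let $u$ be the solution to the homogeneous problem $$\begin{cases}(\partial_t^\alpha+\mathcal A)u=0 & \text{in }\Omega\times(0,\infty),\\ u=u_0,\ \partial_t u=u_1 & \text{in }\Omega\times\{0\},\\ u=0 & \text{on }\partial\Omega\times(0,\infty).\end{cases}$$ Then for all sufficiently large $t$ (i.e. there is $t_0>0$ such that for all $t\ge t_0$), $$\left\|u(\cdot,t)-\sum_{j=0}^1\frac{\mathcal A^{-1}u_j}{\Gamma(j+1-\alpha)}\,t^{j-\alpha}\right\|_{\mathcal D(\mathcal A^{\beta+1})}\le C_\alpha\sum_{j=0}^1\|u_j\|_{\mathcal D(\mathcal A^{\beta-1})}\,t^{j-2\alpha}.$$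
   Context: Setting. $\Omega\subset\mathbb R^d$ ($d=1,2,\dots$) is a bounded domain with sufficiently smooth boundary $\partial\Omega$. All functions are real-valued and $(\cdot,\cdot)$ is the inner product of $L^2(\Omega)$. The operator $\mathcal A:H^2(\Omega)\cap H^1_0(\Omega)\to L^2(\Omega)$ is $\mathcal A g=-\nabla\cdot(\boldsymbol a\nabla g)+c\,g$, where $c\in L^\infty(\Omega)$, $c\ge0$ in $\Omega$, and $\boldsymbol a=(a_{ij})\in C^1(\overline\Omega;\mathbb R^{d\times d})$ is symmetric with $\boldsymbol a(\boldsymbol x)\boldsymbol\xi\cdot\boldsymbol\xi\ge\kappa\,\boldsymbol\xi\cdot\boldsymbol\xi$ for all $\boldsymbol x\in\overline\Omega$, $\boldsymbol\xi\in\mathbb R^d$ and some constant $\kappa>0$. Let $\{(\lambda_n,\varphi_n)\}_{n\ge1}$ be the eigensystem of $\mathcal A$: $\mathcal A\varphi_n=\lambda_n\varphi_n$, $0<\lambda_1<\lambda_2\le\cdots$, $\lambda_n\to\infty$, with $\{\varphi_n\}$ a complete orthonormal system of $L^2(\Omega)$. Spaces. For $\beta\ge0$, $\mathcal D(\mathcal A^\beta)=\{g\in L^2(\Omega):\|g\|_{\mathcal D(\mathcal A^\beta)}<\infty\}$ with $\|g\|_{\mathcal D(\mathcal A^\beta)}=\big(\sum_{n}|\lambda_n^\beta(g,\varphi_n)|^2\big)^{1/2}$. For $-1\le\beta<0$, $\mathcal D(\mathcal A^\beta)$ is the dual space of $\mathcal D(\mathcal A^{-\beta})$ (with $L^2(\Omega)$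 as pivot space), with norm $\big(\sum_n|\lambda_n^\beta\langle g,\varphi_n\rangle|^2\big)^{1/2}$, where $\langle\cdot,\cdot\rangle$ is the duality pairing. $\mathcal A$ extends to $\mathcal A:\mathcal D(\mathcal A^{\beta})\to\mathcal D(\mathcal A^{\beta-1})$ for $\beta\ge0$ by acting on the eigenfunction coefficients as multiplication by $\lambda_n$, and $\mathcal A^{-1}g=\sum_n\lambda_n^{-1}(g,\varphi_n)\varphi_n$ for $g\in L^2(\Omega)$. Fractional calculus. $J^\beta g(t)=\frac1{\Gamma(\beta)}\int_0^t(t-s)^{\beta-1}g(s)\,ds$ for $\beta>0$. For $1<\alpha<2$ the Caputo derivative is $\partial_t^\alpha g=J^{2-\alpha}g''$ for smooth $g$; for non-smooth functions it is understood as the inverse of $J^\alpha$ applied to the function minus its initial data $u_0+tu_1$. Solution. A solution of the problem on $\Omega\times(0,T)$ is a function $u\in L^1(0,T;L^2(\Omega))$ with $u(\cdot,t)=u_0+t\,u_1-J^\alpha(\mathcal Au)(t)$ in $\mathcal D(\mathcal A^{-1})$ for a.e. $t\in(0,T)$ (the Dirichlet condition is encoded in $\mathcal A$); a solution on $\Omega\times(0,\infty)$ is one whose restriction is a solution for every $T>0$. For $t>0$, $u(\cdot,t)$ denotes the value of the representative that is continuous from $(0,\infty)$ to $\mathcal D(\mathcal A^{\beta+1})$. *)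

(* Defs.v *)
From HB Require Import structures.
From mathcomp Require Import all_boot all_order all_algebra.
From mathcomp Require Import all_classical all_reals all_analysis.
From mathcomp Require Import measurable_realfun.
Set Implicit Arguments.
Unset Strict Implicit.
Unset Printing Implicit Defensive.
Import Order.TTheory GRing.Theory Num.Theory.
Import numFieldNormedType.Exports.
Local Open Scope classical_set_scope.
Local Open Scope ring_scope.

Definition rV_display : measure_display -> measure_display.
Proof. exact. Qed.

Section measurable_rV.
Context {dT} {T : measurableType dT} (n : nat).

Let coord : 'I_n -> 'rV[T]_n -> T := fun i x => x ord0 i.

Let rV_set0 : g_sigma_preimage coord set0.
Proof. exact: sigma_algebra0. Qed.

Let rV_setC A : g_sigma_preimage coord A -> g_sigma_preimage coord (~` A).
Proof. exact: sigma_algebraC. Qed.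

Let rV_bigcup (F : (set 'rV[T]_n)^nat) :
  (forall i, g_sigma_preimage coord (F i)) ->
  g_sigma_preimage coord (\bigcup_i (F i)).
Proof. exact: sigma_algebra_bigcup. Qed.

HB.instance Definition _ := @isMeasurable.Build (rV_display dT)
  'rV[T]_n (g_sigma_preimage coord) rV_set0 rV_setC rV_bigcup.

End measurable_rV.


Lemma measurable_coord_rV dT (T : measurableType dT) n (i : 'I_n) :
  measurable_fun [set: 'rV[T]_n] (fun x : 'rV[T]_n => x ord0 i).
Proof.
move=> _ Y mY; rewrite setTI; apply: sub_sigma_algebra => /=.
rewrite -bigcup_seq/=; exists i => /=; first by rewrite mem_index_enum.
by exists Y => //; rewrite setTI.
Qed.

Lemma measurable_fun_rV d1 (T1 : measurableType d1) dT (T : measurableType dT)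
    n (f : T1 -> 'rV[T]_n) :
  (forall i, measurable_fun [set: T1] (fun x => f x ord0 i)) ->
  measurable_fun [set: T1] f.
Proof.
move=> mf; pose coord (i : 'I_n) := fun x : 'rV[T]_n => x ord0 i.
apply: (measurability
  (\big[setU/set0]_(i < n) preimage_set_system setT (coord i) measurable)) => //.
move=> _ [B GB <-]; move: GB; rewrite -bigcup_seq => -[i _ [C mC <-]].
by have := mf i measurableT C mC; rewrite !setTI.
Qed.

Section lebesgue_rV.
Context {R : realType}.

Definition cons_rV d (p : R * 'rV[R]_d) : 'rV[R]_d.+1 :=
  row_mx (p.1%:M : 'rV[R]_1) p.2.

Let uncons_rV d (x : 'rV[R]_d.+1) : R * 'rV[R]_d :=
  (x ord0 ord0, rsubmx (x : 'rV[R]_(1 + d))).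

Let cons_rVl d p : @cons_rV d p ord0 (lshift d (ord0 : 'I_1)) = p.1.
Proof. by rewrite [LHS](@row_mxEl _ _ 1 d) mxE eqxx mulr1n. Qed.

Let cons_rVr d p i : @cons_rV d p ord0 (rshift 1 i) = p.2 ord0 i.
Proof. exact: (@row_mxEr _ _ 1 d). Qed.

Lemma measurable_cons_rV d : measurable_fun [set: R * 'rV[R]_d] (@cons_rV d).
Proof.
apply: measurable_fun_rV => i.
case: (split_ordP (i : 'I_(1 + d))) => j ->.
  rewrite (ord1 j); under eq_fun do rewrite cons_rVl.
  exact: measurable_fst.
under eq_fun do rewrite cons_rVr.
exact: (measurableT_comp (measurable_coord_rV j) measurable_snd).
Qed.

Let measurable_uncons_rV d : measurable_fun [set: 'rV[R]_d.+1] (@uncons_rV d).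
Proof.
apply: measurable_fun_pair; first exact: measurable_coord_rV.
apply: measurable_fun_rV => i.
under eq_fun do rewrite mxE.
exact: measurable_coord_rV.
Qed.

Let cons_rVK d : cancel (@cons_rV d) (@uncons_rV d).
Proof.
move=> [a x]; rewrite /uncons_rV [rsubmx _](@row_mxKr _ _ 1 d)/=.
suff -> : cons_rV (a, x) ord0 ord0 = a by [].
rewrite -[RHS](cons_rVl (a, x)); congr (fun_of_matrix _ _ _).
exact/val_inj.
Qed.

Definition lebesgue_cons d (m : {sigma_finite_measure set 'rV[R]_d -> \bar R}) :
    set 'rV[R]_d.+1 -> \bar R :=
  pushforward (@lebesgue_measure R \x m)%E (@cons_rV d).

Section lebesgue_cons.
Context d (m : {sigma_finite_measure set 'rV[R]_d -> \bar R}).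

Let lebesgue_cons0 : lebesgue_cons m set0 = 0%E.
Proof. by rewrite /lebesgue_cons /pushforward preimage_set0 measure0. Qed.

Let lebesgue_cons_ge0 A : (0 <= lebesgue_cons m A)%E.
Proof. by rewrite /lebesgue_cons /pushforward measure_ge0. Qed.

Let lebesgue_cons_sigma_additive : semi_sigma_additive (lebesgue_cons m).
Proof.
move=> F mF tF mUF.
have mpre A : measurable A -> measurable (@cons_rV d @^-1` A).
  by move=> mA; rewrite -[X in measurable X]setTI; exact: measurable_cons_rV.
rewrite /lebesgue_cons /pushforward preimage_bigcup.
apply: measure_semi_sigma_additive; first by move=> n; exact: mpre.
- move/trivIsetP : tF => tF; apply/trivIsetP => /= i j _ _ ij.
  by rewrite -preimage_setI tF// preimage_set0.
- by rewrite -preimage_bigcup; exact: mpre.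
Qed.

HB.instance Definition _ := isMeasure.Build _ _ _ (lebesgue_cons m)
  lebesgue_cons0 lebesgue_cons_ge0 lebesgue_cons_sigma_additive.

Let lebesgue_cons_sigma_finite : sigma_finite setT (lebesgue_cons m).
Proof.
have [F UF mF] : sigma_finite setT (@lebesgue_measure R \x m)%E.
  have /sigma_finiteP[F [TF ndF Foo]] := sigma_finiteT (@lebesgue_measure R).
  have /sigma_finiteP[G [TG ndG Goo]] := sigma_finiteT m.
  exists (fun n => F n `*` G n).
    rewrite -setXTT TF TG predeqE => -[x y]; split.
      move=> [/= [n _ Fnx] [k _ Gky]]; exists (maxn n k) => //; split.
      - by move: x Fnx; exact/subsetPset/ndF/leq_maxl.
      - by move: y Gky; exact/subsetPset/ndG/leq_maxr.
    by move=> [n _ []/= ? ?]; split; exists n.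
  move=> k; have [? ?] := Foo k; have [? ?] := Goo k.
  split; first exact: measurableX.
  by rewrite product_measure1E// lte_mul_pinfty// ge0_fin_numE.
exists (fun n => @uncons_rV d @^-1` F n).
  by rewrite -preimage_bigcup -UF preimage_setT.
move=> n; have [mFn Fnoo] := mF n; split.
  by rewrite -[X in measurable X]setTI; exact: measurable_uncons_rV.
rewrite /lebesgue_cons /pushforward -comp_preimage.
by rewrite (_ : _ \o _ = id)//; apply/funext => x; exact: cons_rVK.
Qed.

HB.instance Definition _ := Measure_isSigmaFinite.Build _ _ _ (lebesgue_cons m)
  lebesgue_cons_sigma_finite.

End lebesgue_cons.

(* Lebesgue measure on R^d: the image of the product of Lebesgue measure on R and
   of lebesgue_rV d' under (t, x) |-> row_mx t x, and a Dirac mass for d = 0. *)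
Fixpoint lebesgue_rV d : {sigma_finite_measure set 'rV[R]_d -> \bar R} :=
  if d is d'.+1 then lebesgue_cons (lebesgue_rV d')
  else \d_(0 : 'rV[R]_0).

End lebesgue_rV.

Section Gamma.
Context {R : realType}.

Definition Gamma_integral (x : R) : R :=
  \int[@lebesgue_measure R]_(t in `]0, +oo[) (t `^ (x - 1) * expR (- t)).

(* For x <= 0 the integral diverges and Gamma is continued by
   Gamma x = Gamma (x + n) / (x (x + 1) ... (x + n - 1)), with n least such that
   0 < x + n; at the poles 0, -1, -2, ... this gives the dummy value 0. *)
Definition Gamma (x : R) : R :=
  let n := if 0 < x then 0%N else (Num.truncn (- x)).+1 in
  Gamma_integral (x + n%:R) / \prod_(k < n) (x + k%:R).

End Gamma.

(* S is a subspace of V on which N is a (semi)norm with values in [0, +oo[;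
   elements of S at N-distance 0 represent the same vector. *)
Section Bochner.
Context {R : realType} {V : lmodType R} (S : set V) (N : V -> \bar R).
Implicit Types (a b : R) (f : R -> V).

Definition is_step (s : seq (set R * V)) := {in s, forall p, measurable p.1 /\ S p.2}.

Definition step (s : seq (set R * V)) (t : R) : V := \sum_(p <- s) \1_(p.1) t *: p.2.

Definition step_integral a b (s : seq (set R * V)) : V :=
  \sum_(p <- s) fine (lebesgue_measure (p.1 `&` `]a, b[%classic)) *: p.2.

(* The functions e k are Borel versions of t |-> N (f t - step (s_ k) t), which
   is itself only required to be Lebesgue measurable. *)
Definition bochner_approx a b f (s_ : nat -> seq (set R * V)) :=
  (forall k, is_step (s_ k)) /\
  exists e : nat -> R -> \bar R,
    [/\ forall k, measurable_fun `]a, b[ (e k),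
        forall k, \forall t \ae @lebesgue_measure R,
          t \in `]a, b[ -> N (f t - step (s_ k) t) = e k t
      & (\int[@lebesgue_measure R]_(t in `]a, b[) e k t)%E @[k --> \oo]
          --> 0%E].

(* f is in L^1(a, b; S) *)
Definition bochner_integrable a b f :=
  (\forall t \ae @lebesgue_measure R, t \in `]a, b[ -> S (f t)) /\
  exists s_ : nat -> seq (set R * V), bochner_approx a b f s_.

Definition bochner_integral a b f (v : V) :=
  [/\ S v,
      \forall t \ae @lebesgue_measure R, t \in `]a, b[ -> S (f t)
    & exists2 s_ : nat -> seq (set R * V), bochner_approx a b f s_ &
        N (step_integral a b (s_ k) - v) @[k --> \oo] --> 0%E].

(* v = J^alpha f (t) *)
Definition frac_integral (alpha : R) f (t : R) (v : V) :=
  exists2 w, bochner_integral 0 t (fun s => (t - s) `^ (alpha - 1) *: f s) w &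
    v = (Gamma alpha)^-1 *: w.

End Bochner.

Section Elliptic.
Context {R : realType} {d : nat}.
Local Notation mu := (@lebesgue_rV R d).
Implicit Types (Omega : set 'rV[R]_d) (f g h : 'rV[R]_d -> R).

Definition partial (i : 'I_d) f : 'rV[R]_d -> R := 'D_(delta_mx ord0 i) f.

Definition has_partial (i : 'I_d) f (x : 'rV[R]_d) :=
  derivable f x (delta_mx ord0 i).

Fixpoint Ck (k : nat) f : Prop :=
  continuous f /\
  if k is k'.+1 then
    forall i, (forall x, has_partial i f x) /\ Ck k' (partial i f)
  else True.

(* f is C^1 in Omega, and f and its first derivatives extend continuously to the
   closure. *)
Definition C1_closure Omega f :=
  {within closure Omega, continuous f} /\
  forall i, exists2 g, {within closure Omega, continuous g} &
    forall x, Omega x -> has_partial i f x /\ partial i f x = g x.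

(* Near each of its points the boundary is a regular level set {rho = 0} of a
   C^2 function, with Omega on the side {rho < 0}. *)
Definition C2_boundary Omega :=
  forall x0, closure Omega x0 -> ~ Omega x0 ->
  exists2 r : R, 0 < r & exists rho : 'rV[R]_d -> R,
    [/\ Ck 2 rho,
        exists i, partial i rho x0 != 0
      & forall x, ball x0 r x -> (Omega x <-> rho x < 0)].

Record smooth_bounded_domain Omega : Prop := SmoothBoundedDomain {
  domain_nonempty : Omega !=set0;
  domain_open : open Omega;
  domain_connected : connected Omega;
  domain_bounded : bounded_set Omega;
  domain_boundary : C2_boundary Omega }.

Record elliptic_coefficients Omega (a : 'rV[R]_d -> 'M[R]_d) (c : 'rV[R]_d -> R)
    : Prop := EllipticCoefficients {
  a_C1 : forall i j, C1_closure Omega (fun x => a x i j);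
  a_sym : forall x, closure Omega x -> (a x)^T = a x;
  a_elliptic : exists2 kappa : R, 0 < kappa &
    forall x, closure Omega x -> forall xi : 'rV[R]_d,
      kappa * (xi *m xi^T) ord0 ord0 <= (xi *m a x *m xi^T) ord0 ord0;
  c_measurable : measurable_fun Omega c;
  c_bounded : exists M : R, \forall x \ae mu, Omega x -> `|c x| <= M;
  c_ge0 : \forall x \ae mu, Omega x -> 0 <= c x }.

(* Elements of L^2(Omega) are represented by Borel functions; equality in
   L^2(Omega) is equality almost everywhere on Omega. *)
Definition L2norm Omega f : \bar R :=
  poweR (\int[mu]_(x in Omega) (f x ^+ 2)%:E)%E 2^-1.

Definition L2 Omega : set ('rV[R]_d -> R) :=
  [set f | measurable_fun Omega f /\ (L2norm Omega f < +oo)%E].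

Definition L2dot Omega f g : R := \int[mu]_(x in Omega) (f x * g x).

Definition test_function Omega f :=
  [/\ forall k, Ck k f,
      compact (closure [set x | f x != 0])
    & closure [set x | f x != 0] `<=` Omega].

Definition weak_partial Omega (i : 'I_d) f g :=
  forall psi, test_function Omega psi ->
    L2dot Omega f (partial i psi) = - L2dot Omega g psi.

Definition H1 Omega f :=
  L2 Omega f /\ forall i, exists2 g, L2 Omega g & weak_partial Omega i f g.

Definition H2 Omega f :=
  L2 Omega f /\ forall i, exists2 g, H1 Omega g & weak_partial Omega i f g.

(* The closure of the test functions in H^1(Omega). *)
Definition H10 Omega f :=
  L2 Omega f /\
  exists2 p : 'I_d -> 'rV[R]_d -> R,
    forall i, L2 Omega (p i) /\ weak_partial Omega i f (p i) &
    exists psi : nat -> 'rV[R]_d -> R,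
      [/\ forall k, test_function Omega (psi k),
          L2norm Omega (psi k - f) @[k --> \oo] --> 0%E
        & forall i, L2norm Omega (partial i (psi k) - p i) @[k --> \oo]
                      --> 0%E].

(* g is in H^2 and H^1_0, and h = - div (a grad g) + c g in L^2(Omega), where p
   is the gradient of g and q i is the i-th derivative of the i-th component of
   a grad g. *)
Definition elliptic_op Omega (a : 'rV[R]_d -> 'M[R]_d) (c : 'rV[R]_d -> R) g h :=
  [/\ H2 Omega g, H10 Omega g, L2 Omega h &
      exists p q : 'I_d -> 'rV[R]_d -> R,
        [/\ forall i, L2 Omega (p i) /\ weak_partial Omega i g (p i),
            forall i, L2 Omega (q i) /\
              weak_partial Omega i (fun x => \sum_j a x i j * p j x) (q i)
          & \forall x \ae mu, Omega x ->
              h x = - (\sum_i q i x) + c x * g x]].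

(* The eigenpairs are numbered from 0. *)
Record eigensystem Omega (a : 'rV[R]_d -> 'M[R]_d) (c : 'rV[R]_d -> R)
    (lam : nat -> R) (phi : nat -> 'rV[R]_d -> R) : Prop := Eigensystem {
  eigenpair : forall n, elliptic_op Omega a c (phi n) (lam n *: phi n);
  lam_gt0 : 0 < lam 0%N;
  lam_simple : lam 0%N < lam 1%N;
  lam_nondecreasing : forall n, (0 < n)%N -> lam n <= lam n.+1;
  lam_cvg : lam n @[n --> \oo] --> +oo;
  phi_orthonormal : forall m n, L2dot Omega (phi m) (phi n) = (m == n)%:R;
  phi_complete : forall g, L2 Omega g ->
    (forall n, L2dot Omega g (phi n) = 0) ->
    \forall x \ae mu, Omega x -> g x = 0 }.

End Elliptic.

Section Evolution.
Context {R : realType} {d : nat}.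
Variables (Omega : set 'rV[R]_d) (lam : nat -> R) (phi : nat -> 'rV[R]_d -> R).
Local Notation fn := ('rV[R]_d -> R).
Local Notation functional := (('rV[R]_d -> R) -> R).
Implicit Types (g h w psi : fn) (F : functional) (beta : R).

Definition spectral_norm beta (b : nat -> R) : \bar R :=
  poweR (\sum_(0 <= n <oo) (`|lam n `^ beta * b n| ^+ 2)%:E)%E 2^-1.

(* For g in L^2(Omega) this is the norm of g in D(A^beta) for negative beta as
   well, since L^2(Omega) is the pivot space. *)
Definition domA_norm beta g : \bar R :=
  spectral_norm beta (fun n => L2dot Omega g (phi n)).

Definition domA beta : set fn :=
  [set g | L2 Omega g /\ (domA_norm beta g < +oo)%E].

(* D(A^beta) for beta < 0: bounded linear functionals on D(A^(-beta)). *)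
Definition domA_dual beta : set functional :=
  [set F | (forall (k : R) g h, domA (- beta) g -> domA (- beta) h ->
              F (k *: g + h) = k * F g + F h) /\
           exists M : R, forall g, domA (- beta) g ->
              (`|F g|%:E <= M%:E * domA_norm (- beta) g)%E].

Definition domA_dual_norm beta F : \bar R :=
  spectral_norm beta (fun n => F (phi n)).

(* A : L^2(Omega) -> D(A^(-1)) *)
Definition A_ext g : functional := fun psi =>
  limn (series (fun n => lam n * L2dot Omega g (phi n) * L2dot Omega (phi n) psi)).

(* w = A^(-1) g *)
Definition is_A_inv g w :=
  L2 Omega w /\
  L2norm Omega
    (w - \sum_(k < n) ((lam k)^-1 * L2dot Omega g (phi k)) *: phi k)
    @[n --> \oo] --> 0%E.

Definition solution_on (alpha : R) (u0 u1 : fn) (T : R) (u : R -> fn) :=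
  bochner_integrable (L2 Omega) (L2norm Omega) 0 T u /\
  \forall t \ae @lebesgue_measure R, 0 < t < T ->
    exists2 v,
      frac_integral (domA_dual (- 1)) (domA_dual_norm (- 1)) alpha
        (fun s => A_ext (u s)) t v &
      forall psi, domA 1 psi ->
        L2dot Omega (u t) psi =
          L2dot Omega u0 psi + t * L2dot Omega u1 psi - v psi.

Definition solution (alpha : R) (u0 u1 : fn) (u : R -> fn) :=
  forall T, 0 < T -> solution_on alpha u0 u1 T u.

(* v is a representative of u that is continuous from (0, oo) to D(A^beta). *)
Definition continuous_representative beta (u v : R -> fn) :=
  [/\ \forall t \ae @lebesgue_measure R, 0 < t ->
        \forall x \ae @lebesgue_rV R d, Omega x -> u t x = v t x,
      forall t, 0 < t -> domA beta (v t)
    & forall t, 0 < t -> domA_norm beta (v s - v t) @[s --> t] --> 0%E].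

End Evolution.

(* Main.v *)
From HB Require Import structures.
Require Import Defs.
From mathcomp Require Import all_boot all_order all_algebra.
From mathcomp Require Import all_classical all_reals all_analysis.
From mathcomp Require Import measurable_realfun.
From mathcomp.real_closed Require Import complex.
From mathcomp Require Import ring lra.
Set Implicit Arguments.
Unset Strict Implicit.
Unset Printing Implicit Defensive.
Import Order.TTheory GRing.Theory Num.Theory.
Import numFieldNormedType.Exports.
Local Open Scope classical_set_scope.
Local Open Scope ring_scope.

(** Let c(t) = (u(t), phi_n) be the coefficient of the solution at the n-th
    eigenfunction, lambda = lambda_n, and let a, b be the coefficients of u_0
    and u_1.  The equation of the solution becomes the scalar Volterra equation
    c = a + b t - lambda J^alpha c, and everything follows from

      |c(t) - a t^(-alpha) / (lambda Gamma(1 - alpha))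
            - b t^(1 - alpha) / (lambda Gamma(2 - alpha))|
        <= C (|a| t^(-2 alpha) + |b| t^(1 - 2 alpha)) / lambda^2     (t > 0)

    with C depending on alpha only ([relaxation_asymptotics]): multiplied by
    lambda^(beta + 1) the right-hand side carries the weight lambda^(beta - 1),
    so squaring and summing over n gives the estimate between the norms of
    D(A^(beta + 1)) and D(A^(beta - 1)) ([spectral_norm_le]), for every t > 0.

    The scalar estimate is obtained by Laplace transformation.  For
    s^alpha >= 2 lambda the operator lambda J^alpha halves the norm of L^1(0, T)
    with weight e^(-s t), whence a bound on c uniform in T, and the transform of
    c is (a s^(alpha - 1) + b s^(alpha - 2)) / (s^alpha + lambda).  Let G have
    the transform s^(alpha - 2) / (s^alpha + lambda).  The primitive of c has the
    same transform as a G + b (primitive of G), so c = a G' + b G by uniqueness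
    and differentiation ([laplace_inj], [volterra_solution]).  The function G is
    not written as a Mittag-Leffler series but as its leading term plus an
    integral over a ray,

      G(t) = t^(1 - alpha) / (lambda Gamma(2 - alpha)) + rho(t),
      rho(t) = - 1 / (lambda pi)
               int Im [e^(t z) z^(2 alpha - 2) / (z^alpha + lambda) dz],

    z = e^(x + i theta), x in R, with pi / 2 < theta < pi / alpha.  On this ray
    e^(t z) decays because theta > pi / 2, and |z^alpha + lambda| >= q lambda with
    q > 0 independent of lambda because alpha theta < pi; substituting
    x - ln t for x gives rho = O(t^(1 - 2 alpha) / lambda^2) and
    rho' = O(t^(-2 alpha) / lambda^2) ([relaxation_correction]).

    By Fubini the transform of rho at s is the integral over the ray of
    Im [z^(2 alpha - 2) / ((z^alpha + lambda) (s - z)) dz], a residue at z = s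
    ([mittag_leffler_contour]).  In the variable w = log (z / s) the ray is a
    horizontal line and the pole is at 0; the residue theorem that is needed is
    [strip_cauchy]: for H real on the real axis, the integral of
    Im (- H / sinh) over the line Im w = y is pi H(0).  After subtraction of H(0)
    the singularity is removable, the Cauchy-Riemann equations make the integral
    over the line independent of y, and for y = 0 the integrand vanishes; the
    subtracted term is computed with an arctangent.

    On the side of function spaces, each coefficient functional is dominated by
    the norm in which Bochner integrals are approximated by step functions, so
    coefficients commute with the integrals that define a solution
    ([bochner_coefficient_integrable], [frac_integral_coefficient]). *)

(** * Complex modulus and the Cauchy-Riemann equations *)

Import Normc.

Section complex_modulus.
Context {R : realType}.
Implicit Types (z w : R[i]).

Definition re z : R := complex.Re z.
Definition im z : R := complex.Im z.
Definition cabs z : R := normc z.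

Lemma cabsM z w : cabs (z * w) = cabs z * cabs w.
Proof. exact: normcM. Qed.

Lemma cabsV z : cabs z^-1 = (cabs z)^-1.
Proof. exact: normcV. Qed.

Lemma cabs_ge0 z : 0 <= cabs z.
Proof. by case: z => x y; exact: sqrtr_ge0. Qed.

Lemma cabs_eq0 z : (cabs z == 0) = (z == 0).
Proof.
apply/eqP/eqP => [/eq0_normc//|->]; exact: normc0.
Qed.

Lemma le_cabsD z w : cabs (z + w) <= cabs z + cabs w.
Proof. exact: le_normcD. Qed.

Lemma cabsN z : cabs (- z) = cabs z.
Proof. exact: normcN. Qed.

Lemma sqr_cabs z : cabs z ^+ 2 = re z ^+ 2 + im z ^+ 2.
Proof. by case: z => x y; rewrite /re/im/=/cabs/= sqr_sqrtr ?addr_ge0 ?sqr_ge0. Qed.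

Lemma normr_Re_le z : `|re z| <= cabs z.
Proof.
rewrite -(@ler_pXn2r _ 2) ?nnegrE ?cabs_ge0//.
by rewrite real_normK ?num_real// sqr_cabs lerDl sqr_ge0.
Qed.

Lemma normr_Im_le z : `|im z| <= cabs z.
Proof.
rewrite -(@ler_pXn2r _ 2) ?nnegrE ?cabs_ge0//.
by rewrite real_normK ?num_real// sqr_cabs lerDr sqr_ge0.
Qed.

Lemma cabs_le z : cabs z <= `|re z| + `|im z|.
Proof.
rewrite -(@ler_pXn2r _ 2) ?nnegrE ?cabs_ge0 ?addr_ge0//.
rewrite sqr_cabs sqrrD !real_normK ?num_real//.
by rewrite -addrAC lerDl mulrn_wge0// mulr_ge0.
Qed.

Lemma cabs_real (x : R) : cabs x%:C%C = `|x|.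
Proof. by rewrite /cabs/= expr0n/= addr0 sqrtr_sqr. Qed.

Lemma reD z w : re (z + w) = re z + re w.
Proof. by case: z w => ? ? []. Qed.
Lemma imD z w : im (z + w) = im z + im w.
Proof. by case: z w => ? ? []. Qed.
Lemma reN z : re (- z) = - re z.
Proof. by case: z. Qed.
Lemma imN z : im (- z) = - im z.
Proof. by case: z. Qed.
Lemma reM z w : re (z * w) =
  re z * re w - im z * im w.
Proof. by case: z w => ? ? []. Qed.
Lemma imM z w : im (z * w) =
  re z * im w + im z * re w.
Proof. by case: z w => ? ? [? ?]; rewrite /re /im/=; ring. Qed.
Lemma reV z : re z^-1 = re z / cabs z ^+ 2.
Proof. by rewrite sqr_cabs; case: z. Qed.
Lemma imV z : im z^-1 = - im z / cabs z ^+ 2.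
Proof. by rewrite sqr_cabs; case: z => x y; rewrite /im/= mulNr. Qed.

End complex_modulus.

Definition ReImE := (@reD, @imD, @reN, @imN, @reM, @imM).

Section holomorphic.
Context {R : realType}.
Implicit Types (f g : R -> R -> R[i]).

(** [f'] is the complex derivative of [f] at x + i y, recorded through the four
    real partial derivatives; in this form it can be fed into differentiation
    under a real integral. *)
Record holo_at f f' (x y : R) : Prop := HoloAt {
  holo_Rex : is_derive x 1 (fun u => re (f u y)) (re (f' x y)) ;
  holo_Imx : is_derive x 1 (fun u => im (f u y)) (im (f' x y)) ;
  holo_Rey : is_derive y 1 (fun u => re (f x u)) (- im (f' x y)) ;
  holo_Imy : is_derive y 1 (fun u => im (f x u)) (re (f' x y)) }.

Lemma holo_cst (c : R[i]) x y : holo_at (fun _ _ => c) (fun _ _ => 0) x y.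
Proof. by split; rewrite /im/= ?oppr0; exact: is_derive_cst. Qed.

Lemma holo_eq f f1' f2' x y : f1' x y = f2' x y ->
  holo_at f f1' x y -> holo_at f f2' x y.
Proof. by move=> E [? ? ? ?]; split; rewrite -E. Qed.

Lemma holo_add f f' g g' x y : holo_at f f' x y -> holo_at g g' x y ->
  holo_at (fun u v => f u v + g u v) (fun u v => f' u v + g' u v) x y.
Proof.
move=> [a1 a2 a3 a4] [b1 b2 b3 b4]; split.
- under eq_fun do rewrite reD.
  by apply: is_derive_eq; rewrite reD.
- under eq_fun do rewrite imD.
  by apply: is_derive_eq; rewrite imD.
- under eq_fun do rewrite reD.
  by apply: is_derive_eq; rewrite imD opprD.
- under eq_fun do rewrite imD.
  by apply: is_derive_eq; rewrite reD.
Qed.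

Lemma holo_mul f f' g g' x y : holo_at f f' x y -> holo_at g g' x y ->
  holo_at (fun u v => f u v * g u v)
          (fun u v => f' u v * g u v + f u v * g' u v) x y.
Proof.
move=> [a1 a2 a3 a4] [b1 b2 b3 b4]; split.
- under eq_fun do rewrite reM.
  by apply: is_derive_eq; rewrite !ReImE/= /GRing.scale/=; ring.
- under eq_fun do rewrite imM.
  by apply: is_derive_eq; rewrite !ReImE/= /GRing.scale/=; ring.
- under eq_fun do rewrite reM.
  by apply: is_derive_eq; rewrite !ReImE/= /GRing.scale/=; ring.
- under eq_fun do rewrite imM.
  by apply: is_derive_eq; rewrite !ReImE/= /GRing.scale/=; ring.
Qed.

Lemma is_derive_div_sqD (a b : R -> R) (x a' b' : R) :
  is_derive x 1 a a' -> is_derive x 1 b b' -> a x ^+ 2 + b x ^+ 2 != 0 ->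
  is_derive x 1 (fun u => a u / (a u ^+ 2 + b u ^+ 2))
    ((a' * (b x ^+ 2 - a x ^+ 2) - 2 * a x * b x * b') /
     (a x ^+ 2 + b x ^+ 2) ^+ 2).
Proof.
move=> da db n0.
have dh : is_derive x 1 (fun u => a u ^+ 2 + b u ^+ 2)
    (2 * a x * a' + 2 * b x * b').
  by apply: is_derive_eq; rewrite /GRing.scale/= ; ring.
have dV := @is_deriveV _ _ x _ 1 n0 dh.
apply: (@is_derive_eq _ _ _ _ _ _ _ _ (is_deriveM da dV)).
by rewrite /GRing.scale/=; field.
Qed.

Lemma holo_inv f f' x y : f x y != 0 -> holo_at f f' x y ->
  holo_at (fun u v => (f u v)^-1) (fun u v => - f' u v / f u v ^+ 2) x y.
Proof.
move=> f0 [a1 a2 a3 a4].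
have N0 : re (f x y) ^+ 2 + im (f x y) ^+ 2 != 0.
  by rewrite -sqr_cabs sqrf_eq0 cabs_eq0.
have N0' : im (f x y) ^+ 2 + re (f x y) ^+ 2 != 0 by rewrite addrC.
have cE : cabs (f x y ^+ 2) = re (f x y) ^+ 2 + im (f x y) ^+ 2.
  by rewrite expr2 cabsM -expr2 sqr_cabs.
have [E1 E2] : re (- f' x y / f x y ^+ 2) =
      (re (f' x y) * (im (f x y) ^+ 2 - re (f x y) ^+ 2)
       - 2 * re (f x y) * im (f x y) * im (f' x y)) /
      (re (f x y) ^+ 2 + im (f x y) ^+ 2) ^+ 2 /\
    im (- f' x y / f x y ^+ 2) =
      - (im (f' x y) * (re (f x y) ^+ 2 - im (f x y) ^+ 2)
       - 2 * im (f x y) * re (f x y) * re (f' x y)) /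
      (im (f x y) ^+ 2 + re (f x y) ^+ 2) ^+ 2.
  by split; rewrite !ReImE reV imV cE expr2 !ReImE; field; rewrite ?N0 ?N0'.
have imE w : im (w^-1) = - (im w / (im w ^+ 2 + re w ^+ 2)).
  by rewrite imV sqr_cabs addrC mulNr.
split.
- under eq_fun do rewrite reV sqr_cabs.
  by apply: is_derive_eq (is_derive_div_sqD a1 a2 N0) _; rewrite E1.
- under eq_fun do rewrite imE.
  by apply: is_derive_eq (is_deriveN (is_derive_div_sqD a2 a1 N0')) _; rewrite E2 mulNr.
- under eq_fun do rewrite reV sqr_cabs.
  by apply: is_derive_eq (is_derive_div_sqD a3 a4 N0) _; rewrite E2; field; rewrite ?N0 ?N0'.
- under eq_fun do rewrite imE.
  by apply: is_derive_eq (is_deriveN (is_derive_div_sqD a4 a3 N0')) _; rewrite E1; field; rewrite ?N0 ?N0'.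
Qed.

(** The power z^p of z = e^(x + i y) for the branch with arg z = y. *)
Definition cexp (p x y : R) : R[i] :=
  ((expR (p * x) * cos (p * y)) +i* (expR (p * x) * sin (p * y)))%C.

Lemma cexpD p q x y : cexp (p + q) x y = cexp p x y * cexp q x y.
Proof.
rewrite /cexp !mulrDl expRD cosD sinD.
by apply/eqP; rewrite eq_complex/=; apply/andP; split; apply/eqP; ring.
Qed.

Lemma cabs_cexp p x y : cabs (cexp p x y) = expR (p * x).
Proof.
by rewrite /cabs/= !exprMn -mulrDr cos2Dsin2 mulr1 sqrtr_sqr ger0_norm ?expR_ge0.
Qed.

Lemma cexp_real p x : cexp p x 0 = (expR (p * x))%:C%C.
Proof. by rewrite /cexp mulr0 cos0 sin0 mulr1 mulr0. Qed.

Lemma cexp0 x y : cexp 0 x y = 1.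
Proof. by rewrite /cexp !mul0r cos0 sin0 expR0 mulr1 mulr0. Qed.

Lemma holo_cexp p x y : holo_at (cexp p) (fun u v => p%:C%C * cexp p u v) x y.
Proof.
have dl (z : R) : is_derive z 1 ( *%R p) p.
  by apply: is_derive_eq; rewrite /GRing.scale/=; ring.
have de (z : R) : is_derive z 1 (fun u : R => expR (p * u)) (expR (p * z) * p).
  exact: is_derive1_comp.
have dc (z : R) : is_derive z 1 (fun u : R => cos (p * u)) (- sin (p * z) * p).
  exact: is_derive1_comp.
have ds (z : R) : is_derive z 1 (fun u : R => sin (p * u)) (cos (p * z) * p).
  exact: is_derive1_comp.
split; rewrite /re /im /=; apply: is_derive_eq; rewrite /GRing.scale/=; ring.
Qed.

End holomorphic.

(** * The kernel - 1 / sinh *)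
Section calculus.
Context {R : realType}.
Implicit Types (f : R -> R).

Lemma is_derive_continuous f (x f' : R) : is_derive x 1 f f' -> {for x, continuous f}.
Proof.
move=> [df _]; apply: differentiable_continuous; exact/derivable1_diffP.
Qed.

Lemma MVT_is_derive f (f' : R -> R) (a b : R) : a <= b ->
  (forall x : R, x \in `[a, b] -> is_derive x 1 f (f' x)) ->
  exists2 c : R, c \in `[a, b] & f b - f a = f' c * (b - a).
Proof.
move=> ab df.
have df' (x : R) : x \in `]a, b[ -> is_derive x 1 f (f' x).
  by rewrite in_itv/= => /andP[ax xb]; apply: df; rewrite in_itv/= !ltW.
have cf : {within `[a, b], continuous f}.
  by apply: derivable_within_continuous => x /df dfx; exact: ex_derive.
exact: (@MVT_segment R f f' a b ab df' cf).
Qed.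

Lemma lipschitz_derive f (f' : R -> R) (L a b : R) (I : interval R) :
  a \in I -> b \in I ->
  (forall x, x \in I -> is_derive x 1 f (f' x)) ->
  (forall x, x \in I -> `|f' x| <= L) -> `|f b - f a| <= L * `|b - a|.
Proof.
wlog ab : a b / a <= b.
  move=> W aI bI df bf; have [|/ltW ba] := leP a b; first by move=> ab; exact: W.
  by rewrite distrC (distrC b); exact: W.
move=> aI bI df bf.
have sI x : x \in `[a, b] -> x \in I.
  by rewrite in_itv; exact: (@interval_is_interval _ I a b aI bI x).
have [x xab ->] := @MVT_is_derive f f' a b ab (fun x xab => df x (sI _ xab)).
by rewrite normrM ler_wpM2r// bf// sI.
Qed.

Lemma expR_half_le (x : R) : 2 * `|x| <= `|expR x - expR (- x)|.
Proof.
wlog x0 : x / 0 <= x.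
  move=> W; have [x0|/ltW x0] := leP 0 x; first exact: W.
  by have := W (- x); rewrite oppr_ge0 opprK normrN distrC; exact.
have d (z : R) : is_derive z 1 (fun u : R => expR u - expR (- u)) (expR z + expR (- z)).
  have dn : is_derive z 1 (fun u : R => expR (- u)) (expR (- z) * - 1).
    exact: is_derive1_comp.
  by apply: is_derive_eq; ring.
have [c cI] := MVT_is_derive x0 (fun z _ => d z).
rewrite oppr0 subrr subr0 addr0 => ->; rewrite normrM.
apply: ler_wpM2r => //; rewrite ger0_norm ?addr_ge0 ?expR_ge0//.
have := expR_ge1Dx c; have := expR_ge1Dx (- c); lra.
Qed.

(** From sin y = 2 sin (y/2) cos (y/2): both cos (y/2) and the derivative of sin
    on [0, y/2] are at least cos (Y/2). *)
Lemma cos_half_sqr_le_sin (Y y : R) : 0 < Y < pi -> `|y| <= Y ->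
  cos (Y / 2) ^+ 2 * `|y| <= `|sin y|.
Proof.
move=> /andP[Y0 Ypi].
wlog y0 : y / 0 <= y.
  move=> W; have [y0|/ltW y0] := leP 0 y; first exact: W.
  by have := W (- y); rewrite oppr_ge0 sinN !normrN; exact.
rewrite ger0_norm// => yY.
have cmon (z w : R) : 0 <= z -> z <= w -> w <= pi -> cos w <= cos z.
  move=> z0 zw wp; rewrite leNgt; apply/negP => czw.
  by move: czw; rewrite ltr_cos ?in_itv/= ?ltNge ?zw//; apply/andP; split; lra.
have sp : 0 <= sin y by apply: sin_ge0_pi; apply/andP; split; lra.
rewrite (ger0_norm sp).
have [c /[!in_itv]/= cI] := @MVT_is_derive (@sin R) cos 0 (y / 2) ltac:(lra) (fun z _ => is_derive_sin z).
rewrite sin0 !subr0 => sE.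
have cY : cos (Y / 2) <= cos c by apply: cmon; lra.
have cY' : cos (Y / 2) <= cos (y / 2) by apply: cmon; lra.
have cp : 0 < cos (Y / 2) by apply: cos_gt0_pihalf; lra.
have -> : sin y = 2 * sin (y / 2) * cos (y / 2).
  by rewrite [in LHS](_ : y = y / 2 + y / 2) ?sinD; [ring|lra].
rewrite sE.
have := ler_pM (ltW cp) (ltW cp) cY cY'; nra.
Qed.

End calculus.

Section kernel.
Context {R : realType}.

(** - 2 sinh (x + i y) *)
Definition csinh2 (x y : R) : R[i] := cexp (- 1) x y - cexp 1 x y.

Lemma re_csinh2 x y : re (csinh2 x y) = (expR (- x) - expR x) * cos y.
Proof. by rewrite /csinh2 !ReImE /re/= !mulN1r !mul1r cosN; ring. Qed.

Lemma im_csinh2 x y : im (csinh2 x y) = - (expR (- x) + expR x) * sin y.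
Proof. by rewrite /csinh2 !ReImE /im/= !mulN1r !mul1r sinN; ring. Qed.

Lemma sqr_cabs_csinh2 x y :
  cabs (csinh2 x y) ^+ 2 = (expR x - expR (- x)) ^+ 2 + 4 * sin y ^+ 2.
Proof.
rewrite sqr_cabs re_csinh2 im_csinh2.
have := cos2Dsin2 y; have : expR x * expR (- x) = 1 by rewrite expRxMexpNx_1.
set e := expR x; set e' := expR _; set c := cos y; set s := sin y => ee cs.
rewrite !exprMn (_ : c ^+ 2 = 1 - s ^+ 2); last by lra.
have -> : e' = e^-1.
  have e0 : e != 0 by rewrite /e gt_eqF// expR_gt0.
  by apply: (mulfI e0); rewrite ee divff.
have e0 : e != 0 by rewrite /e gt_eqF// expR_gt0.
by field.
Qed.

Lemma cabs_csinh2_ge_x x y : 2 * `|x| <= cabs (csinh2 x y).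
Proof.
apply: (le_trans (expR_half_le x)).
rewrite -(@ler_pXn2r _ 2) ?nnegrE ?cabs_ge0// sqr_cabs_csinh2.
by rewrite real_normK ?num_real// lerDl mulr_ge0// sqr_ge0.
Qed.

Lemma cabs_csinh2_ge_sin x y : 2 * `|sin y| <= cabs (csinh2 x y).
Proof.
rewrite -(@ler_pXn2r _ 2) ?nnegrE ?cabs_ge0 ?mulr_ge0// sqr_cabs_csinh2.
rewrite exprMn real_normK ?num_real// (_ : 2 ^+ 2 = 4); last by ring.
by rewrite lerDr sqr_ge0.
Qed.

Lemma cabs_csinh2_ge_exp x y : expR `|x| * `|sin y| <= cabs (csinh2 x y).
Proof.
have L : (expR x + expR (- x)) * `|sin y| <= cabs (csinh2 x y).
  rewrite -(@ler_pXn2r _ 2) ?nnegrE ?cabs_ge0 ?mulr_ge0 ?addr_ge0 ?expR_ge0//.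
  rewrite exprMn real_normK ?num_real// sqr_cabs_csinh2.
  have := cos2Dsin2 y; have : expR x * expR (- x) = 1 by rewrite expRxMexpNx_1.
  set e := expR x; set e' := expR _; set c := cos y; set s := sin y => ee cs.
  have s1 : s ^+ 2 <= 1 by have := sqr_ge0 c; lra.
  have : 0 <= (e - e') ^+ 2 * (1 - s ^+ 2) by rewrite mulr_ge0 ?sqr_ge0// subr_ge0.
  have -> : (e + e') ^+ 2 = (e - e') ^+ 2 + 4 * (e * e') by ring.
  rewrite ee; lra.
apply: le_trans L; apply: ler_wpM2r => //.
have := expR_ge0 x; have := expR_ge0 (- x).
by case: (ger0P x) => _; lra.
Qed.

(** - 1 / sinh (x + i y), with a simple pole of residue - 1 at the origin. *)
Definition ckernel (x y : R) : R[i] := 2 * (csinh2 x y)^-1.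

Lemma im_ckernel x y : im (ckernel x y) =
  2 * (expR (- x) + expR x) * sin y /
  ((expR x - expR (- x)) ^+ 2 + 4 * sin y ^+ 2).
Proof.
rewrite /ckernel imM reV imV sqr_cabs_csinh2 im_csinh2.
have -> : re (2 : R[i]) = 2 by rewrite /re/=; ring.
have -> : im (2 : R[i]) = 0 by rewrite /im/=; ring.
by ring.
Qed.

Lemma cabs_ckernel x y : cabs (ckernel x y) = 2 / cabs (csinh2 x y).
Proof.
rewrite /ckernel cabsM cabsV; congr (_ * _).
have -> : 2 = (2%:C)%C :> R[i] by apply/eqP; rewrite eq_complex/= addr0 !eqxx.
by rewrite cabs_real ger0_norm.
Qed.

Lemma im_ckernel0 x : im (ckernel x 0) = 0.
Proof. by rewrite im_ckernel sin0 mulr0 mul0r. Qed.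

Definition ckernel' (x y : R) : R[i] :=
  2 * (cexp (- 1) x y + cexp 1 x y) / csinh2 x y ^+ 2.

Lemma holo_csinh2 x y :
  holo_at csinh2 (fun u v => - (cexp (- 1) u v + cexp 1 u v)) x y.
Proof.
have := @holo_add _ _ _ _ _ x y (holo_cexp (-1) x y)
   (holo_mul (holo_cst (-1) x y) (holo_cexp 1 x y)).
rewrite (_ : (fun u v : R => cexp (-1) u v + -1 * cexp 1 u v) = csinh2); last first.
  by apply/funext => u; apply/funext => v; rewrite mulN1r.
apply: holo_eq.
have -> : (-1)%:C%C = -1 :> R[i] by rewrite rmorphN1.
have -> : 1%:C%C = 1 :> R[i] by [].
by rewrite mul0r mul1r; ring.
Qed.

Lemma holo_ckernel x y : csinh2 x y != 0 -> holo_at ckernel ckernel' x y.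
Proof.
move=> s0.
have := holo_mul (holo_cst 2 x y) (holo_inv s0 (holo_csinh2 x y)).
apply: holo_eq; rewrite /ckernel' mul0r add0r.
by rewrite -[RHS]mulrA; congr (_ * _); congr (_ / _); ring.
Qed.

Lemma cabs_ckernel'_le x y :
  cabs (ckernel' x y) <= 4 * expR `|x| / cabs (csinh2 x y) ^+ 2.
Proof.
have E2 : cabs (csinh2 x y ^+ 2) = cabs (csinh2 x y) ^+ 2 by rewrite !expr2 cabsM.
rewrite /ckernel' cabsM cabsV E2.
apply: ler_wpM2r; first by rewrite invr_ge0 sqr_ge0.
rewrite cabsM.
have -> : 2 = (2%:C)%C :> R[i] by apply/eqP; rewrite eq_complex/= addr0 !eqxx.
rewrite cabs_real ger0_norm// (_ : 4 = 2 * 2); last by ring.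
rewrite -mulrA ler_pM2l//; apply: (le_trans (le_cabsD _ _)).
rewrite !cabs_cexp mulN1r mul1r.
have L1 : expR (- x) <= expR `|x| by rewrite ler_expR -normrN ler_norm.
have L2 : expR x <= expR `|x| by rewrite ler_expR ler_norm.
lra.
Qed.

End kernel.

(** * Integration over the real line *)
Section real_integrability.
Context d (T : measurableType d) (R : realType) (m : {measure set T -> \bar R}).
Variables (D : set T) (mD : measurable D).
Implicit Types (f g : T -> R).

Lemma integrable_fctD f g : m.-integrable D (EFin \o f) ->
  m.-integrable D (EFin \o g) -> m.-integrable D (EFin \o (fun x => f x + g x)).
Proof. by move=> i1 i2; exact: (integrableD mD i1 i2). Qed.

Lemma integrable_fctB f g : m.-integrable D (EFin \o f) ->
  m.-integrable D (EFin \o g) -> m.-integrable D (EFin \o (fun x => f x - g x)).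
Proof. by move=> i1 i2; exact: (integrableB mD i1 i2). Qed.

Lemma integrable_fctZ (k : R) f : m.-integrable D (EFin \o f) ->
  m.-integrable D (EFin \o (fun x => k * f x)).
Proof. by move=> i1; exact: (integrableZl mD k i1). Qed.

Lemma le_integrable_fct f g : measurable_fun D f ->
  (forall x, D x -> `|f x| <= g x) -> m.-integrable D (EFin \o g) ->
  m.-integrable D (EFin \o f).
Proof.
move=> mf fg; apply: le_integrable => //; first exact/measurable_EFinP.
by move=> x Dx; rewrite /= lee_fin (le_trans (fg _ Dx))// ler_norm.
Qed.

Lemma measurable_integrable f : m.-integrable D (EFin \o f) -> measurable_fun D f.
Proof. by move=> /integrableP[/measurable_EFinP]. Qed.

Lemma ge0_integrable_fct f (M : R) : measurable_fun D f -> (forall x, D x -> 0 <= f x) ->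
  (\int[m]_(x in D) (f x)%:E <= M%:E)%E -> m.-integrable D (EFin \o f).
Proof.
move=> mf f0 leM; apply/integrableP; split; first exact/measurable_EFinP.
apply: (le_lt_trans _ (ltry M)); apply: le_trans leM.
rewrite le_eqVlt; apply/orP; left; apply/eqP; apply: eq_integral => x /set_mem Dx.
by rewrite gee0_abs// lee_fin f0.
Qed.

End real_integrability.

Section lebesgue_affine.
Context {R : realType}.
Local Notation mu := (@lebesgue_measure R).
Local Open Scope ereal_scope.

Lemma measurable_fun_shift (a : R) :
  measurable_fun [set: measurableTypeR R] (fun x : measurableTypeR R => (x : R) + a : measurableTypeR R)%R.
Proof. by apply: measurable_funD => //; exact: measurable_cst. Qed.

Lemma measurable_fun_scale (s : R) :
  measurable_fun [set: measurableTypeR R] (fun x : measurableTypeR R => s * (x : R) : measurableTypeR R)%R.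
Proof. by apply: measurable_funM => //; exact: measurable_cst. Qed.

(** The shifted measure agrees with Lebesgue measure on intervals, which determine
    it. *)
Lemma lebesgue_measure_shift (a : R) (A : set R) : measurable A ->
  pushforward mu (fun x : R => x + a : measurableTypeR R)%R A = mu A.
Proof.
move=> mA; apply/esym.
have ma := measurable_fun_shift a.
pose h : {mfun (measurableTypeR R) >-> measurableTypeR R} := HB.pack (fun x : measurableTypeR R => (x : R) + a : measurableTypeR R)%R (isMeasurableFun.Build _ _ _ _ _ ma).
apply: (@lebesgue_measure_unique R (pushforward mu h)) => //= _ [[p q]] _ <-.
rewrite /pushforward/=.
have -> : (fun x : R => x + a)%R @^-1` [set` `]p, q]] = [set` `](p - a)%R, (q - a)%R]].
  by apply/seteqP; split => x /=; rewrite !in_itv/= ltrBlDr lerBrDr.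
rewrite !lebesgue_measure_itv/= !lte_fin ltrD2r.
by case: ifPn => // _; rewrite -!EFinD; congr EFin; ring.
Qed.

Lemma ge0_integral_shift (a : R) (f : R -> \bar R) :
  measurable_fun [set: R] f -> (forall x, 0 <= f x) ->
  \int[mu]_x f (x + a)%R = \int[mu]_x f x.
Proof.
move=> mf f0.
have := @ge0_integral_pushforward _ _ _ _ R _ (measurable_fun_shift a) mu setT f measurableT mf (fun y _ => f0 y).
rewrite preimage_setT => <-.
apply: eq_measure_integral; first exact: measurable_fun_shift.
by move=> ma A mA _; exact: lebesgue_measure_shift.
Qed.

Lemma lebesgue_measure_scale (s : R) (A : set R) : (0 < s)%R -> measurable A ->
  mu A = s%:E * pushforward mu (fun x : R => s * x : measurableTypeR R)%R A.
Proof.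
move=> s0 mA.
have ma := measurable_fun_scale s.
pose h : {mfun (measurableTypeR R) >-> measurableTypeR R} := HB.pack (fun x : measurableTypeR R => s * (x : R) : measurableTypeR R)%R (isMeasurableFun.Build _ _ _ _ _ ma).
pose k : {nonneg R} := NngNum (ltW s0).
rewrite (@lebesgue_measure_unique R (mscale k (pushforward mu h)))//= => _ [[p q]] _ <-.
rewrite /mscale/= /pushforward/=.
have -> : (fun x : R => s * x)%R @^-1` [set` `]p, q]] = [set` `](p / s)%R, (q / s)%R]].
  by apply/seteqP; split => x /=; rewrite !in_itv/= ltr_pdivrMr// ler_pdivlMr// mulrC.
rewrite !lebesgue_measure_itv/= !lte_fin ltr_pM2r ?invr_gt0//.
case: ifPn => // _; last by rewrite mule0.
by rewrite -!EFinD -EFinM; congr EFin; field; rewrite gt_eqF.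
Qed.

Lemma ge0_integral_scale (s : R) (f : R -> \bar R) : (0 < s)%R ->
  measurable_fun [set: R] f -> (forall x, 0 <= f x) ->
  \int[mu]_x f x = s%:E * \int[mu]_x f (s * x)%R.
Proof.
move=> s0 mf f0.
have ma := measurable_fun_scale s.
have := @ge0_integral_pushforward _ _ _ _ R _ ma mu setT f measurableT mf (fun y _ => f0 y).
rewrite preimage_setT => <-.
pose h : {mfun (measurableTypeR R) >-> measurableTypeR R} := HB.pack (fun x : measurableTypeR R => s * (x : R) : measurableTypeR R)%R (isMeasurableFun.Build _ _ _ _ _ ma).
pose k : {nonneg R} := NngNum (ltW s0).
have := @ge0_integral_mscale _ _ _ (pushforward mu h) setT measurableT k f mf (fun x _ => f0 x).
move=> <-.
by apply: eq_measure_integral => A mA _; exact: lebesgue_measure_scale.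
Qed.

End lebesgue_affine.

Section exponential_integrals.
Context {R : realType}.
Local Notation mu := (@lebesgue_measure R).

Lemma is_derive_expM (k x : R) : is_derive x 1 (fun u : R => expR (k * u)) (k * expR (k * x)).
Proof.
have dl : is_derive x 1 ( *%R k) k.
  by apply: is_derive_eq; rewrite /GRing.scale/=; ring.
have := @is_derive1_comp _ expR ( *%R k) x _ _ (is_derive_expR (k * x)) dl.
by rewrite mulrC.
Qed.

Lemma continuous_expM (k : R) : continuous (fun u : R => expR (k * u)).
Proof.
move=> x; apply: differentiable_continuous; apply/derivable1_diffP.
by have [] := is_derive_expM k x.
Qed.

Lemma measurable_expM (k : R) (D : set R) : measurable_fun D (fun u : R => expR (k * u)).
Proof.
apply: (measurable_funS measurableT) => //.
by apply: continuous_measurable_fun; exact: continuous_expM.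
Qed.

Lemma expM_cvgy (d : R) : 0 < d -> expR (- d * x) @[x --> +oo] --> (0 : R).
Proof.
move=> d0.
under eq_fun do rewrite mulNr.
have h : d * x @[x --> +oo] --> +oo by apply: gt0_cvgMry => //; exact: cvg_id.
exact: (cvg_comp _ _ h (@cvgr_expR R)).
Qed.

Lemma integral_expM (d : R) : 0 < d ->
  (\int[mu]_(x in `[0%R, +oo[) (expR (- d * x))%:E = (d^-1)%:E)%E.
Proof.
move=> d0.
have dF (x : R) : is_derive x 1 (fun x : R => - d^-1 * expR (- d * x)) (expR (- d * x)).
  have h := is_derive_expM (- d) x.
  apply: is_derive_eq; rewrite /GRing.scale/=; field.
  by rewrite gt_eqF.
rewrite (@ge0_continuous_FTC2y _ _ (fun x : R => - d^-1 * expR (- d * x)) _ 0).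
- by rewrite mulr0 expR0 mulr1 sub0e EFinN oppeK.
- by move=> x _; exact: expR_ge0.
- by apply: continuous_subspaceT; exact: continuous_expM.
- rewrite -[X in _ --> X](mulr0 (- d^-1)); apply: cvgM; first exact: cvg_cst.
  exact: expM_cvgy.
- by move=> x _; have [] := dF x.
- apply: cvg_at_right_filter.
  by apply: cvgM; [exact: cvg_cst|exact: continuous_expM].
- by move=> x _; rewrite derive1E; exact: (@derive_val _ _ _ _ _ _ _ (dF x)).
Qed.

Lemma continuous_expM_norm (d m : R) : continuous (fun x : R => expR (- d * `|x - m|)).
Proof.
move=> x; apply: (@continuous_comp _ _ _ (fun x : R => `|x - m|) (fun u => expR (- d * u))); last exact: continuous_expM.
apply: (@continuous_comp _ _ _ (fun x : R => x - m) Num.norm); last exact: norm_continuous.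
by apply: cvgB; [exact: cvg_id|exact: cvg_cst].
Qed.

Lemma integral_expM_norm (d m : R) : 0 < d ->
  (\int[mu]_x (expR (- d * `|x - m|))%:E = (2 / d)%:E)%E.
Proof.
move=> d0.
rewrite (@ge0_integral_shift _ (- m) (fun x => (expR (- d * `|x|))%:E)); last first.
- by move=> x; rewrite lee_fin expR_ge0.
- apply/measurable_EFinP; apply: continuous_measurable_fun.
  by have := @continuous_expM_norm d 0; under eq_fun do rewrite subr0.
rewrite (@ge0_symfun_integralT _ (fun x => expR (- d * `|x|))).
- rewrite -set_itvcy (@eq_integral _ _ _ mu _ (fun x => (expR (- d * x))%:E)).
    by rewrite integral_expM// -EFinM.
  by move=> x; rewrite inE/= in_itv/= andbT => x0; rewrite ger0_norm.
- by move=> x; exact: expR_ge0.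
- by have := @continuous_expM_norm d 0; under eq_fun do rewrite subr0.
- by move=> x /=; rewrite normrN.
Qed.

Lemma integrable_expM_norm (d m C : R) : 0 < d ->
  mu.-integrable setT (EFin \o (fun x => C * expR (- d * `|x - m|))).
Proof.
move=> d0; under [X in _.-integrable _ X]eq_fun do rewrite /= EFinM.
apply: integrableZl => //; apply/integrableP; split.
  by apply/measurable_EFinP; apply: continuous_measurable_fun; exact: continuous_expM_norm.
under eq_integral do rewrite gee0_abs ?lee_fin ?expR_ge0//.
by rewrite integral_expM_norm// ltry.
Qed.

Lemma Rintegral_expM_norm (d m C : R) : 0 < d ->
  \int[mu]_x (C * expR (- d * `|x - m|)) = C * (2 / d).
Proof.
move=> d0; rewrite RintegralZl//; last first.
  by have := integrable_expM_norm m 1 d0; under eq_fun do rewrite /= mul1r.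
by rewrite /Rintegral integral_expM_norm.
Qed.

Lemma dominated_Rintegral (D : set R) (f : nat -> R -> R) (g G : R -> R) :
  measurable D -> (forall n, measurable_fun D (f n)) ->
  mu.-integrable D (EFin \o G) ->
  {ae mu, forall x, D x -> f n x @[n --> \oo] --> g x} ->
  measurable_fun D g ->
  (forall n x, D x -> `|f n x| <= G x) ->
  mu.-integrable D (EFin \o g) /\
  \int[mu]_(x in D) f n x @[n --> \oo] --> \int[mu]_(x in D) g x.
Proof.
move=> mD mf iG fg mg leG.
have mf' n : measurable_fun D (EFin \o f n) by exact/measurable_EFinP.
have fg' : {ae mu, forall x, D x -> (EFin \o f n) x @[n --> \oo] --> (EFin \o g) x}.
  move: fg => [N [mN N0 sN]]; exists N; split => // x /= nx; apply: sN => /= h; apply: nx => Dx.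
  exact: (cvg_comp _ _ (h Dx)).
have leG' : {ae mu, forall x n, D x -> (`|(EFin \o f n) x| <= (EFin \o G) x)%E}.
  by apply: aeW => x n Dx; rewrite /= lee_fin leG.
have [ig _ cvg] := @dominated_convergence _ _ _ mu D mD (fun n => EFin \o f n) (EFin \o g) (EFin \o G) mf' (proj2 (measurable_EFinP _ _) mg) fg' iG leG'.
split => //.
have fin : (\int[mu]_(x in D) (EFin \o g) x)%E \is a fin_num by exact: integrable_fin_num.
rewrite -(fineK fin) in cvg.
exact: (fine_cvg cvg).
Qed.

Lemma cvg_Rintegral_segment (f : R -> R) : mu.-integrable setT (EFin \o f) ->
  \int[mu]_(x in `[- n%:R, n%:R]) f x @[n --> \oo] --> \int[mu]_x f x.
Proof.
move=> If.
under eq_fun do rewrite Rintegral_mkcond.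
have mf : measurable_fun setT f by have /integrableP[/measurable_EFinP] := If.
apply: (proj2 (@dominated_Rintegral setT _ f (fun x => `|f x|) _ _ _ _ _ _)) => //.
- by move=> n; apply/(measurable_restrictT f) => //; exact: measurable_funTS.
- exact: integrable_norm.
- apply: aeW => x _; apply: cvg_near_cst; near=> n.
  rewrite patchE ifT// inE/= in_itv/= -ler_norml.
  near: n; exact: nbhs_infty_ger.
- by move=> n x _; rewrite patchE; case: ifP => // _; rewrite normr0.
Unshelve. all: end_near. Qed.

Lemma is_derive_under_Rintegral (f f' : R -> R -> R) (D : set R) (a u v : R)
    (g : R -> R) : measurable D -> u < a < v ->
  (forall z, u < z < v -> mu.-integrable D (EFin \o f z)) ->
  (forall z x : R, u < z < v -> D x -> is_derive z 1 (f ^~ x) (f' z x)) ->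
  (forall x, 0 <= g x) -> mu.-integrable D (EFin \o g) ->
  (forall z x, u < z < v -> D x -> `|f' z x| <= g x) ->
  is_derive a 1 (fun z => \int[mu]_(x in D) f z x) (\int[mu]_(x in D) f' a x).
Proof.
move=> mD auv intf df g0 intg leg.
have uvE (z : R) : `]u, v[%classic z -> u < z < v by rewrite /= in_itv.
have Ia : `]u, v[%classic a by rewrite /= in_itv.
have d1E (z x : R) : u < z < v -> D x -> partial1of2 f z x = f' z x.
  by move=> zI Dx; rewrite partial1of2E; exact: (@derive_val _ _ _ _ _ _ _ (df z x zI Dx)).
have H1 z : `]u, v[%classic z -> mu.-integrable D (EFin \o f z).
  by move=> /uvE; exact: intf.
have H2 (z x : R) : `]u, v[%classic z -> D x -> derivable (f ^~ x) z 1.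
  by move=> /uvE zI Dx; have [] := df z x zI Dx.
have H4 (z x : R) : `]u, v[%classic z -> D x -> `|partial1of2 f z x| <= g x.
  by move=> /uvE zI Dx; rewrite d1E// leg.
apply: DeriveDef.
  exact: (@derivable_under_integral R _ _ mu f D mD a u v Ia H1 H2 g g0 intg H4).
rewrite -derive1E (@differentiation_under_integral R _ _ mu f D mD a u v Ia H1 H2 g g0 intg H4).
by apply: eq_Rintegral => x /set_mem Dx; exact: d1E.
Qed.

End exponential_integrals.

(** * A residue theorem in a strip *)
Section complex_continuity.
Context {R : realType}.
Implicit Types (f g : R -> R[i]) (x : R).

Definition ccont f x := {for x, continuous (fun u => re (f u))} /\
  {for x, continuous (fun u => im (f u))}.

Lemma ccontD f g x : ccont f x -> ccont g x -> ccont (fun u => f u + g u) x.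
Proof.
move=> [fr fi] [gr gi]; split.
  rewrite (_ : (fun u => re (f u + g u)) = fun u => re (f u) + re (g u)).
    exact: continuousD.
  by apply/funext => u; rewrite reD.
rewrite (_ : (fun u => im (f u + g u)) = fun u => im (f u) + im (g u)).
  exact: continuousD.
by apply/funext => u; rewrite imD.
Qed.

Lemma ccontM f g x : ccont f x -> ccont g x -> ccont (fun u => f u * g u) x.
Proof.
move=> [fr fi] [gr gi]; split.
  rewrite (_ : (fun u => re (f u * g u)) =
      fun u => re (f u) * re (g u) - im (f u) * im (g u)).
    by apply: continuousB; exact: continuousM.
  by apply/funext => u; rewrite reM.
rewrite (_ : (fun u => im (f u * g u)) =
    fun u => re (f u) * im (g u) + im (f u) * re (g u)).
  by apply: continuousD; exact: continuousM.
by apply/funext => u; rewrite imM.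
Qed.

Lemma holo_ccont (f f' : R -> R -> R[i]) x y : holo_at f f' x y -> ccont (f ^~ y) x.
Proof.
by move=> [fr fi _ _]; split; [exact: is_derive_continuous fr|exact: is_derive_continuous fi].
Qed.

Lemma ccont_cst (c : R[i]) x : ccont (fun=> c) x.
Proof. by split; exact: cst_continuous. Qed.

End complex_continuity.

Section segment_integrals.
Context {R : realType}.
Local Notation mu := (@lebesgue_measure R).

Lemma continuous_integrable_segment (f : R -> R) (a b : R) : continuous f ->
  mu.-integrable `[a, b] (EFin \o f).
Proof.
move=> cf; apply: continuous_compact_integrable; first exact: segment_compact.
exact: continuous_subspaceT.
Qed.

Lemma Rintegral_is_derive (F f : R -> R) (a b : R) : a < b ->
  (forall x : R, is_derive x 1 F (f x)) -> continuous f ->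
  \int[mu]_(x in `[a, b]) f x = F b - F a.
Proof.
move=> ab dF cf.
have cF : continuous F by move=> x; exact: is_derive_continuous (dF x).
rewrite /Rintegral (@continuous_FTC2 _ f F)//.
- exact: continuous_subspaceT.
- split.
  + by move=> x _; have [] := dF x.
  + exact/cvg_at_right_filter/cF.
  + exact/cvg_at_left_filter/cF.
- by move=> x _; rewrite derive1E; exact: (@derive_val _ _ _ _ _ _ _ (dF x)).
Qed.

End segment_integrals.

Section kernel_mass.
Context {R : realType}.
Local Notation mu := (@lebesgue_measure R).

Let primitive (y x : R) : R := atan ((expR x - expR (- x)) / (2 * sin y)).

Let is_derive_atan_primitive (x y : R) : sin y != 0 ->
  is_derive x 1 (primitive y) (im (ckernel x y)).
Proof.
move=> s0; have n0 : (expR x - expR (- x)) ^+ 2 + 4 * sin y ^+ 2 != 0.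
  rewrite gt_eqF// ltr_wpDl ?sqr_ge0// mulr_gt0//.
  by rewrite lt_neqAle sqr_ge0 andbT eq_sym sqrf_eq0.
have dn : is_derive x 1 (fun u : R => expR (- u)) (- expR (- x)).
  have := is_derive_expM (-1) x; rewrite (_ : (fun u : R => expR (- 1 * u)) = (fun u : R => expR (- u))).
    by rewrite !mulN1r.
  by apply/funext => u; rewrite mulN1r.
have dg : is_derive x 1 (fun u : R => (expR u - expR (- u)) / (2 * sin y))
    ((expR x + expR (- x)) / (2 * sin y)).
  have h : is_derive x 1 (fun u : R => (2 * sin y)^-1 *: (expR u - expR (- u)))
      ((2 * sin y)^-1 *: (expR x - - expR (- x))) by exact: is_deriveZ.
  rewrite opprK in h.
  rewrite (_ : (fun u : R => _) = (fun u : R => (2 * sin y)^-1 *: (expR u - expR (- u)))).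
    by apply: is_derive_eq; rewrite /GRing.scale/= mulrC.
  by apply/funext => u; rewrite /GRing.scale/= mulrC.
have h := @is_derive1_comp _ (@atan R) _ x _ _ (is_derive1_atan _) dg.
rewrite im_ckernel; apply: (@is_derive_eq _ _ _ _ _ _ _ _ h).
have -> : 1 + ((expR x - expR (- x)) / (2 * sin y)) ^+ 2 =
    ((expR x - expR (- x)) ^+ 2 + 4 * sin y ^+ 2) / (2 * sin y) ^+ 2 by field.
move: n0; set D := _ + 4 * _ => n0.
by field; rewrite s0 n0.
Qed.

Lemma continuous_im_ckernel (y : R) : sin y != 0 -> continuous (fun x => im (ckernel x y)).
Proof.
move=> s0 x; have D0 : csinh2 x y != 0.
  rewrite -cabs_eq0 gt_eqF//; apply: lt_le_trans (cabs_csinh2_ge_sin x y).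
  by rewrite mulr_gt0// normr_gt0.
by have [_] := holo_ccont (holo_ckernel D0).
Qed.

(** The primitive atan (sinh x / sin y) increases by pi whatever the height y is;
    this is half of 2 pi, as the lines at heights y and - y together enclose the
    pole. *)
Lemma integral_im_ckernel (y : R) : 0 < y < pi ->
  mu.-integrable setT (EFin \o (fun x => im (ckernel x y))) /\
  \int[mu]_x im (ckernel x y) = pi.
Proof.
move=> ypi; have sp : 0 < sin y by exact: sin_gt0_pi.
have s0 : sin y != 0 by rewrite gt_eqF.
have ck := continuous_im_ckernel s0.
have k0 x : 0 <= im (ckernel x y).
  rewrite im_ckernel; apply: divr_ge0.
    by rewrite !mulr_ge0 ?addr_ge0 ?expR_ge0// ltW.
  by rewrite addr_ge0 ?sqr_ge0// mulr_ge0// sqr_ge0.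
have kN : (fun x => im (ckernel x y)) =1 (fun x => im (ckernel x y)) \o -%R.
  by move=> x; rewrite fctE !im_ckernel opprK; congr (_ / _); ring.
have I : (\int[mu]_x (im (ckernel x y))%:E = pi%:E)%E.
  rewrite (@ge0_symfun_integralT _ _ k0 ck kN) -set_itvcy.
  rewrite (@ge0_continuous_FTC2y _ _ (primitive y) _ (pi / 2)).
  - rewrite /primitive oppr0 subrr mul0r atan0 sube0 -EFinM; congr EFin; by field.
  - by move=> x _; exact: k0.
  - exact: continuous_subspaceT.
  - have h : (expR x - expR (- x)) / (2 * sin y) @[x --> +oo%R] --> +oo%R.
      apply: gt0_cvgMly; first by rewrite invr_gt0 mulr_gt0.
      apply: ger_cvgy (@cvg_id _ _).
      near=> x; have x1 : 1 <= x by near: x; apply: nbhs_pinfty_ge; exact: num_real.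
      have := expR_half_le x; rewrite (@ger0_norm _ x) ?ger0_norm; [lra| |lra].
      by rewrite subr_ge0 ler_expR; lra.
    exact: (cvg_comp _ _ h (@cvgy_atan R)).
  - by move=> x _; have [] := is_derive_atan_primitive x s0.
  - apply: cvg_at_right_filter.
    exact: (is_derive_continuous (is_derive_atan_primitive 0 s0)).
  - by move=> x _; rewrite derive1E; exact: (@derive_val _ _ _ _ _ _ _ (is_derive_atan_primitive x s0)).
split; last by rewrite /Rintegral I.
apply/integrableP; split; first by apply/measurable_EFinP; exact: continuous_measurable_fun.
under eq_integral do rewrite gee0_abs ?lee_fin//.
by rewrite I ltry.
Unshelve. all: end_near. Qed.

End kernel_mass.

Section strip_cauchy.
Context {R : realType}.
Local Notation mu := (@lebesgue_measure R).
Variables (Y delta B : R) (H H' : R -> R -> R[i]).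
Hypotheses (Y0pi : 0 < Y < pi) (delta01 : 0 < delta <= 1).
Hypothesis holoH : forall x y : R, `|y| < Y -> holo_at H H' x y.
Hypothesis contH' : forall x y : R, `|y| < Y -> ccont (H' ^~ y) x.
Hypothesis leH : forall x y : R, `|y| < Y -> cabs (H x y) <= B * expR ((1 - delta) * `|x|).
Hypothesis leH' : forall x y : R, `|y| < Y -> cabs (H' x y) <= B * expR ((1 - delta) * `|x|).
Hypothesis realH : forall x, im (H x 0) = 0.

Let H0 := H 0 0.
(* The pole of the kernel is cancelled by the zero of H - H(0). *)
Let M (x y : R) := (H x y - H0) * ckernel x y.
Let M' (x y : R) := H' x y * ckernel x y + (H x y - H0) * ckernel' x y.
Let c := cos (Y / 2) ^+ 2.

Let Y0 : 0 < Y. Proof. by case/andP: Y0pi. Qed.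
Let Ypi : Y < pi. Proof. by case/andP: Y0pi. Qed.
Let delta1 : delta <= 1. Proof. by case/andP: delta01. Qed.

Let norm0Y : `|0 : R| < Y. Proof. by rewrite normr0. Qed.

Let B0 : 0 <= B.
Proof.
have := le_trans (cabs_ge0 _) (leH 0 norm0Y).
by rewrite normr0 mulr0 expR0 mulr1.
Qed.

Let c_gt0 : 0 < c.
Proof. by rewrite exprn_gt0// cos_gt0_pihalf//; move: Y0 Ypi => ? ?; apply/andP; split; lra. Qed.

Let c_le1 : c <= 1.
Proof. by have := cos2Dsin2 (Y / 2); have := sqr_ge0 (sin (Y / 2)); rewrite /c; lra. Qed.

Let sin_ge y : `|y| < Y -> c * `|y| <= `|sin y|.
Proof. by move=> /ltW; exact: cos_half_sqr_le_sin. Qed.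

Let csinh2_neq0 (x y : R) : `|y| < Y -> (x != 0) || (y != 0) -> csinh2 x y != 0.
Proof.
move=> yY; rewrite -cabs_eq0 => /orP[x0|y0]; rewrite gt_eqF//.
  by apply: lt_le_trans (cabs_csinh2_ge_x x y); rewrite mulr_gt0// normr_gt0.
apply: lt_le_trans (cabs_csinh2_ge_sin x y).
by rewrite mulr_gt0//; apply: lt_le_trans (sin_ge yY); rewrite mulr_gt0// normr_gt0.
Qed.

Let holoM (x y : R) : `|y| < Y -> (x != 0) || (y != 0) -> holo_at M M' x y.
Proof.
move=> yY xy.
have h1 := holo_add (holoH x yY) (holo_cst (- H0) x y).
have h2 := holo_ckernel (csinh2_neq0 yY xy).
have := holo_mul h1 h2; rewrite /M /M'; apply: holo_eq.
by rewrite addr0.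
Qed.

Let le_HB0 x y : `|y| < Y ->
  cabs (H x y - H0) <= 2 * B * expR ((1 - delta) * `|x|).
Proof.
move=> yY; apply: (le_trans (le_cabsD _ _)); rewrite cabsN.
have := leH x yY; have := leH 0 norm0Y; rewrite normr0 mulr0 expR0.
have E1 : 1 <= expR ((1 - delta) * `|x|).
  by rewrite -[leLHS]expR0 ler_expR mulr_ge0// subr_ge0.
move=> h1 h2; have := ler_wpM2l B0 E1; rewrite -/H0 in h1 h2 *; lra.
Qed.

(** The Lipschitz bound is taken along the path (0, 0), (x, 0), (x, y). *)
Let le_HB0_lip (N x y : R) : `|y| < Y -> `|x| <= N ->
  cabs (H x y - H0) <= 4 * B * expR ((1 - delta) * N) * (`|x| + `|y|).
Proof.
move=> yY xN.
pose L := B * expR ((1 - delta) * N).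
have N0 : 0 <= N by exact: le_trans xN.
have leL u v : `|v| < Y -> `|u| <= N -> cabs (H' u v) <= L.
  move=> vY uN; apply: (le_trans (leH' u vY)); apply: ler_wpM2l => //.
  by rewrite ler_expR ler_wpM2l// subr_ge0.
have inY v : v \in `]-Y, Y[ -> `|v| < Y by rewrite in_itv/= ltr_norml.
have inN u : u \in `[-N, N] -> `|u| <= N by rewrite in_itv/= ler_norml.
have y_in : y \in `]-Y, Y[ by rewrite in_itv/= -ltr_norml.
have o_in : 0 \in `]-Y, Y[ by rewrite in_itv/= -ltr_norml.
have x_in : x \in `[-N, N] by rewrite in_itv/= -ler_norml.
have o_in' : 0 \in `[-N, N] by rewrite in_itv/= -ler_norml normr0.
have h1 : `|re (H x y) - re (H x 0)| <= L * `|y - 0|.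
  apply: (@lipschitz_derive R (fun v => re (H x v)) (fun v => - im (H' x v)) L _ _ _ o_in y_in).
    by move=> v /inY vY; case: (holoH x vY).
  by move=> v /inY vY; rewrite normrN (le_trans (normr_Im_le _))// leL.
have h2 : `|im (H x y) - im (H x 0)| <= L * `|y - 0|.
  apply: (@lipschitz_derive R (fun v => im (H x v)) (fun v => re (H' x v)) L _ _ _ o_in y_in).
    by move=> v /inY vY; case: (holoH x vY).
  by move=> v /inY vY; rewrite (le_trans (normr_Re_le _))// leL.
have h3 : `|re (H x 0) - re (H 0 0)| <= L * `|x - 0|.
  apply: (@lipschitz_derive R (fun v => re (H v 0)) (fun v => re (H' v 0)) L _ _ _ o_in' x_in).
    by move=> u _; case: (holoH u norm0Y).
  by move=> u /inN uN; rewrite (le_trans (normr_Re_le _))// leL.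
rewrite !subr0 in h1 h2 h3.
apply: (le_trans (cabs_le _)); rewrite !ReImE realH !subr0 /H0.
rewrite realH subr0 in h2.
have -> : re (H x y) - re (H 0 0) = (re (H x y) - re (H x 0)) + (re (H x 0) - re (H 0 0)) by ring.
have := ler_normD (re (H x y) - re (H x 0)) (re (H x 0) - re (H 0 0)).
have : 0 <= L * `|x| by rewrite !mulr_ge0// expR_ge0.
have : 0 <= L * `|y| by rewrite !mulr_ge0// expR_ge0.
rewrite -[4 * B * _]mulrA -/L; lra.
Qed.

(** Near the pole both |H - H(0)| and |sinh| are of the order of |x| + |y|. *)
Let M_le_near (N x y : R) : `|y| < Y -> (x != 0) || (y != 0) -> `|x| <= N ->
  cabs (M x y) <= 8 * B * expR ((1 - delta) * N) / c.
Proof.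
move=> yY xy xN; rewrite /M cabsM cabs_ckernel.
set D := cabs (csinh2 x y).
have D0 : 0 < D by rewrite lt_neqAle cabs_ge0 andbT eq_sym cabs_eq0; exact: csinh2_neq0.
have Dge : c * (`|x| + `|y|) <= D.
  have := cabs_csinh2_ge_x x y; have := cabs_csinh2_ge_sin x y; rewrite -/D.
  have := sin_ge yY; have : 0 <= (1 - c) * `|x| by rewrite mulr_ge0// subr_ge0.
  lra.
rewrite mulrA ler_pdivrMr//.
apply: (le_trans (ler_wpM2r _ (le_HB0_lip yY xN))) => //.
have K0 : 0 <= 8 * B * expR ((1 - delta) * N) by rewrite !mulr_ge0// expR_ge0.
rewrite -[leRHS]mulrA.
have : `|x| + `|y| <= c^-1 * D by rewrite mulrC ler_pdivlMr// mulrC.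
by move=> /(ler_wpM2l K0); lra.
Qed.

(** Away from the pole 1 / sinh decays like e^(-|x|), faster than H grows. *)
Let M_le_far x y : `|y| < Y -> y != 0 ->
  cabs (M x y) <= 4 * B / `|sin y| * expR (- (delta * `|x|)).
Proof.
move=> yY y0; rewrite /M cabsM cabs_ckernel.
have s0 : 0 < `|sin y|.
  by apply: lt_le_trans (sin_ge yY); rewrite mulr_gt0// normr_gt0.
have D := cabs_csinh2_ge_exp x y.
have E0 : 0 < expR `|x| * `|sin y| by rewrite mulr_gt0// expR_gt0.
have -> : 4 * B / `|sin y| * expR (- (delta * `|x|)) =
  2 * B * expR ((1 - delta) * `|x|) * (2 / (expR `|x| * `|sin y|)).
  rewrite mulrBl mul1r expRD; field.
  by rewrite !gt_eqF// expR_gt0.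
apply: ler_pM => //; rewrite ?cabs_ge0 ?divr_ge0 ?cabs_ge0//.
  exact: le_HB0.
by rewrite ler_pM2l// lef_pV2// posrE (lt_le_trans E0).
Qed.

Let M'_le (N e x y : R) : `|y| < Y -> 0 < e -> e <= `|y| -> `|x| <= N ->
  cabs (M' x y) <= B * expR ((1 - delta) * N) / (c * e) +
    2 * B * expR ((1 - delta) * N) * (expR N / (c * e) ^+ 2).
Proof.
move=> yY e0 ey xN.
have N0 : 0 <= N by exact: le_trans xN.
have d1 : 0 <= 1 - delta by rewrite subr_ge0.
have EN : expR ((1 - delta) * `|x|) <= expR ((1 - delta) * N).
  by rewrite ler_expR ler_wpM2l.
have D : 2 * (c * e) <= cabs (csinh2 x y).
  apply: le_trans (cabs_csinh2_ge_sin x y); rewrite ler_pM2l//.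
  by apply: le_trans (sin_ge yY); rewrite ler_pM2l.
have ce0 : 0 < c * e by rewrite mulr_gt0.
have ce0' : 0 < 2 * (c * e) by rewrite mulr_gt0.
rewrite /M'; apply: (le_trans (le_cabsD _ _)).
rewrite (cabsM (H' x y)) (cabsM (H x y - H0)); apply: lerD.
  apply: ler_pM; rewrite ?cabs_ge0//.
    by apply: (le_trans (leH' x yY)); rewrite ler_wpM2l.
  rewrite cabs_ckernel (_ : (c * e)^-1 = 2 / (2 * (c * e))); last first.
    by field; rewrite !gt_eqF.
  by rewrite ler_pM2l// lef_pV2// posrE (lt_le_trans ce0').
apply: ler_pM; rewrite ?cabs_ge0//.
  by apply: (le_trans (le_HB0 x yY)); rewrite ler_wpM2l// mulr_ge0.
apply: (le_trans (cabs_ckernel'_le x y)).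
rewrite (_ : expR N / (c * e) ^+ 2 = 4 * expR N / (2 * (c * e)) ^+ 2); last first.
  by field; rewrite !gt_eqF.
apply: ler_pM; rewrite ?mulr_ge0 ?invr_ge0 ?sqr_ge0 ?expR_ge0//.
  by rewrite ler_pM2l// ler_expR.
rewrite lef_pV2 ?posrE ?exprn_gt0// ?(lt_le_trans ce0')//.
by rewrite ler_pXn2r ?nnegrE ?cabs_ge0// ltW.
Qed.

Let im_M0 x : im (M x 0) = 0.
Proof. by rewrite /M imM im_ckernel0 !ReImE /H0 !realH oppr0 addr0 mulr0 mul0r addr0. Qed.

(* The contour integral at height y, truncated to [-N, N]. *)
Let J (N y : R) : R := \int[mu]_(x in `[- N, N]) im (M x y).

Let contM (y : R) : `|y| < Y -> y != 0 -> continuous (fun x => im (M x y)).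
Proof.
move=> yY y0 x; have xy : (x != 0) || (y != 0) by rewrite y0 orbT.
by have [_] := holo_ccont (holoM yY xy).
Qed.

Let contM' (y : R) : `|y| < Y -> y != 0 -> continuous (fun x => re (M' x y)).
Proof.
move=> yY y0 x; have xy : (x != 0) || (y != 0) by rewrite y0 orbT.
have s0 := csinh2_neq0 yY xy.
suff [] : ccont (M' ^~ y) x by [].
have hK := holo_ckernel s0.
have hs := holo_inv s0 (holo_csinh2 x y).
apply: ccontD.
  by apply: ccontM; [exact: contH'|exact: holo_ccont hK].
apply: ccontM.
  by apply: ccontD; [exact: holo_ccont (holoH x yY)|exact: ccont_cst].
apply: ccontM.
  apply: ccontM; first exact: ccont_cst.
  by apply: ccontD; apply: holo_ccont (holo_cexp _ x y).
have E : (fun u : R => csinh2 u y ^- 2) = fun u => (csinh2 u y)^-1 * (csinh2 u y)^-1.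
  by apply/funext => u; rewrite expr2 invfM.
rewrite E; have h1 : ccont (fun u : R => (csinh2 u y)^-1) x.
  exact: holo_ccont hs.
exact: ccontM.
Qed.

Let intM (N y : R) : `|y| < Y -> mu.-integrable `[- N, N] (EFin \o (fun x => im (M x y))).
Proof.
move=> yY; have [->|y0] := eqVneq y 0.
  by under [X in _.-integrable _ X]eq_fun do rewrite /= im_M0; exact: integrable0.
exact/continuous_integrable_segment/contM.
Qed.

Let J_cont (N : R) : 0 <= N -> {in `](- Y), Y[%classic, continuous (J N)}.
Proof.
move=> N0.
pose g := fun x : R => 8 * B * expR ((1 - delta) * N) / c.
apply: (@continuity_under_integral _ _ _ mu (fun y x => im (M x y)) _ (measurable_itv _) _ _ _ _ g).
- by move=> y /=; rewrite in_itv/= -ltr_norml => yY; exact: intM.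
- exists [set 0]; split => //; first exact: lebesgue_measure_set1.
  move=> x /=; apply: contra_notP => /eqP x0 _ y.
  rewrite inE/= in_itv/= -ltr_norml => yY.
  have xy : (x != 0) || (y != 0) by rewrite x0.
  by have [_ _ _ h] := holoM yY xy; exact: is_derive_continuous h.
- by apply: continuous_integrable_segment; exact: cst_continuous.
- move=> y /=; rewrite in_itv/= -ltr_norml => yY.
  apply: aeW => x; rewrite /= in_itv/= -ler_norml => xN.
  have [y0|y0] := eqVneq y 0.
    by rewrite y0 im_M0 normr0 !mulr_ge0 ?expR_ge0// invr_ge0 ltW.
  apply: (le_trans (normr_Im_le _)); apply: M_le_near => //.
  by rewrite y0 orbT.
Qed.

(** By the Cauchy-Riemann equations d/dy Im M = d/dx Re M, so that only the two
    vertical sides contribute. *)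
Let is_derive_J (N y : R) : 0 < N -> 0 < y < Y ->
  is_derive y 1 (J N) (re (M N y) - re (M (- N) y)).
Proof.
move=> N0 /andP[y0 yY].
pose C := B * expR ((1 - delta) * N) / (c * (y / 2)) +
    2 * B * expR ((1 - delta) * N) * (expR N / (c * (y / 2)) ^+ 2).
have inI (z : R) : y / 2 < z < Y -> [/\ `|z| < Y, z != 0 & y / 2 <= `|z|].
  move=> /andP[z1 z2]; have z0 : 0 < z by lra.
  by rewrite gtr0_norm// z2 gt_eqF// ltW.
have yY' : `|y| < Y by rewrite gtr0_norm.
have yn : y != 0 by rewrite gt_eqF.
have NN : - N < N by lra.
have dM (x : R) : is_derive x 1 (fun x : R => re (M x y)) (re (M' x y)).
  have xy : (x != 0) || (y != 0) by rewrite yn orbT.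
  by case: (holoM yY' xy).
rewrite -(@Rintegral_is_derive _ (fun x => re (M x y)) (fun x => re (M' x y)) (- N) N NN dM (contM' yY' yn)).
apply: (@is_derive_under_Rintegral R (fun z x => im (M x z)) (fun z x => re (M' x z))
  _ y (y / 2) Y (fun=> C)) => //.
- by apply/andP; split; lra.
- by move=> z /inI[zY _ _]; exact: intM.
- move=> z x /inI[zY z0 _] _; have xy : (x != 0) || (z != 0) by rewrite z0 orbT.
  by case: (holoM zY xy).
- have cy : 0 < c * (y / 2) by rewrite mulr_gt0// divr_gt0.
  move=> _; apply: addr_ge0; first by apply: divr_ge0 (ltW cy); rewrite mulr_ge0 ?expR_ge0.
  apply: mulr_ge0; first by rewrite !mulr_ge0 ?expR_ge0.
  by apply: divr_ge0; rewrite ?expR_ge0 ?sqr_ge0.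
- by apply: continuous_integrable_segment; exact: cst_continuous.
- move=> z x /inI[zY _ ez]; rewrite /= in_itv/= -ler_norml => xN.
  by apply: (le_trans (normr_Re_le _)); apply: M'_le => //; lra.
Qed.

Let M_end (N y : R) : 1 <= N -> `|y| < Y -> cabs (M N y) + cabs (M (- N) y) <= 16 * B * expR (- delta * N).
Proof.
move=> N1 yY; have N0 : 0 < N by lra.
have e2 : 2 <= expR N by have := expR_ge1Dx N; lra.
have e1 : expR (- N) <= 1 by rewrite -[leRHS]expR0 ler_expR; lra.
have L (x : R) : `|x| = N -> cabs (M x y) <= 8 * B * expR (- delta * N).
  move=> xN; rewrite /M cabsM cabs_ckernel.
  have D : expR N / 2 <= cabs (csinh2 x y).
    rewrite -(@ler_pXn2r _ 2) ?nnegrE ?cabs_ge0 ?divr_ge0 ?expR_ge0// sqr_cabs_csinh2.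
    apply: (@le_trans _ _ ((expR x - expR (- x)) ^+ 2)); last by rewrite lerDl mulr_ge0// sqr_ge0.
    have [x0|x0] := leP 0 x.
      have -> : x = N by rewrite -xN ger0_norm.
      rewrite ler_pXn2r ?nnegrE ?divr_ge0 ?expR_ge0//; last lra.
      lra.
    have -> : x = - N by rewrite -xN ltr0_norm ?opprK.
    rewrite opprK -[leRHS]sqrrN opprB ler_pXn2r ?nnegrE ?divr_ge0 ?expR_ge0//; last lra.
    lra.
  have E0 : 0 < expR N / 2 by rewrite divr_gt0// expR_gt0.
  have -> : 8 * B * expR (- delta * N) = 2 * B * expR ((1 - delta) * `|x|) * (2 / (expR N / 2)).
    by rewrite xN mulrBl mul1r mulNr expRD; field; rewrite gt_eqF// expR_gt0.
  apply: ler_pM => //; rewrite ?cabs_ge0 ?divr_ge0 ?cabs_ge0//; first exact: le_HB0.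
  by rewrite ler_pM2l// lef_pV2// posrE (lt_le_trans E0).
have := L N (gtr0_norm N0); have := L (- N); rewrite normrN => /(_ (gtr0_norm N0)); lra.
Qed.

(** M is real on the real axis, hence J N 0 = 0, and the mean value theorem
    transports this to the height y up to the contribution of the sides. *)
Let J_le (N y : R) : 1 <= N -> 0 < y < Y -> `|J N y| <= 16 * B * expR (- delta * N) * y.
Proof.
move=> N1 yY; have N0 : 0 < N by lra.
have /andP[y0 ylt] := yY.
have J0 : J N 0 = 0.
  rewrite /J (@eq_Rintegral _ _ _ _ _ (fun=> 0)); last by move=> x _; rewrite im_M0.
  by rewrite /Rintegral integral0.
have dJ (z : R) : z \in `]0, y[ -> is_derive z 1 (J N) (re (M N z) - re (M (- N) z)).
  by rewrite in_itv/= => /andP[z0 zy]; apply: is_derive_J => //; apply/andP; split; lra.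
have cJ : {within `[0, y], continuous (J N)}.
  apply: continuous_in_subspaceT => z; rewrite inE/= in_itv/= => /andP[z0 zy].
  apply: J_cont; first exact: ltW.
  by rewrite inE/= in_itv/=; apply/andP; split; lra.
have [z zI] := @MVT R (J N) (fun z => re (M N z) - re (M (- N) z)) 0 y y0 dJ cJ.
rewrite J0 !subr0 => ->; rewrite normrM (gtr0_norm y0) ler_pM2r//.
move: zI; rewrite in_itv/= => /andP[z0 zy].
have zY : `|z| < Y by rewrite gtr0_norm//; lra.
apply: le_trans (M_end N1 zY); apply: (le_trans (ler_normB _ _)).
by apply: lerD; exact: normr_Re_le.
Qed.

Let integrable_imM (y : R) : 0 < y < Y -> mu.-integrable setT (EFin \o (fun x => im (M x y))).
Proof.
move=> /andP[y0 yY].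
have yY' : `|y| < Y by rewrite gtr0_norm.
have yn : y != 0 by rewrite gt_eqF.
have d0 : 0 < delta by case/andP: delta01.
apply: (le_integrable _ _ _ (integrable_expM_norm 0 (4 * B / `|sin y|) d0)) => //.
  by apply/measurable_EFinP; apply: continuous_measurable_fun; exact: contM.
move=> x _; rewrite /= lee_fin subr0.
apply: (le_trans (normr_Im_le _)).
apply: le_trans (ler_norm _); rewrite mulNr; exact: M_le_far.
Qed.

Let int_imM (y : R) : 0 < y < Y -> \int[mu]_x im (M x y) = 0.
Proof.
move=> yY; have d0 : 0 < delta by case/andP: delta01.
have c1 := cvg_Rintegral_segment (integrable_imM yY).
have c2 : (fun n : nat => \int[mu]_(x in `[- n%:R, n%:R]) im (M x y)) @ \oo --> (0 : R).
  apply/norm_cvg0P.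
  have h : (fun n : nat => 16 * B * expR (- delta * n%:R) * y) @ \oo --> (0 : R).
    rewrite -[X in _ --> X](mul0r y); apply: cvgM; last exact: cvg_cst.
    rewrite -[X in _ --> X](mulr0 (16 * B)); apply: cvgM; first exact: cvg_cst.
    apply: (cvg_comp _ _ _ (expM_cvgy d0)).
    exact: cvgr_idn.
  apply: (@squeeze_cvgr _ _ _ _ (cst 0) _ _ _ _ _ h); last exact: cvg_cst.
  near=> n; rewrite normr_ge0/=; apply: J_le => //.
  near: n; exact: nbhs_infty_ger.
exact: (cvg_unique _ c1 c2).
Unshelve. all: end_near. Qed.

(** Letting N tend to infinity kills the contribution of M = (H - H(0)) K, K being
    the kernel; what is left is H(0) times the mass of Im K. *)
Theorem strip_cauchy (y : R) : 0 < y < Y ->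
  mu.-integrable setT (EFin \o (fun x => im (H x y * ckernel x y))) /\
  \int[mu]_x im (H x y * ckernel x y) = pi * re (H 0 0).
Proof.
move=> yY; have ypi : 0 < y < pi by case/andP: yY => y0 ylt; apply/andP; split; move: Ypi => ?; lra.
have [Ik k] := integral_im_ckernel ypi.
have HE x : im (H x y * ckernel x y) = im (M x y) + re (H 0 0) * im (ckernel x y).
  rewrite /M mulrBl imD imN (imM H0) /H0 realH mul0r addr0; ring.
have Ik' : mu.-integrable setT (EFin \o (fun x => re (H 0 0) * im (ckernel x y))).
  by under [X in _.-integrable _ X]eq_fun do rewrite /= EFinM; exact: integrableZl.
have IM := integrable_imM yY.
split.
  rewrite (_ : (fun x => im (H x y * ckernel x y)) =
    (fun x => im (M x y) + re (H 0 0) * im (ckernel x y))); last exact/funext.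
  by rewrite /comp; under eq_fun do rewrite EFinD; exact: integrableD.
under eq_Rintegral do rewrite HE.
by rewrite RintegralD// int_imM// add0r RintegralZl// k mulrC.
Qed.

End strip_cauchy.

(** * The Laplace transform of the contour kernel *)
Section denominator.
Context {R : realType}.

Lemma re_real_cexp (a p x y : R) :
  re (a%:C%C * cexp p x y) = a * (expR (p * x) * cos (p * y)).
Proof. by rewrite reM /re /im/= mul0r subr0. Qed.

Lemma im_real_cexp (a p x y : R) :
  im (a%:C%C * cexp p x y) = a * (expR (p * x) * sin (p * y)).
Proof. by rewrite imM /re /im/= mul0r addr0. Qed.

(** z^p stays away from the negative half-axis, so there is no cancellation in
    a z^p + l and its modulus is bounded below by both terms. *)
Lemma cabs_denominator_ge (q a l p x y : R) : 0 <= q <= 1 -> 0 <= a -> 0 <= l ->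
  q - 1 <= cos (p * y) ->
  q * l <= cabs (a%:C%C * cexp p x y + l%:C%C) /\
  q * (a * expR (p * x)) <= cabs (a%:C%C * cexp p x y + l%:C%C).
Proof.
move=> /andP[q0 q1] a0 l0 qc.
set e := expR (p * x); have e0 : 0 <= e by exact: expR_ge0.
set D := cabs _; have ae0 : 0 <= a * e by rewrite mulr_ge0.
have D2 : D ^+ 2 = (a * e) ^+ 2 + l ^+ 2 + 2 * (a * e) * l * cos (p * y).
  rewrite sqr_cabs reD imD re_real_cexp im_real_cexp -/e.
  have := cos2Dsin2 (p * y); set c := cos _; set s := sin _ => cs.
  have -> : re (l%:C%C) = l by [].
  have -> : im (l%:C%C) = 0 by [].
  by rewrite addr0 !exprMn !sqrrD !exprMn (_ : s ^+ 2 = 1 - c ^+ 2); [ring|lra].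
have L : q * ((a * e) ^+ 2 + l ^+ 2) <= D ^+ 2.
  have h1 : 2 * (a * e) * l * (q - 1) <= 2 * (a * e) * l * cos (p * y).
    by rewrite ler_wpM2l// !mulr_ge0.
  have h2 : 0 <= (1 - q) * (a * e - l) ^+ 2 by rewrite mulr_ge0 ?sqr_ge0// subr_ge0.
  rewrite D2; nra.
have L2 u : 0 <= u -> u ^+ 2 <= (a * e) ^+ 2 + l ^+ 2 -> q * u <= D.
  move=> u0 uL; rewrite -(@ler_pXn2r _ 2) ?nnegrE ?cabs_ge0 ?mulr_ge0//.
  apply: le_trans L; rewrite exprMn; apply: (@le_trans _ _ (q * u ^+ 2)).
    by rewrite ler_wpM2r ?sqr_ge0// expr2 ler_piMl.
  by rewrite ler_wpM2l.
by split; apply: L2 => //; rewrite ?lerDl ?lerDr sqr_ge0.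
Qed.

End denominator.

Section mittag_leffler_contour.
Context {R : realType}.
Local Notation mu := (@lebesgue_measure R).
Variables (alpha Y sigma lambda : R).
Hypotheses (alpha12 : 1 < alpha < 2) (Ypos : 0 < Y) (Ylt : alpha * Y < pi)
  (cosY : cos (alpha * Y) <= 0) (lambda0 : 0 < lambda).

(* With z = e^(x + i y) and s = e^sigma, H is
   s^(2 alpha - 2) z^(2 alpha - 2) (z + 1) / 2 / (s^alpha z^alpha + lambda).  The
   factor (z + 1) / 2 turns - 1 / sinh into 1 / (1 / z - 1), see [csub_inv]. *)
Let A := expR (alpha * sigma).
Let c0 := expR ((2 * alpha - 2) * sigma) / 2.
Let q := 1 + cos (alpha * Y).
Let N (x y : R) : R[i] := c0%:C%C * (cexp (2 * alpha - 1) x y + cexp (2 * alpha - 2) x y).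
Let N' (x y : R) : R[i] := c0%:C%C * ((2 * alpha - 1)%:C%C * cexp (2 * alpha - 1) x y
   + (2 * alpha - 2)%:C%C * cexp (2 * alpha - 2) x y).
Let D (x y : R) : R[i] := A%:C%C * cexp alpha x y + lambda%:C%C.
Let D' (x y : R) : R[i] := A%:C%C * (alpha%:C%C * cexp alpha x y).
Let H (x y : R) : R[i] := N x y * (D x y)^-1.
Let H' (x y : R) : R[i] := N' x y * (D x y)^-1 + N x y * (- D' x y / D x y ^+ 2).

Let a1 : 1 < alpha. Proof. by case/andP: alpha12. Qed.
Let a2 : alpha < 2. Proof. by case/andP: alpha12. Qed.
Let A0 : 0 < A. Proof. exact: expR_gt0. Qed.
Let c00 : 0 < c0. Proof. by rewrite divr_gt0// expR_gt0. Qed.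

Let q0 : 0 < q.
Proof.
rewrite /q -ltrBlDl sub0r -cospi ltr_cos ?in_itv/=//.
- have : 0 < alpha * Y by rewrite mulr_gt0//; move: a1 => ?; lra.
  by move: Ylt => ? ?; apply/andP; split; lra.
- by rewrite pi_ge0 lexx.
Qed.

Let q1 : q <= 1. Proof. by rewrite /q gerDl. Qed.

Let cosq (y : R) : `|y| < Y -> q - 1 <= cos (alpha * y).
Proof.
move=> yY; rewrite /q addrAC subrr add0r.
have -> : cos (alpha * y) = cos (alpha * `|y|).
  by case: (ger0P y) => // _; rewrite mulrN cosN.
have a0 : 0 <= alpha by move: a1 => ?; lra.
have h1 : 0 <= alpha * `|y| by rewrite mulr_ge0.
have h2 : alpha * `|y| <= alpha * Y by rewrite ler_wpM2l// ltW.
rewrite leNgt; apply/negP; rewrite ltr_cos ?in_itv/=; [by rewrite ltNge h2| |].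
- by apply/andP; split; move: Ylt => ?; lra.
- by apply/andP; split; move: Ylt => ?; lra.
Qed.

Let D_ge (x y : R) : `|y| < Y ->
  q * lambda <= cabs (D x y) /\ q * (A * expR (alpha * x)) <= cabs (D x y).
Proof.
move=> yY; apply: cabs_denominator_ge; [by rewrite (ltW q0) q1|exact: ltW|exact: ltW|exact: cosq].
Qed.

Let D_gt0 (x y : R) : `|y| < Y -> 0 < cabs (D x y).
Proof.
by move=> yY; have [h _] := D_ge x yY; apply: lt_le_trans h; rewrite mulr_gt0.
Qed.

Let D_neq0 (x y : R) : `|y| < Y -> D x y != 0.
Proof. by move=> yY; rewrite -cabs_eq0 gt_eqF// D_gt0. Qed.

Let holoN x y : holo_at N N' x y.
Proof.
have := holo_mul (holo_cst c0%:C%C x y) (holo_add (holo_cexp (2 * alpha - 1) x y) (holo_cexp (2 * alpha - 2) x y)).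
by apply: holo_eq; rewrite mul0r add0r.
Qed.

Let holoD x y : holo_at D D' x y.
Proof.
have := holo_add (holo_mul (holo_cst A%:C%C x y) (holo_cexp alpha x y)) (holo_cst lambda%:C%C x y).
by apply: holo_eq; rewrite mul0r add0r addr0.
Qed.

Let holoH (x y : R) : `|y| < Y -> holo_at H H' x y.
Proof.
move=> yY; exact: holo_mul (holoN x y) (holo_inv (D_neq0 x yY) (holoD x y)).
Qed.

Let contH' (x y : R) : `|y| < Y -> ccont (H' ^~ y) x.
Proof.
move=> yY; have cI := holo_ccont (holo_inv (D_neq0 x yY) (holoD x y)).
have cc p : ccont (cexp p ^~ y) x by exact: holo_ccont (holo_cexp p x y).
apply: ccontD.
  apply: ccontM cI; apply: ccontM; first exact: ccont_cst.
  by apply: ccontD; apply: ccontM (cc _); exact: ccont_cst.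
apply: ccontM; first exact: holo_ccont (holoN x y).
rewrite (_ : (fun u => _) = fun u => (-1 * D' u y) * ((D u y)^-1 * (D u y)^-1)); last first.
  by apply/funext => u; rewrite mulN1r expr2 invfM.
apply: ccontM; last exact: ccontM.
apply: ccontM; first exact: ccont_cst.
by do 2 (apply: ccontM; first exact: ccont_cst).
Qed.

Let B1 := 2 * c0 / (q * A) + 2 * c0 / (q * lambda).

Let B1_ge0 : 0 <= B1.
Proof. by apply: addr_ge0; apply: divr_ge0; rewrite ?mulr_ge0 ?(ltW c00) ?(ltW q0) ?(ltW A0) ?(ltW lambda0). Qed.

(** For x >= 0 the denominator is compared with its first term, for x <= 0 with
    its second one. *)
Let NV (x y : R) : `|y| < Y ->
  2 * c0 * expR ((2 * alpha - 1) * x) <= B1 * expR ((alpha - 1) * `|x|) * cabs (D x y) /\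
  2 * c0 * expR ((2 * alpha - 2) * x) <= B1 * expR ((alpha - 1) * `|x|) * cabs (D x y).
Proof.
move=> yY; have [h1 h2] := D_ge x yY.
have k (e : R) : e = 2 * alpha - 1 \/ e = 2 * alpha - 2 ->
    2 * c0 * expR (e * x) <= B1 * expR ((alpha - 1) * `|x|) * cabs (D x y).
  move=> eE; have e0 : 0 <= e by move: a1 => ?; case: eE => ->; lra.
  have e1 : e <= 2 * alpha - 1 by case: eE => ->; lra.
  have [x0|x0] := leP 0 x.
    apply: (@le_trans _ _ ((2 * c0 / (q * A)) * expR ((alpha - 1) * x) * (q * (A * expR (alpha * x))))).
      have -> : (2 * c0 / (q * A)) * expR ((alpha - 1) * x) * (q * (A * expR (alpha * x))) =
          2 * c0 * (expR ((alpha - 1) * x) * expR (alpha * x)).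
        by field; rewrite !gt_eqF.
      rewrite -expRD ler_wpM2l ?mulr_ge0 ?(ltW c00)// ler_expR -mulrDl ler_wpM2r//.
      by lra.
    apply: ler_pM => //.
    - by rewrite mulr_ge0 ?divr_ge0 ?expR_ge0// ?mulr_ge0// ltW.
    - by rewrite !mulr_ge0 ?expR_ge0// ltW.
    - rewrite (ger0_norm x0) ler_wpM2r ?expR_ge0// lerDl divr_ge0 ?mulr_ge0// ltW//.
  have e1' : 1 <= expR ((alpha - 1) * `|x|).
    by rewrite -[leLHS]expR0 ler_expR mulr_ge0//; move: a1 => ?; lra.
  apply: (@le_trans _ _ ((2 * c0 / (q * lambda)) * 1 * (q * lambda))).
    have -> : (2 * c0 / (q * lambda)) * 1 * (q * lambda) = 2 * c0 * 1.
      by field; rewrite !gt_eqF.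
    rewrite ler_wpM2l ?mulr_ge0 ?(ltW c00)// -[leRHS]expR0 ler_expR.
    by rewrite mulr_ge0_le0// ltW.
  apply: ler_pM => //.
  - by rewrite mulr1 divr_ge0 ?mulr_ge0// ltW.
  - by rewrite mulr_ge0// ltW.
  - apply: ler_pM => //; first by rewrite divr_ge0 ?mulr_ge0// ltW.
    by rewrite lerDr divr_ge0 ?mulr_ge0// ltW.
by split; apply: k; [left|right].
Qed.

Let leNV (x y : R) : `|y| < Y ->
  cabs (N x y) * (cabs (D x y))^-1 <= B1 * expR ((alpha - 1) * `|x|).
Proof.
move=> yY; rewrite ler_pdivrMr ?D_gt0// /N cabsM cabs_real gtr0_norm//.
have [h1 h2] := NV x yY.
have := le_cabsD (cexp (2 * alpha - 1) x y) (cexp (2 * alpha - 2) x y).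
rewrite !cabs_cexp => /(ler_wpM2l (ltW c00)); lra.
Qed.

Let B := (2 * alpha - 1 + alpha / q) * B1.

Let leH' (x y : R) : `|y| < Y -> cabs (H' x y) <= B * expR ((alpha - 1) * `|x|).
Proof.
move=> yY; rewrite /H' (le_trans (le_cabsD _ _))//.
rewrite (cabsM (N' x y)) (cabsM (N x y)) (cabsM (- D' x y)) !cabsV cabsN.
have -> : cabs (D x y ^+ 2) = cabs (D x y) ^+ 2 by rewrite !expr2 cabsM.
have a0 : 0 <= alpha by move: a1 => ?; lra.
have E0 : 0 <= B1 * expR ((alpha - 1) * `|x|) by rewrite mulr_ge0// expR_ge0.
rewrite /B -mulrA mulrDl; apply: lerD.
  rewrite ler_pdivrMr ?D_gt0// /N' cabsM cabs_real gtr0_norm//.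
  have [h1 h2] := NV x yY.
  have := le_cabsD ((2 * alpha - 1)%:C%C * cexp (2 * alpha - 1) x y)
     ((2 * alpha - 2)%:C%C * cexp (2 * alpha - 2) x y).
  have p1 : 0 <= 2 * alpha - 1 by move: a1 => ?; lra.
  have p2 : 0 <= 2 * alpha - 2 by move: a1 => ?; lra.
  rewrite !cabsM !cabs_real !cabs_cexp (ger0_norm p1) (ger0_norm p2).
  move=> /(ler_wpM2l (ltW c00)) => h; apply: (le_trans h).
  rewrite -[leRHS]mulrA; set Z := B1 * _ * _ in h1 h2 *.
  have h3 : (2 * alpha - 2) * (2 * c0 * expR ((2 * alpha - 2) * x)) <= (2 * alpha - 2) * Z.
    by rewrite ler_wpM2l//; move: a1 => ?; lra.
  have h4 : (2 * alpha - 1) * (2 * c0 * expR ((2 * alpha - 1) * x)) <= (2 * alpha - 1) * Z.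
    by rewrite ler_wpM2l//; move: a1 => ?; lra.
  have Z0 : 0 <= Z by rewrite mulr_ge0// cabs_ge0.
  lra.
have -> : cabs (N x y) * (cabs (D' x y) * (cabs (D x y) ^+ 2)^-1) =
   (cabs (D' x y) / cabs (D x y)) * (cabs (N x y) / cabs (D x y)).
  by field; rewrite gt_eqF// D_gt0.
apply: ler_pM; rewrite ?divr_ge0 ?cabs_ge0//; last exact: leNV.
rewrite ler_pdivrMr ?D_gt0// /D' !cabsM !cabs_real cabs_cexp gtr0_norm// ger0_norm//.
have [_ h] := D_ge x yY.
have -> : A * (alpha * expR (alpha * x)) = alpha / q * (q * (A * expR (alpha * x))).
  by field; rewrite gt_eqF.
by rewrite ler_wpM2l// divr_ge0// ltW.
Qed.

Let leH (x y : R) : `|y| < Y -> cabs (H x y) <= B * expR ((alpha - 1) * `|x|).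
Proof.
move=> yY; rewrite /H cabsM cabsV; apply: (le_trans (leNV x yY)).
rewrite ler_wpM2r ?expR_ge0// /B ler_peMl//.
have : 0 <= alpha / q by rewrite divr_ge0//; [move: a1 => ?; lra|exact: ltW].
by move: a1 => ?; lra.
Qed.

Let HE0 x : H x 0 = (c0 * (expR ((2 * alpha - 1) * x) + expR ((2 * alpha - 2) * x)) /
   (A * expR (alpha * x) + lambda))%:C%C.
Proof.
by rewrite /H /N /D !cexp_real !(rmorphM, rmorphD, fmorphV).
Qed.

Lemma csub_inv (w : R[i]) : w != 0 -> w^-1 - w != 0 -> 1 - w != 0 -> 
  (1 - w)^-1 = (w^-1 + 1) / 2 * (2 * (w^-1 - w)^-1).
Proof.
move=> w0 ww w1.
have -> : w^-1 - w = w^-1 * (1 - w) * (1 + w) by field.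
have w1' : 1 + w != 0.
  by apply: contraNneq ww => /eqP; rewrite addrC addr_eq0 => /eqP ->; rewrite invrN invr1 opprK addrC subrr.
have w1'' : w + 1 != 0 by rewrite addrC.
by field; rewrite ?w0 ?w1 ?w1' ?w1''.
Qed.

(** The residue at z = s = e^sigma of z^(2 alpha - 2) / ((z^alpha + lambda) (s - z)),
    z = e^(x + sigma + i theta): [strip_cauchy] at the height theta. *)
Lemma mittag_leffler_contour (theta : R) : 0 < theta < Y -> Y < pi ->
  mu.-integrable setT (EFin \o (fun x => im (cexp (2 * alpha - 1) (x + sigma) theta /
    (cexp alpha (x + sigma) theta + lambda%:C%C) / ((expR sigma)%:C%C - cexp 1 (x + sigma) theta)))) /\
  \int[mu]_x (im (cexp (2 * alpha - 1) (x + sigma) theta /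
    (cexp alpha (x + sigma) theta + lambda%:C%C) / ((expR sigma)%:C%C - cexp 1 (x + sigma) theta))) =
  pi * (expR ((2 * alpha - 2) * sigma) / (A + lambda)).
Proof.
move=> thY Ypi.
have h1 : 0 < Y < pi by rewrite Ypos Ypi.
have h2 : 0 < 2 - alpha <= 1 by move: a1 a2 => ? ?; apply/andP; split; lra.
have E1 : 1 - (2 - alpha) = alpha - 1 by ring.
have realH x : im (H x 0) = 0 by rewrite HE0.
have := @strip_cauchy R Y (2 - alpha) B H H' h1 h2 holoH contH'.
rewrite E1 => /(_ leH leH' realH theta thY).
have -> : pi * re (H 0 0) = pi * (expR ((2 * alpha - 2) * sigma) / (A + lambda)).
  rewrite HE0 !mulr0 !expR0 mulr1; congr (_ * _); rewrite /re/= /c0; field.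
  by rewrite gt_eqF// addr_gt0.
rewrite (_ : (fun x => im (H x theta * ckernel x theta)) = (fun x => im (cexp (2 * alpha - 1) (x + sigma) theta /
    (cexp alpha (x + sigma) theta + lambda%:C%C) / ((expR sigma)%:C%C - cexp 1 (x + sigma) theta)))) //.
apply/funext => x; congr im.
have sh p : cexp p (x + sigma) theta = (expR (p * sigma))%:C%C * cexp p x theta.
  apply/eqP; rewrite eq_complex/= !mul0r subr0 addr0 mulrDr expRD.
  by apply/andP; split; apply/eqP; ring.
have thY' : `|theta| < Y by case/andP: thY => t0 tY; rewrite gtr0_norm.
have thpi : 0 < theta < pi by case/andP: thY => t0 tY; rewrite t0 (lt_trans tY).
rewrite !sh mul1r /H /N /D /ckernel /csinh2 -/A.
have D0 := D_neq0 x thY'; rewrite /D in D0.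
have s0 : csinh2 x theta != 0.
  rewrite -cabs_eq0 gt_eqF//; apply: lt_le_trans (cabs_csinh2_ge_sin x theta).
  by rewrite mulr_gt0// normr_gt0 gt_eqF// sin_gt0_pi.
rewrite /csinh2 in s0.
have w0 : cexp 1 x theta != 0 by rewrite -cabs_eq0 cabs_cexp gt_eqF// expR_gt0.
have wV : cexp (-1) x theta = (cexp 1 x theta)^-1.
  by apply: (mulIf w0); rewrite -cexpD mulVf// addrC subrr cexp0.
have E2 : cexp (2 * alpha - 2) x theta = cexp (2 * alpha - 1) x theta * (cexp 1 x theta)^-1.
  by rewrite -wV -cexpD (_ : 2 * alpha - 1 + -1 = 2 * alpha - 2)//; ring.
rewrite wV in s0 *; rewrite E2.
set w := cexp 1 x theta in w0 s0 *.
have w1 : 1 - w != 0.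
  by apply: contraNneq s0 => /eqP; rewrite subr_eq0 => /eqP <-; rewrite invr1 subrr.
have e0 : (expR sigma)%:C%C != 0 :> R[i] by rewrite fmorph_eq0 gt_eqF// expR_gt0.
have -> : (expR ((2 * alpha - 1) * sigma))%:C%C = (expR ((2 * alpha - 2) * sigma))%:C%C * (expR sigma)%:C%C :> R[i].
  by rewrite -rmorphM/= -expRD; congr (_%:C)%C; congr expR; ring.
have -> : (expR sigma)%:C%C - (expR sigma)%:C%C * w = (expR sigma)%:C%C * (1 - w) by ring.
rewrite invfM (csub_inv w0 s0 w1) /c0 rmorphM/= fmorphV/=.
have -> : (2 : R)%:C%C = 2 :> R[i] by apply/eqP; rewrite eq_complex/= addr0 !eqxx.
move: (cexp alpha x theta) D0 => Ca D0.
move: (2 / (w^-1 - w)) => k.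
by field; rewrite ?D0 ?w0 ?e0.
Qed.

End mittag_leffler_contour.

(** * The Laplace transform *)
Section convolution.
Context {R : realType}.
Local Notation mu := (@lebesgue_measure R).

Lemma integral_shift (a : R) (f : R -> \bar R) : measurable_fun [set: R] f ->
  (\int[mu]_x f (x + a)%R = \int[mu]_x f x)%E.
Proof.
move=> mf; rewrite [LHS]integralE [RHS]integralE; congr (_ - _)%E.
  rewrite -(@ge0_integral_shift R a f^\+%E (measurable_funepos mf) (funepos_ge0 f)).
  by apply: eq_integral => x _; rewrite !funeposE.
rewrite -(@ge0_integral_shift R a f^\-%E (measurable_funeneg mf) (funeneg_ge0 f)).
by apply: eq_integral => x _; rewrite !funenegE.
Qed.

Lemma integral_convolution (F G H : R -> R) :
  mu.-integrable setT (EFin \o F) -> mu.-integrable setT (EFin \o G) ->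
  (forall t, mu.-integrable setT (EFin \o (fun tau => F (t - tau) * G tau))) ->
  (forall t, H t = \int[mu]_tau (F (t - tau) * G tau)) ->
  mu.-integrable setT (EFin \o H) /\
  \int[mu]_t H t = \int[mu]_t F t * \int[mu]_t G t.
Proof.
move=> iF iG iFG HE.
have mF : measurable_fun setT F by have /integrableP[/measurable_EFinP] := iF.
have mG : measurable_fun setT G by have /integrableP[/measurable_EFinP] := iG.
pose h (z : measurableTypeR R * measurableTypeR R) : R := F (z.1 - z.2) * G z.2.
have mh : measurable_fun [set: measurableTypeR R * measurableTypeR R] h.
  apply: measurable_funM.
    apply: measurableT_comp; first exact: mF.
    by apply: measurable_funB; [exact: measurable_fst|exact: measurable_snd].
  by apply: measurableT_comp; [exact: mG|exact: measurable_snd].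
have mh' : measurable_fun setT (EFin \o h) by exact/measurable_EFinP.
have maF : measurable_fun setT (fun x => `|F x|%:E).
  by apply/measurable_EFinP; exact: measurableT_comp.
have shiftF tau : (\int[mu]_t `|F (t - tau)|%:E = \int[mu]_x `|F x|%:E)%E.
  have F0 x : (0 <= `|F x|%:E)%E by rewrite lee_fin.
  exact: (@ge0_integral_shift R (- tau) _ maF F0).
have shiftF' tau : (\int[mu]_t (F (t - tau))%:E = \int[mu]_x (F x)%:E)%E.
  have mF' : measurable_fun setT (fun x => (F x)%:E) by exact/measurable_EFinP.
  exact: (@integral_shift (- tau) _ mF').
have nF : (\int[mu]_x `|F x|%:E < +oo)%E.
  by have /integrableP[_] := iF.
have nG : (\int[mu]_x `|G x|%:E < +oo)%E.
  by have /integrableP[_] := iG.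
have nF' : (\int[mu]_x `|F x|%:E \is a fin_num)%E.
  by rewrite ge0_fin_numE// integral_ge0.
have ih : (mu \x mu)%E.-integrable setT (EFin \o h).
  apply/(integrable21ltyP _ _ mh').
  under eq_integral => tau _.
    under eq_integral => t _ do rewrite /h/= normrM EFinM muleC.
    rewrite ge0_integralZl//; last first.
      apply: (measurableT_comp maF); exact: measurable_funB.
    rewrite shiftF muleC.
    over.
  rewrite /= -(fineK nF') ge0_integralZl ?fineK//.
  - by rewrite lte_mul_pinfty// integral_ge0.
  - by apply/measurable_EFinP; exact: measurableT_comp.
  - by rewrite integral_ge0.
have HF : fubini_F mu (EFin \o h) = EFin \o H.
  apply/funext => t; rewrite /fubini_F /= HE /Rintegral fineK//.
  exact: integrable_fin_num (iFG t).
have iH : mu.-integrable setT (EFin \o H) by rewrite -HF; exact: integrable_fubini_F.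
split => //.
rewrite {1}/Rintegral.
have -> : (\int[mu]_t (H t)%:E = \int[mu]_t fubini_F mu (EFin \o h) t)%E by rewrite HF.
rewrite /fubini_F (Fubini ih).
have inF : (\int[mu]_x (F x)%:E \is a fin_num)%E by exact: integrable_fin_num iF.
have inG : (\int[mu]_x (G x)%:E \is a fin_num)%E by exact: integrable_fin_num iG.
under eq_integral => tau _.
  under eq_integral => t _ do rewrite /h/= EFinM muleC.
  rewrite integralZl//; last first.
    apply/integrableP; split.
      by apply/measurable_EFinP; apply: measurableT_comp => //; exact: measurable_funB.
    by rewrite shiftF.
  rewrite shiftF'.
  over.
rewrite /= -(fineK inF) integralZr//= fineM//= mulrC.
by [].
Qed.

End convolution.

Section laplace.
Context {R : realType}.
Local Notation mu := (@lebesgue_measure R).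
Implicit Types (f g : R -> R) (s t : R).

Definition laplace_integrable f s :=
  mu.-integrable `]0, +oo[ (EFin \o (fun t => expR (- s * t) * f t)).

Definition laplace f s := \int[mu]_(t in `]0, +oo[) (expR (- s * t) * f t).

Lemma laplace_integrableD f g s : laplace_integrable f s -> laplace_integrable g s ->
  laplace_integrable (fun t => f t + g t) s.
Proof.
move=> iff ig; rewrite /laplace_integrable.
rewrite (_ : (fun t => _) = fun t => expR (- s * t) * f t + expR (- s * t) * g t).
  exact: integrable_fctD.
by apply/funext => t; rewrite mulrDr.
Qed.

Lemma laplace_integrableZ k f s : laplace_integrable f s ->
  laplace_integrable (fun t => k * f t) s.
Proof.
move=> iff; rewrite /laplace_integrable.
rewrite (_ : (fun t => _) = fun t => k * (expR (- s * t) * f t)).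
  exact: integrable_fctZ.
by apply/funext => t; rewrite mulrCA.
Qed.

Lemma laplaceD f g s : laplace_integrable f s -> laplace_integrable g s ->
  laplace (fun t => f t + g t) s = laplace f s + laplace g s.
Proof.
move=> iff ig; rewrite /laplace -RintegralD//.
by apply: eq_Rintegral => t _; rewrite mulrDr.
Qed.

Lemma laplaceZ k f s : laplace_integrable f s ->
  laplace (fun t => k * f t) s = k * laplace f s.
Proof.
move=> iff; rewrite /laplace -RintegralZl//.
by apply: eq_Rintegral => t _; rewrite mulrCA.
Qed.

Lemma laplace_integrable_eq f g s : (forall t, 0 < t -> f t = g t) ->
  laplace_integrable f s -> laplace_integrable g s.
Proof.
move=> fg; apply: eq_integrable => // t; rewrite inE/= in_itv/= andbT => t0.
by rewrite fg.
Qed.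

Lemma eq_laplace f g s : (forall t, 0 < t -> f t = g t) -> laplace f s = laplace g s.
Proof.
move=> fg; apply: eq_Rintegral => t; rewrite inE/= in_itv/= andbT => t0.
by rewrite fg.
Qed.

Lemma laplace_integrableW f s s' : s <= s' -> laplace_integrable f s ->
  laplace_integrable f s'.
Proof.
move=> ss' iff; have mf := measurable_integrable iff.
have E t : expR (- s' * t) * f t = expR (- (s' - s) * t) * (expR (- s * t) * f t).
  by rewrite mulrA -expRD; congr (expR _ * _); ring.
apply: (le_integrable_fct _ _ _ (integrable_norm iff)) => //.
- rewrite (funext E); apply: measurable_funM => //; exact: measurable_expM.
- move=> t; rewrite /= in_itv/= andbT => t0; rewrite E normrM ler_piMl//.
  rewrite ger0_norm ?expR_ge0// -[leRHS]expR0 ler_expR mulNr oppr_le0.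
  by rewrite mulr_ge0 ?subr_ge0// ltW.
Qed.

Let pos f s : R -> R := (fun t => expR (- s * t) * f t) \_ `]0, +oo[.

Let integrable_pos f s : laplace_integrable f s -> mu.-integrable setT (EFin \o pos f s).
Proof. by move=> h; rewrite /pos -restrict_EFin; apply/(integrable_mkcond _ _).1. Qed.

Let integral_pos f s : \int[mu]_t pos f s t = laplace f s.
Proof. exact/esym/Rintegral_mkcond. Qed.

(** The functions are extended by 0 to the negative half-line, which turns the
    convolution over (0, t) into a convolution over R. *)
Lemma laplace_convolution f g h s :
  laplace_integrable f s -> laplace_integrable g s ->
  (forall t, 0 < t -> mu.-integrable `]0, t[ (EFin \o (fun tau => f (t - tau) * g tau))) ->
  (forall t, 0 < t -> h t = \int[mu]_(tau in `]0, t[) (f (t - tau) * g tau)) ->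
  laplace_integrable h s /\ laplace h s = laplace f s * laplace g s.
Proof.
move=> iff ig ifg hE.
have E t tau : pos f s (t - tau) * pos g s tau =
    ((fun tau => expR (- s * t) * (f (t - tau) * g tau)) \_ `]0, t[) tau.
  rewrite /pos !patchE !mem_setE !in_itv/= !andbT subr_gt0.
  case: (ltP tau t) => tt; case: (ltP 0 tau) => t0 //=; rewrite ?mul0r ?mulr0//.
  have -> : expR (- s * t) = expR (- s * (t - tau)) * expR (- s * tau).
    by rewrite -expRD; congr expR; ring.
  by ring.
have E0 t : t <= 0 -> `]0, t[%classic = set0 :> set R.
  by move=> t0; rewrite set_itv_ge// -leNgt bnd_simp.
have [iH HE] : mu.-integrable setT (EFin \o pos h s) /\
   \int[mu]_t pos h s t = \int[mu]_t pos f s t * \int[mu]_t pos g s t.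
  apply: integral_convolution; [exact: integrable_pos|exact: integrable_pos| |].
  - move=> t; rewrite (funext (E t)).
    rewrite -restrict_EFin; apply/(integrable_mkcond _ _).1 => //.
    have [t0|t0] := leP t 0; first by rewrite E0//; exact: integrable_set0.
    under [X in _.-integrable _ X]eq_fun do rewrite /= EFinM.
    by apply: integrableZl => //; exact: ifg.
  - move=> t; under eq_Rintegral do rewrite E.
    rewrite -Rintegral_mkcond /pos patchE mem_setE in_itv/= andbT.
    case: ltP => t0; last by rewrite E0// Rintegral_set0.
    by rewrite hE// RintegralZl//; exact: ifg.
split; last by rewrite -!integral_pos.
by move: iH; rewrite /pos -restrict_EFin => /(integrable_mkcond _ _).2; apply.
Qed.

End laplace.

Section laplace_powers.
Context {R : realType}.
Local Notation mu := (@lebesgue_measure R).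

Lemma ge0_integral_bigcup_le (f : R -> R) (F : nat -> set R) (M : R) :
  (forall n, measurable (F n)) -> {homo F : n m / (n <= m)%N >-> (n <= m)%O} ->
  measurable_fun (\bigcup_n F n) f -> (forall x, (\bigcup_n F n) x -> 0 <= f x) ->
  (forall n, \int[mu]_(x in F n) (f x)%:E <= M%:E)%E ->
  (\int[mu]_(x in \bigcup_n F n) (f x)%:E <= M%:E)%E.
Proof.
move=> mF ndF mf f0 leM.
have := @ge0_nondecreasing_set_cvg_integral _ (measurableTypeR R) R F (EFin \o f) mu ndF mF.
move=> cv.
have mfn n : measurable_fun (F n) (EFin \o f).
  apply/measurable_EFinP; apply: measurable_funS mf => //.
    exact: bigcupT_measurable.
  exact: bigcup_sup.
have f0n n x : F n x -> (0 <= (EFin \o f) x)%E.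
  by move=> Fx; rewrite lee_fin f0//; exists n.
have {}cv := cv mfn f0n.
have <- := cvg_lim _ cv => //.
apply: lime_le; first exact: cvgP cv.
by near=> n; exact: leM.
Unshelve. all: end_near. Qed.

End laplace_powers.

Section gamma.
Context {R : realType}.
Local Notation mu := (@lebesgue_measure R).

Let powR_le_sqr (p t : R) : 0 <= p <= 2 -> 0 < t -> t `^ p <= 1 + t ^+ 2.
Proof.
move=> /andP[p0 p2] t0; have [t1|t1] := leP 1 t.
  apply: (@le_trans _ _ (t `^ 2)); first exact: ler_powR.
  by rewrite (powR_mulrn 2 (ltW t0)) lerDr.
apply: (@le_trans _ _ 1); last by rewrite lerDl sqr_ge0.
rewrite /powR gt_eqF// -[leRHS]expR0 ler_expR mulr_ge0_le0//.
by rewrite -ln1 ler_ln ?posrE// ltW.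
Qed.

Let expR_powR_le (p t : R) : 0 <= p <= 2 -> 0 < t ->
  (1 + t `^ p) ^+ 2 <= 32 ^+ 2 * expR t.
Proof.
move=> p02 t0; have h := powR_le_sqr p02 t0; have h0 := powR_ge0 t p.
have e4 : expR t = expR (t / 4) ^+ 4.
  by rewrite -expRM_natl; congr expR; field.
have e1 : 1 + t / 4 <= expR (t / 4) by exact: expR_ge1Dx.
have q0 : 0 <= 1 + t / 4 by rewrite addr_ge0// divr_ge0// ltW.
have e2 : (1 + t / 4) ^+ 4 <= expR (t / 4) ^+ 4.
  by rewrite ler_pXn2r// nnegrE expR_ge0.
rewrite e4; apply: (@le_trans _ _ (32 ^+ 2 * (1 + t / 4) ^+ 4)); last by rewrite ler_wpM2l// sqr_ge0.
have -> : 32 ^+ 2 * (1 + t / 4) ^+ 4 = (32 * (1 + t / 4) ^+ 2) ^+ 2 by ring.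
rewrite ler_pXn2r ?nnegrE ?addr_ge0 ?mulr_ge0 ?sqr_ge0//.
apply: (@le_trans _ _ (2 + t ^+ 2)); first by lra.
have -> : 32 * (1 + t / 4) ^+ 2 = 32 + 16 * t + 2 * t ^+ 2 by field.
by have := sqr_ge0 t; lra.
Qed.

Let primitive_continuous (p a b : R) : 0 < a ->
  {within `[a, b], continuous (fun t => p * t `^ (p - 1) / (1 + t `^ p) ^+ 2)}.
Proof.
move=> a0; have n0 t : 1 + t `^ p != 0 by rewrite gt_eqF// ltr_pwDl// powR_ge0.
have cp q (t : R) : 0 < t -> {for t, continuous (fun t => t `^ q)}.
  by move=> t0; exact: is_derive_continuous (is_derive1_powR q t0).
apply: continuous_in_subspaceT => t; rewrite inE/= in_itv/= => /andP[at_ _].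
have t0 : 0 < t by exact: lt_le_trans at_.
apply: cvgM.
  by apply: cvgM; [exact: cvg_cst|exact: (cp (p - 1) t t0)].
apply: cvgV; first by rewrite sqrf_eq0.
by apply: cvgM; apply: cvgD; try exact: cvg_cst; exact: (cp p t t0).
Qed.

(** The bounded primitive is - 1 / (1 + t^p). *)
Let primitive_le (p a b : R) : 0 < p -> 0 < a -> a < b ->
  (\int[mu]_(t in `[a, b]) (p * t `^ (p - 1) / (1 + t `^ p) ^+ 2)%:E <= 1)%E.
Proof.
move=> p0 a0 ab.
have n0 t : 1 + t `^ p != 0 by rewrite gt_eqF// ltr_pwDl// powR_ge0.
have dF (t : R) : 0 < t -> is_derive t 1 (fun t => - (1 + t `^ p)^-1) (p * t `^ (p - 1) / (1 + t `^ p) ^+ 2).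
  move=> t0; have dp := is_derive1_powR p t0.
  have d1 : is_derive t 1 (fun t => 1 + t `^ p) (p * t `^ (p - 1)).
    by have := is_deriveD (is_derive_cst (1 : R) t 1) dp; rewrite add0r.
  have h := is_deriveN (@is_deriveV _ _ t _ 1 (n0 t) d1).
  by apply: (@is_derive_eq _ _ _ _ _ _ _ _ h); rewrite /GRing.scale/=; field; exact: n0.
rewrite (@continuous_FTC2 _ _ (fun t => - (1 + t `^ p)^-1))//.
- have ha : 0 <= (1 + a `^ p)^-1 by rewrite invr_ge0 addr_ge0 ?powR_ge0.
  have hb : 0 <= (1 + b `^ p)^-1 by rewrite invr_ge0 addr_ge0 ?powR_ge0.
  have hc : (1 + a `^ p)^-1 <= 1 by rewrite invf_le1 ?lerDl ?powR_ge0// ltr_pwDl// powR_ge0.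
  by rewrite -EFinD lee_fin; lra.
- exact: primitive_continuous.
- split.
  + by move=> t; rewrite in_itv/= => /andP[at_ _]; have [] := dF t (lt_trans a0 at_).
  + by apply: cvg_at_right_filter; exact: (is_derive_continuous (dF a a0)).
  + by apply: cvg_at_left_filter; exact: (is_derive_continuous (dF b (lt_trans a0 ab))).
- move=> t; rewrite in_itv/= => /andP[at_ _].
  by rewrite derive1E; exact: (@derive_val _ _ _ _ _ _ _ (dF t (lt_trans a0 at_))).
Qed.

(** Since (1 + t^p)^2 = O(e^t), the integrand is dominated by a multiple of
    p t^(p - 1) / (1 + t^p)^2, whose integrals over the intervals [1/n, n] are
    bounded by 1; this treats both endpoints at once. *)
Lemma gamma_integrable (p : R) : 0 < p <= 2 ->
  mu.-integrable `]0, +oo[ (EFin \o (fun t => t `^ (p - 1) * expR (- t))).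
Proof.
move=> /andP[p0 p2].
have mf D : measurable_fun D (fun t : R => t `^ (p - 1) * expR (- t)).
  apply: (measurable_funS measurableT) => //.
  apply: measurable_funM; first exact: measurable_powR.
  have := @measurable_expM R (-1) setT.
  by rewrite (_ : (fun u => expR (-1 * u)) = (fun t : R => expR (- t)))//; apply/funext => t; rewrite mulN1r.
pose F (n : nat) : set R := `[n.+2%:R^-1, n.+2%:R]%classic.
have UF : `]0, +oo[%classic = \bigcup_n F n :> set R.
  apply/seteqP; split => t; rewrite /= in_itv/= ?andbT.
    move=> t0; pose N := maxn (Num.truncn t) (Num.truncn t^-1).
    have tN : t <= N.+2%:R.
      apply: (@le_trans _ _ (Num.truncn t).+1%:R); first exact/ltW/truncnS_gt.
      by rewrite ler_nat !ltnS (leq_trans (leq_maxl _ (Num.truncn t^-1)))// leqnSn.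
    have tN' : t^-1 <= N.+2%:R.
      apply: (@le_trans _ _ (Num.truncn t^-1).+1%:R); first exact/ltW/truncnS_gt.
      by rewrite ler_nat !ltnS (leq_trans (leq_maxr (Num.truncn t) _))// leqnSn.
    by exists N => //; rewrite /F/= in_itv/= tN andbT -[leRHS]invrK lef_pV2// posrE// invr_gt0.
  move=> [n _]; rewrite /F/= in_itv/= => /andP[h _].
  by apply: lt_le_trans h; rewrite invr_gt0.
rewrite UF; apply: (ge0_integrable_fct (M := 32 ^+ 2 / p)).
- exact: mf.
- by move=> t _; rewrite mulr_ge0 ?powR_ge0 ?expR_ge0.
apply: ge0_integral_bigcup_le.
- by move=> n; exact: measurable_itv.
- move=> n m nm; apply/subsetPset => t; rewrite /F/= !in_itv/= => /andP[h1 h2].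
  rewrite (le_trans h2) ?ler_nat ?ltnS// andbT (le_trans _ h1)//.
  by rewrite lef_pV2 ?posrE// ler_nat !ltnS.
- exact: mf.
- by move=> t _; rewrite mulr_ge0 ?powR_ge0 ?expR_ge0.
move=> n; have a0 : 0 < n.+2%:R^-1 :> R by rewrite invr_gt0.
have ab : n.+2%:R^-1 < n.+2%:R :> R.
  by apply: (@lt_trans _ _ 1); rewrite ?invf_lt1 ?ltr1n.
have mg : measurable_fun (F n) (fun t : R => p * t `^ (p - 1) / (1 + t `^ p) ^+ 2).
  rewrite (_ : (fun t : R => _) = fun t : R => p * t `^ (p - 1) * ((1 + t `^ p) `^ (-1)) ^+ 2).
    apply: (measurable_funS measurableT) => //; apply: measurable_funM.
      by apply: measurable_funM => //; exact: measurable_powR.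
    apply: measurable_funX; apply: (measurableT_comp (measurable_powR (-1))).
    by apply: measurable_funD => //; exact: measurable_powR.
  by apply/funext => t; rewrite powR_inv1 ?exprVn// addr_ge0 ?powR_ge0.
apply: (@le_trans _ _ (\int[mu]_(t in F n) ((32 ^+ 2 / p)%:E * (p * t `^ (p - 1) / (1 + t `^ p) ^+ 2)%:E))%E).
  apply: ge0_le_integral => //.
  - exact: measurable_itv.
  - by move=> t _; rewrite lee_fin mulr_ge0 ?powR_ge0 ?expR_ge0.
  - by apply/measurable_EFinP; exact: mf.
  - by apply: measurable_funeM; exact/measurable_EFinP.
  - move=> t; rewrite /F/= in_itv/= => /andP[h _].
    have t0 : 0 < t by exact: lt_le_trans h.
    have s0 : 0 < 1 + t `^ p by rewrite ltr_pwDl// powR_ge0.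
    have e0 := expR_gt0 t.
    rewrite -EFinM lee_fin expRN.
    have -> : 32 ^+ 2 / p * (p * t `^ (p - 1) / (1 + t `^ p) ^+ 2) = t `^ (p - 1) * (32 ^+ 2 / (1 + t `^ p) ^+ 2).
      by field; rewrite !gt_eqF.
    apply: ler_wpM2l; first exact: powR_ge0.
    rewrite ler_pdivlMr ?exprn_gt0// mulrC ler_pdivrMr//.
    by apply: expR_powR_le => //; rewrite p2 ltW.
rewrite ge0_integralZl//.
- rewrite -[leRHS]mule1; apply: lee_wpmul2l; first by rewrite lee_fin divr_ge0 ?sqr_ge0// ltW.
  exact: primitive_le.
- exact: measurable_itv.
- exact/measurable_EFinP.
- move=> t _; rewrite lee_fin divr_ge0 ?sqr_ge0// mulr_ge0 ?powR_ge0// ltW//.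
- by rewrite lee_fin divr_ge0 ?sqr_ge0// ltW.
Qed.

(** On [1, 2] the integrand is at least e^(-2) / 2. *)
Lemma Gamma_integral_gt0 (p : R) : 0 < p <= 2 -> 0 < Gamma_integral p.
Proof.
move=> p02; have iG := gamma_integrable p02; have /andP[p0 p2] := p02.
pose m : R := 2^-1 * expR (- 2).
have m0 : 0 < m by rewrite mulr_gt0 ?expR_gt0// invr_gt0.
apply: (lt_le_trans m0); rewrite /Gamma_integral.
have h12 : `[(1 : R), 2]%classic `<=` `]0, +oo[%classic.
  by move=> t; rewrite /= !in_itv/= andbT => /andP[t1 _]; apply: lt_le_trans t1.
apply: (@le_trans _ _ (\int[mu]_(t in `[1, 2]) (t `^ (p - 1) * expR (- t)))).
  have -> : m = \int[mu]_(t in `[1, 2]) m.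
    rewrite Rintegral_cst//= lebesgue_measure_itv/= lte_fin ltr1n/=.
    by rewrite (_ : 2 - 1 = 1 :> R) ?mulr1//; ring.
  apply: le_Rintegral => //.
  - by apply: continuous_integrable_segment; exact: cst_continuous.
  - exact: integrableS iG.
  - move=> t; rewrite /= in_itv/= => /andP[t1 t2].
    have t0 : 0 < t by exact: lt_le_trans t1.
    apply: ler_pM; rewrite ?invr_ge0 ?expR_ge0//; last by rewrite ler_expR lerN2.
    apply: (@le_trans _ _ (t `^ (- 1))).
      by rewrite (powR_inv1 (ltW t0)) lef_pV2 ?posrE.
    by rewrite ler_powR// lerBrDr; lra.
rewrite /Rintegral fine_le//.
- by apply: integrable_fin_num => //; exact: integrableS iG.
- by apply: integrable_fin_num.
apply: ge0_subset_integral => //.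
- by apply/measurable_EFinP; exact: measurable_integrable iG.
- by move=> t _; rewrite lee_fin mulr_ge0 ?powR_ge0 ?expR_ge0.
Qed.

(** The substitution of s t for t in the Gamma integral. *)
Lemma laplace_powR (p s : R) : 0 < p <= 2 -> 0 < s ->
  laplace_integrable (fun t => t `^ (p - 1)) s /\
  laplace (fun t => t `^ (p - 1)) s = Gamma_integral p * s `^ (- p).
Proof.
move=> p02 s0; have iG := gamma_integrable p02.
have mP (D : set R) : measurable_fun D (fun t : R => expR (- s * t) * t `^ (p - 1)).
  apply: (measurable_funS measurableT) => //.
  by apply: measurable_funM; [exact: measurable_expM|exact: measurable_powR].
have f0 t : (0 <= (expR (- s * t) * t `^ (p - 1))%:E)%E.
  by rewrite lee_fin mulr_ge0 ?powR_ge0 ?expR_ge0.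
pose g : R -> \bar R := (EFin \o (fun t => t `^ (p - 1) * expR (- t))) \_ `]0, +oo[.
have g0 t : (0 <= g t)%E.
  by rewrite /g patchE; case: ifP => // _; rewrite lee_fin mulr_ge0 ?powR_ge0 ?expR_ge0.
have mg : measurable_fun setT g.
  apply/(measurable_restrictT _ _).1 => //; apply/measurable_EFinP.
  exact: measurable_integrable iG.
have gE t : g (s * t) = ((EFin \o (fun t => (s `^ (p - 1)) * (expR (- s * t) * t `^ (p - 1)))) \_ `]0, +oo[) t.
  rewrite /g !patchE !mem_setE !in_itv/= !andbT pmulr_rgt0//.
  case: ltP => // t0; rewrite /= powRM ?(ltW s0) ?(ltW t0)//; congr EFin.
  by rewrite mulNr; ring.
have intE : ((Gamma_integral p)%:E = s%:E * ((s `^ (p - 1))%:E *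
    \int[mu]_(t in `]0%R, +oo[) (expR (- s * t) * t `^ (p - 1))%:E))%E.
  rewrite /Gamma_integral /Rintegral fineK; last exact: integrable_fin_num.
  rewrite integral_mkcond (@ge0_integral_scale R s g s0 mg g0); congr (_ * _)%E.
  under eq_integral do rewrite gE.
  rewrite -integral_mkcond.
  have mPE : measurable_fun (`]0, +oo[%classic : set R) (fun t : R => (expR (- s * t) * t `^ (p - 1))%:E).
    by apply/measurable_EFinP; exact: mP.
  have sp0 : (0 <= (s `^ (p - 1))%:E)%E by rewrite lee_fin powR_ge0.
  by rewrite -(ge0_integralZl mu (measurable_itv _) mPE (fun x _ => f0 x) sp0).
have s1 : s * s `^ (p - 1) != 0 by rewrite gt_eqF// mulr_gt0// powR_gt0.
have sE : s * s `^ (p - 1) = s `^ p.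
  rewrite (_ : s `^ p = s `^ (1 + (p - 1))); last by congr (_ `^ _); ring.
  have -> : s `^ (1 + (p - 1)) = s `^ 1 * s `^ (p - 1).
    by apply: powRD; rewrite (gt_eqF s0) implybT.
  by rewrite (powRr1 (ltW s0)).
have iE : (\int[mu]_(t in `]0%R, +oo[) (expR (- s * t) * t `^ (p - 1))%:E =
    (Gamma_integral p * s `^ (- p))%:E)%E.
  have fin : (\int[mu]_(t in `]0%R, +oo[) (expR (- s * t) * t `^ (p - 1))%:E \is a fin_num)%E.
    rewrite ge0_fin_numE ?integral_ge0// ltey; apply/eqP => E; move: intE.
    by rewrite E !gt0_muley// lte_fin powR_gt0.
  rewrite -(fineK fin) in intE *; move: intE; rewrite -!EFinM => -[->].
  by congr EFin; rewrite powRN -sE; field; rewrite !gt_eqF ?powR_gt0.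
split; last by rewrite /laplace /Rintegral iE.
apply: (ge0_integrable_fct (M := Gamma_integral p * s `^ (- p))) => //.
- exact: mP.
- by move=> t _; rewrite mulr_ge0 ?powR_ge0 ?expR_ge0.
- by rewrite iE.
Qed.

End gamma.

Section laplace_uniqueness.
Context {R : realType}.
Local Notation mu := (@lebesgue_measure R).

Let bernoulli_le (u : R) (N : nat) : 0 <= u <= 1 -> 1 - N%:R * u <= (1 - u) ^+ N.
Proof.
move=> /andP[u0 u1]; elim: N => [|N IH]; first by rewrite mul0r subr0 expr0.
rewrite exprS; have u1' : 0 <= 1 - u by rewrite subr_ge0.
apply: le_trans (ler_wpM2l u1' IH).
have N0 : 0 <= N%:R * u ^+ 2 by rewrite mulr_ge0 ?sqr_ge0.
rewrite -natr1; nra.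
Qed.

Let bernoulli_ge (u : R) (N : nat) : 0 <= u <= 1 -> (1 - u) ^+ N * (1 + N%:R * u) <= 1.
Proof.
move=> /andP[u0 u1]; elim: N => [|N IH]; first by rewrite mul0r addr0 expr0 mulr1.
apply: le_trans IH; rewrite exprS -mulrA mulrCA ler_wpM2l//.
  by rewrite exprn_ge0// subr_ge0.
have N0 : 0 <= N%:R :> R by [].
rewrite -natr1; have := sqr_ge0 u; nra.
Qed.

(* Smooth approximations of the indicator of (tau, +oo): the power N of 1 - e^(-m t)
   is of the order of e^(m tau), so that N e^(-m t) is large or small according to
   whether t < tau or t > tau. *)
Let approx (tau : R) (m : nat) (t : R) : R :=
  (1 - expR (- (m%:R * t))) ^+ Num.truncn (expR (m%:R * tau)).

Let approx_itv (tau : R) (m : nat) (t : R) : 0 <= t -> 0 <= approx tau m t <= 1.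
Proof.
move=> t0; have e1 : expR (- (m%:R * t)) <= 1.
  by rewrite -[leRHS]expR0 ler_expR oppr_le0 mulr_ge0.
have e0 := expR_ge0 (- (m%:R * t)).
by rewrite /approx exprn_ge0 ?subr_ge0//= exprn_ile1 ?subr_ge0//; lra.
Qed.

Let approx_err (tau : R) (m : nat) (t : R) : 0 <= t -> t != tau ->
  `|approx tau m t - (tau < t)%R%:R| <= expR (- (m%:R * `|t - tau|)).
Proof.
move=> t0 ttau; have u1 : expR (- (m%:R * t)) <= 1.
  by rewrite -[leRHS]expR0 ler_expR oppr_le0 mulr_ge0.
have u0 := expR_ge0 (- (m%:R * t)).
have u01 : 0 <= expR (- (m%:R * t)) <= 1 by rewrite u0 u1.
have /andP[a0 a1] := approx_itv tau m t0.
have /andP[N1 N2] := truncn_itv (expR_ge0 (m%:R * tau)).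
rewrite /approx in a0 a1 *; move: N1 N2 a0 a1; set N := Num.truncn _ => N1 N2 a0 a1.
have [tt|tt|E] := ltrgtP tau t; last by rewrite E eqxx in ttau.
  rewrite (ler0_norm); last by rewrite subr_le0.
  have := bernoulli_le N u01 => h.
  have h2 : N%:R * expR (- (m%:R * t)) <= expR (- (m%:R * (t - tau))).
    have -> : expR (- (m%:R * (t - tau))) = expR (m%:R * tau) * expR (- (m%:R * t)).
      by rewrite -expRD; congr expR; ring.
    by rewrite ler_wpM2r.
  by move: h h2 => /=; lra.
rewrite subr0 ger0_norm//.
have h := bernoulli_ge N u01.
have E : expR (- (m%:R * (tau - t))) = (expR (m%:R * tau) * expR (- (m%:R * t)))^-1.
  by rewrite -expRD -expRN; congr expR; ring.
rewrite E; set w := expR (m%:R * tau) * _.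
have w0 : 0 < w by rewrite mulr_gt0 ?expR_gt0.
rewrite -[leRHS]mul1r ler_pdivlMr//; apply: le_trans h.
apply: ler_wpM2l => //.
have : w <= N.+1%:R * expR (- (m%:R * t)) by rewrite ler_wpM2r// ltW.
rewrite -natr1 mulrDl mul1r; lra.
Qed.

(** The integrals of h against polynomials in e^(-m t) vanish; those polynomials
    that approximate the indicator of (tau, +oo) are uniformly bounded, and dominated
    convergence applies. *)
Lemma laplace_eq0_primitive (h : R -> R) (tau : R) :
  mu.-integrable `]0, +oo[ (EFin \o h) -> 0 < tau ->
  (forall s, 0 <= s -> laplace h s = 0) ->
  \int[mu]_(t in `]0, tau[) h t = 0.
Proof.
move=> ih tau0 lap0.
have mh := measurable_integrable ih.
have li s : 0 <= s -> laplace_integrable h s.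
  move=> s0; apply: (laplace_integrableW s0); rewrite /laplace_integrable.
  by under [X in _.-integrable _ X]eq_fun do rewrite /= oppr0 mul0r expR0 mul1r.
have poly0 (p : {poly R}) (m : nat) : \int[mu]_(t in `]0, +oo[) (h t * p.[expR (- (m%:R * t))]) = 0.
  transitivity (\int[mu]_(t in `]0, +oo[) (\sum_(i < size p) p`_i * (expR (- (i%:R * m%:R) * t) * h t))).
    apply: eq_Rintegral => t _; rewrite horner_coef mulr_sumr; apply: eq_bigr => i _.
    rewrite -expRM_natl mulrCA [h t * _]mulrC; congr (_ * (expR _ * _)); ring.
  have iterm (i : 'I_(size p)) : mu.-integrable `]0, +oo[ (EFin \o (fun t => p`_i * (expR (- (i%:R * m%:R) * t) * h t))).
    by apply: integrable_fctZ => //; apply: li; rewrite mulr_ge0.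
  rewrite /Rintegral; under eq_integral do rewrite -sumEFin.
  rewrite integral_sum// big1// => i _.
  have := @laplaceZ R p`_i h (i%:R * m%:R) (li _ (mulr_ge0 (ler0n _ _) (ler0n _ _))).
  rewrite lap0 ?mulr_ge0// mulr0 /laplace => e0.
  have {}e0 : \int[mu]_(t in `]0, +oo[) (p`_i * (expR (- (i%:R * m%:R) * t) * h t)) = 0.
    by rewrite -[RHS]e0; apply: eq_Rintegral => t _; rewrite mulrCA.
  rewrite -[LHS]fineK; last by apply: integrable_fin_num => //; exact: iterm.
  by rewrite -[RHS]/(0%:E); congr EFin.
have int0 : \int[mu]_(t in `]0, +oo[) h t = 0.
  rewrite -[RHS](lap0 0 (lexx _)) /laplace; apply: eq_Rintegral => t _.
  by rewrite oppr0 mul0r expR0 mul1r.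
have a0 m : \int[mu]_(t in `]0, +oo[) (h t * approx tau m t) = 0.
  rewrite -[RHS](poly0 ((1 - 'X) ^+ Num.truncn (expR (m%:R * tau))) m).
  by apply: eq_Rintegral => t _; rewrite horner_exp !hornerE.
have mapprox m : measurable_fun (`]0%R, +oo[%classic : set R) (approx tau m).
  apply: measurable_funX; apply: measurable_funB => //.
  have := @measurable_expM R (- m%:R) `]0%R, +oo[%classic.
  by rewrite (_ : (fun u => expR (- m%:R * u)) = (fun t : R => expR (- (m%:R * t))))//; apply/funext => t; rewrite mulNr.
have mI : measurable_fun (`]0%R, +oo[%classic : set R) (fun t : R => (tau < t)%R%:R : R).
  rewrite (_ : (fun t : R => (tau < t)%R%:R : R) = \1_(`]tau, +oo[%classic)); first exact: measurable_indic.
  by apply/funext => t; rewrite indicE mem_setE in_itv/= andbT.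
have [iI cv] : mu.-integrable `]0, +oo[ (EFin \o (fun t => h t * (tau < t)%R%:R)) /\
   \int[mu]_(t in `]0, +oo[) (h t * approx tau n t) @[n --> \oo] --> \int[mu]_(t in `]0, +oo[) (h t * (tau < t)%R%:R).
  apply: (@dominated_Rintegral _ _ (fun n t => h t * approx tau n t) _ (fun t => `|h t|)) => //.
  - by move=> n; exact: measurable_funM.
  - exact: integrable_norm.
  - exists [set tau]; split => //; first exact: lebesgue_measure_set1.
    move=> t /=; apply: contra_notP => ttau; rewrite in_itv/= andbT => t0.
    have {}ttau : t != tau by exact/eqP.
    apply: cvgM; first exact: cvg_cst.
    apply/subr_cvg0/norm_cvg0P.
    have dtau : 0 < `|t - tau| by rewrite normr_gt0 subr_eq0.
    have hb : (fun n : nat => expR (- (n%:R * `|t - tau|))) @ \oo --> (0 : R).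
      have := cvg_comp _ _ cvgr_idn (expM_cvgy dtau).
      apply: cvg_trans; apply: near_eq_cvg; apply: nearW => n /=.
      by rewrite mulNr mulrC.
    apply: (@squeeze_cvgr _ _ _ _ (cst 0) _ _ _ _ _ hb); last exact: cvg_cst.
    by apply: nearW => n; rewrite normr_ge0/=; apply: approx_err => //; exact: ltW.
  - exact: measurable_funM.
  - move=> n t; rewrite /= in_itv/= andbT => t0; rewrite normrM ler_piMr//.
    by have /andP[? ?] := approx_itv tau n (ltW t0); rewrite ger0_norm.
have I0 : \int[mu]_(t in `]0, +oo[) (h t * (tau < t)%R%:R) = 0.
  by rewrite -(cvg_lim (@Rhausdorff R) cv) (funext a0); exact: lim_cst.
transitivity (\int[mu]_(t in `]0, +oo[) (h t - h t * (tau < t)%R%:R)); last first.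
  by rewrite RintegralB// int0 I0 subr0.
rewrite (Rintegral_itv_bndo_bndc); last first.
  apply: integrableS ih => // t; rewrite /= !in_itv/= andbT => /andP[t0 _] //.
have sub : `]0, tau] `<=` `]0%R, +oo[.
  by move=> t; rewrite /= !in_itv/= andbT => /andP[].
rewrite [LHS]Rintegral_mkcond [RHS]Rintegral_mkcond; apply: eq_Rintegral => t _.
rewrite !patchE !mem_setE !in_itv/= andbT.
by case: ltP => t0 //=; case: (leP t tau) => tt /=; rewrite ?mulr0 ?subr0 ?mulr1 ?subrr.
Qed.

End laplace_uniqueness.

(** * The correction term as an integral over a ray *)
Section exponential_decay.
Context {R : realType}.
Implicit Types (p k t x : R).

(* The exponent 5 exceeds by 1 the largest power p = 4 in [expR_decay]. *)
Let expR_pow5 k u : 0 < k -> 0 <= u -> u ^+ 5 <= (5 / k) ^+ 5 * expR (k * u).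
Proof.
move=> k0 u0.
have -> : k * u = 5%:R * (k / 5 * u) by field.
rewrite expRM_natl -exprMn ler_pXn2r ?nnegrE ?mulr_ge0 ?divr_ge0 ?invr_ge0 ?expR_ge0 ?(ltW k0)//.
rewrite [leLHS](_ : u = 5 / k * (k / 5 * u)); last by field; rewrite gt_eqF.
rewrite ler_wpM2l ?divr_ge0 ?invr_ge0 ?(ltW k0)//.
by apply: le_trans (expR_ge1Dx _); rewrite lerDr.
Qed.

(** In the variable y = x + ln t the left-hand side is t^(-p) e^(p y - k e^y), which
    is O(e^(-|y|)) on both sides: this is the scaling that produces the power of
    t. *)
Lemma expR_decay p k t x : 1 <= p <= 4 -> 0 < k -> 0 < t ->
  expR (p * x) * expR (- (k * t * expR x)) <=
    (1 + (5 / k) ^+ 5) * t `^ (- p) * expR (- 1 * `|x - (- ln t)|).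
Proof.
move=> /andP[p1 p4] k0 t0; rewrite opprK; set y := x + ln t.
have -> : k * t * expR x = k * expR y.
  by rewrite /y expRD lnK ?posrE//; ring.
have -> : expR (p * x) = expR (p * y) * t `^ (- p).
  by rewrite /powR gt_eqF// -expRD; congr expR; rewrite /y; ring.
rewrite mulrAC [leRHS]mulrAC ler_wpM2r ?powR_ge0//.
have C0 : 0 <= (5 / k) ^+ 5 by rewrite exprn_ge0// divr_ge0// ltW.
have [y0|y0] := leP 0 y.
  rewrite (ger0_norm y0) mulN1r !expRN ler_pdivrMr ?expR_gt0//.
  rewrite mulrAC ler_pdivlMr ?expR_gt0// -expRD.
  apply: (@le_trans _ _ (expR y ^+ 5)).
    rewrite -expRM_natl ler_expR.
    have : p * y <= 4 * y by rewrite ler_wpM2r.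
    lra.
  apply: le_trans (expR_pow5 k0 (expR_ge0 y)) _.
  by rewrite ler_wpM2r ?expR_ge0// lerDr.
rewrite (ltr0_norm y0) mulN1r opprK.
apply: (@le_trans _ _ (expR y * 1)).
  rewrite ler_pM ?expR_ge0//.
    rewrite ler_expR; have : p * y <= 1 * y by rewrite ler_wnM2r// ltW.
    by rewrite mul1r.
  by rewrite -[leRHS]expR0 ler_expR oppr_le0 mulr_ge0 ?expR_ge0// ltW.
by rewrite mulr1 -[leLHS]mul1r ler_wpM2r ?expR_ge0// lerDl.
Qed.

End exponential_decay.

Section improper_FTC.
Context {R : realType}.
Local Notation mu := (@lebesgue_measure R).

Lemma Rintegral_is_derive_infty (F f : R -> R) :
  (forall x : R, is_derive x 1 F (f x)) -> continuous f ->
  mu.-integrable `]0, +oo[ (EFin \o f) -> F x @[x --> +oo] --> (0 : R) ->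
  \int[mu]_(x in `]0, +oo[) f x = - F 0.
Proof.
move=> dF cf intf F0.
have cv1 : \int[mu]_(t in `]0, +oo[) (f t * (t <= n%:R)%R%:R) @[n --> \oo] --> \int[mu]_(t in `]0, +oo[) f t.
  apply: (proj2 (@dominated_Rintegral _ _ (fun n t => f t * (t <= n%:R)%R%:R) _ (fun t => `|f t|) _ _ _ _ _ _)) => //.
  - move=> n; apply: measurable_funM; first exact: measurable_integrable intf.
    rewrite (_ : (fun t : R => (t <= n%:R)%R%:R : R) = \1_(`]-oo, n%:R]%classic)); first exact: measurable_indic.
    by apply/funext => t; rewrite indicE mem_setE in_itv.
  - exact: integrable_norm.
  - apply: aeW => x _; apply: cvg_near_cst; near=> n.
    rewrite (_ : (x <= n%:R) = true) ?mulr1//.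
    near: n; exact: nbhs_infty_ger.
  - exact: measurable_integrable intf.
  - by move=> n x _; case: (x <= n%:R); rewrite ?mulr1 ?mulr0 ?normr0.
have E (n : nat) : \int[mu]_(t in `]0, +oo[) (f t * (t <= n%:R)%R%:R) = F n%:R - F 0.
  have [->|n0] := eqVneq n 0%N.
    rewrite subrr [LHS]Rintegral_mkcond.
    transitivity (\int[mu]_(x in setT) (0 : R)); last by rewrite /Rintegral integral0.
    apply: eq_Rintegral => t _.
    rewrite patchE mem_setE in_itv/= andbT.
    by case: (ltP (0 : R) t) => // t0; rewrite mulr0.
  have n0' : 0 < n%:R :> R by rewrite ltr0n lt0n.
  rewrite -(Rintegral_is_derive n0' dF cf) -[RHS]Rintegral_itv_obnd_cbnd; last first.
    by apply: integrableS intf => // t; rewrite /= !in_itv/= andbT => /andP[].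
  rewrite [LHS]Rintegral_mkcond [RHS]Rintegral_mkcond; apply: eq_Rintegral => t _.
  rewrite !patchE !mem_setE !in_itv/= andbT.
  by case: ltP => //= t0; case: leP; rewrite ?mulr1 ?mulr0.
have cv2 : F n%:R - F 0 @[n --> \oo] --> 0 - F 0.
  apply: cvgB; last exact: cvg_cst.
  exact: (cvg_comp _ _ cvgr_idn F0).
rewrite -[RHS]sub0r -(cvg_lim (@Rhausdorff R) cv2) -(cvg_lim (@Rhausdorff R) cv1).
by rewrite (funext E).
Unshelve. all: end_near. Qed.

End improper_FTC.

Section hankel_kernel.
Context {R : realType}.
Local Notation plane := (measurableTypeR R * measurableTypeR R)%type.
Local Notation mu := (@lebesgue_measure R).
Variables (alpha theta lambda : R).
Hypotheses (alpha12 : 1 < alpha < 2) (theta_gt : pi / 2 < theta)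
  (theta_lt : alpha * theta < pi) (lambda0 : 0 < lambda).
Implicit Types (t x s : R).

Let q := 1 + cos (alpha * theta).
Let kappa := - cos theta.
Let a1 : 1 < alpha. Proof. by case/andP: alpha12. Qed.
Let a2 : alpha < 2. Proof. by case/andP: alpha12. Qed.
Let theta0 : 0 < theta. Proof. by apply: lt_trans theta_gt; rewrite divr_gt0 ?pi_gt0. Qed.
Let theta_pi : theta < pi.
Proof.
by apply: le_lt_trans theta_lt; rewrite -[leLHS]mul1r ler_wpM2r ?(ltW theta0) ?(ltW a1).
Qed.

Lemma hankel_kappa_gt0 : 0 < kappa.
Proof.
rewrite oppr_gt0 -[theta](subrK (pi / 2)) addrC.
have -> : cos (pi / 2 + (theta - pi / 2)) = - sin (theta - pi / 2).
  by rewrite cosD cos_pihalf sin_pihalf; ring.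
rewrite oppr_lt0; apply: sin_gt0_pi.
have := theta_gt; have := theta_pi; have := @pi_gt0 R => ? ? ?; apply/andP; split; lra.
Qed.

Lemma hankel_q_gt0 : 0 < q.
Proof.
have h : cos pi < cos (alpha * theta).
  rewrite ltr_cos//; first by rewrite in_itv/= (ltW theta_lt) mulr_ge0// ltW// (lt_trans _ a1).
  by rewrite in_itv/= lexx (ltW (@pi_gt0 R)).
by rewrite /q -ltrBlDl sub0r -cospi.
Qed.

Lemma hankel_q_le1 : q <= 1.
Proof.
rewrite /q gerDl.
have -> : alpha * theta = pi / 2 + (alpha * theta - pi / 2) by ring.
rewrite cosD cos_pihalf sin_pihalf mul0r mul1r sub0r oppr_le0.
apply: sin_ge0_pi.
have h : 1 * theta <= alpha * theta by rewrite ler_wpM2r ?ltW.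
have := theta_gt; have := theta_lt; have := @pi_gt0 R => ? ? ?; apply/andP; split; lra.
Qed.

(* z^(2 alpha - 1) / (z^alpha + lambda) at z = e^(x + i theta) *)
Let Q x : R[i] := cexp (2 * alpha - 1) x theta / (cexp alpha x theta + lambda%:C%C).

Let denominator_ge x : q * lambda <= cabs (cexp alpha x theta + lambda%:C%C) /\
  q * expR (alpha * x) <= cabs (cexp alpha x theta + lambda%:C%C).
Proof.
have := @cabs_denominator_ge R q 1 lambda alpha x theta.
rewrite mul1r (_ : 1%:C%C = 1)// mul1r; apply => //.
- by rewrite (ltW hankel_q_gt0) hankel_q_le1.
- exact: ltW.
- by rewrite /q addrAC subrr add0r.
Qed.

Let denominator_neq0 x : cexp alpha x theta + lambda%:C%C != 0.
Proof.
rewrite -cabs_eq0 gt_eqF//; apply: lt_le_trans (proj1 (denominator_ge x)).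
by rewrite mulr_gt0// hankel_q_gt0.
Qed.

Lemma cabs_hankel_le x : cabs (Q x) <= expR ((2 * alpha - 1) * x) / (q * lambda).
Proof.
rewrite /Q cabsM cabsV cabs_cexp ler_wpM2l ?expR_ge0//.
have [h _] := denominator_ge x.
by rewrite lef_pV2 ?posrE ?mulr_gt0 ?hankel_q_gt0// (lt_le_trans _ h)// mulr_gt0 ?hankel_q_gt0.
Qed.

(** A second bound, with less growth at x = +oo, makes the double integral in
    [laplace_hankel] absolutely convergent. *)
Lemma cabs_hankel_le' x : cabs (Q x) <= expR ((alpha - 1) * x) / q.
Proof.
rewrite /Q cabsM cabsV cabs_cexp.
have [_ h] := denominator_ge x.
have -> : expR ((alpha - 1) * x) / q = expR ((2 * alpha - 1) * x) / (q * expR (alpha * x)).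
  rewrite [(2 * alpha - 1) * x](_ : _ = (alpha - 1) * x + alpha * x); last by ring.
  rewrite expRD; field; rewrite !gt_eqF ?expR_gt0 ?hankel_q_gt0//.
rewrite ler_wpM2l ?expR_ge0//.
by rewrite lef_pV2 ?posrE ?mulr_gt0 ?expR_gt0 ?hankel_q_gt0// (lt_le_trans _ h)// mulr_gt0 ?expR_gt0 ?hankel_q_gt0.
Qed.

Let ccont_Q x : ccont Q x.
Proof.
have hC : holo_at (fun u v => cexp alpha u v + lambda%:C%C) (fun u v => alpha%:C%C * cexp alpha u v + 0) x theta.
  by apply: (holo_add (holo_cexp _ _ _)); exact: holo_cst.
exact: ccontM (holo_ccont (holo_cexp _ _ _)) (holo_ccont (holo_inv (denominator_neq0 x) hC)).
Qed.

Let mreQ : measurable_fun [set: R] (fun x => re (Q x)).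
Proof. by apply: continuous_measurable_fun => x; have [] := ccont_Q x. Qed.
Let mimQ : measurable_fun [set: R] (fun x => im (Q x)).
Proof. by apply: continuous_measurable_fun => x; have [] := ccont_Q x. Qed.

(* e^(t z) for z on the ray *)
Let E t x : R[i] := cexp t (expR x * cos theta) (expR x * sin theta).

Let cabs_E t x : cabs (E t x) = expR (- (kappa * t * expR x)).
Proof. by rewrite /E cabs_cexp; congr expR; rewrite /kappa; ring. Qed.

Let derive_cexp t (a b : R) (w : R[i]) : is_derive t 1 (fun t => im (cexp t a b * w)) (im ((a +i* b)%C * cexp t a b * w)).
Proof.
have dl (c z : R) : is_derive z 1 (fun u : R => u * c) c.
  by apply: is_derive_eq; rewrite /GRing.scale/=; ring.
have de : is_derive t 1 (fun u : R => expR (u * a)) (expR (t * a) * a).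
  exact: (@is_derive1_comp _ expR (fun u : R => u * a)).
have dc : is_derive t 1 (fun u : R => cos (u * b)) (- sin (t * b) * b).
  exact: (@is_derive1_comp _ cos (fun u : R => u * b)).
have ds : is_derive t 1 (fun u : R => sin (u * b)) (cos (t * b) * b).
  exact: (@is_derive1_comp _ sin (fun u : R => u * b)).
case: w => c d; rewrite /im/=.
by apply: is_derive_eq; rewrite /GRing.scale/=; ring.
Qed.

Let measurable_imE (w : R -> R[i]) : 
  measurable_fun [set: R] (fun x => re (w x)) -> measurable_fun [set: R] (fun x => im (w x)) ->
  measurable_fun [set: plane] (fun z : plane => im (E z.1 z.2 * w z.2)).
Proof.
move=> mr mi.
have m2 (f : R -> R) : measurable_fun [set: R] f -> measurable_fun [set: plane] (fun z : plane => f z.2).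
  by move=> mf; apply: (measurableT_comp mf); exact: measurable_snd.
have me : measurable_fun [set: R] (@expR R) by apply: continuous_measurable_fun; exact: continuous_expR.
have ms (c : R) : measurable_fun [set: plane] (fun z : plane => (z.1 : R) * (expR (z.2 : R) * c)).
  apply: measurable_funM; first exact: measurable_fst.
  by apply: measurable_funM => //; exact: m2.
have mE1 : measurable_fun [set: plane] (fun z : plane => re (E z.1 z.2)).
  apply: measurable_funM; first exact: (measurableT_comp me (ms _)).
  apply: (measurableT_comp _ (ms _)).
  by apply: continuous_measurable_fun; exact: continuous_cos.
have mE2 : measurable_fun [set: plane] (fun z : plane => im (E z.1 z.2)).
  apply: measurable_funM; first exact: (measurableT_comp me (ms _)).
  apply: (measurableT_comp _ (ms _)).
  by apply: continuous_measurable_fun; exact: continuous_sin.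
under eq_fun do rewrite imM.
exact: (measurable_funD (measurable_funM mE1 (m2 _ mi)) (measurable_funM mE2 (m2 _ mr))).
Qed.

Let measurable_imE1 t (w : R -> R[i]) : 
  measurable_fun [set: R] (fun x => re (w x)) -> measurable_fun [set: R] (fun x => im (w x)) ->
  measurable_fun [set: R] (fun x => im (E t x * w x)).
Proof.
move=> mr mi; have h := measurable_imE mr mi.
exact: (measurableT_comp h (pair1_measurable t)).
Qed.

Let K t x := im (E t x * Q x).
Let K' t x := im (E t x * (cexp 1 x theta * Q x)).

Let zE x : cexp 1 x theta = (expR x * cos theta +i* (expR x * sin theta))%C.
Proof. by rewrite /cexp !mul1r. Qed.

Let derive_K t x : is_derive t 1 (K ^~ x) (K' t x).
Proof.
have h := derive_cexp t (expR x * cos theta) (expR x * sin theta) (Q x).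
apply: (@is_derive_eq _ _ _ _ _ _ _ _ h).
by rewrite /K' zE /E [in RHS]mulrCA [in RHS]mulrA.
Qed.

Let M := (1 + (5 / kappa) ^+ 5) / (q * lambda).

Let M0 : 0 <= M.
Proof.
rewrite /M divr_ge0//; last by rewrite mulr_ge0 ?(ltW lambda0) ?(ltW hankel_q_gt0).
by rewrite addr_ge0// exprn_ge0// divr_ge0// (ltW hankel_kappa_gt0).
Qed.

Let K_exp t x : `|K t x| <= expR ((2 * alpha - 1) * x) * expR (- (kappa * t * expR x)) / (q * lambda).
Proof.
apply: le_trans (normr_Im_le _) _; rewrite cabsM cabs_E.
rewrite [expR (_ * x) * expR _]mulrC -[leRHS]mulrA.
by rewrite ler_wpM2l ?expR_ge0// cabs_hankel_le.
Qed.

Let K'_exp t x : `|K' t x| <= expR ((2 * alpha) * x) * expR (- (kappa * t * expR x)) / (q * lambda).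
Proof.
apply: le_trans (normr_Im_le _) _; rewrite cabsM cabs_E [cabs (_ * Q x)]cabsM cabs_cexp.
rewrite [expR (_ * x) * expR _]mulrC -[leRHS]mulrA.
rewrite ler_wpM2l ?expR_ge0//.
rewrite [2 * alpha * x](_ : _ = 1 * x + (2 * alpha - 1) * x); last by ring.
rewrite expRD -[leRHS]mulrA ler_wpM2l ?expR_ge0//.
exact: cabs_hankel_le.
Qed.

Let le_decay (k p t x : R) : 1 <= p <= 4 -> 0 < t ->
  k <= expR (p * x) * expR (- (kappa * t * expR x)) / (q * lambda) ->
  k <= M * t `^ (- p) * expR (- 1 * `|x - (- ln t)|).
Proof.
move=> p14 t0 h; apply: le_trans h _.
have -> : M * t `^ (- p) * expR (- 1 * `|x - (- ln t)|) = (1 + (5 / kappa) ^+ 5) * t `^ (- p) * expR (- 1 * `|x - (- ln t)|) / (q * lambda).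
  by rewrite /M; ring.
rewrite ler_wpM2r//; last exact: expR_decay p14 hankel_kappa_gt0 t0.
by rewrite invr_ge0 mulr_ge0 ?(ltW lambda0) ?(ltW hankel_q_gt0).
Qed.

Let p1 : 1 <= 2 * alpha - 1 <= 4.
Proof. by move: a1 a2 => ? ?; apply/andP; split; lra. Qed.
Let p2 : 1 <= 2 * alpha <= 4.
Proof. by move: a1 a2 => ? ?; apply/andP; split; lra. Qed.

Let K_le t x : 0 < t -> `|K t x| <= M * t `^ (- (2 * alpha - 1)) * expR (- 1 * `|x - (- ln t)|).
Proof. by move=> t0; exact: le_decay p1 t0 (K_exp t x). Qed.

Let K'_le t x : 0 < t -> `|K' t x| <= M * t `^ (- (2 * alpha)) * expR (- 1 * `|x - (- ln t)|).
Proof. by move=> t0; exact: le_decay p2 t0 (K'_exp t x). Qed.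

Let mK t : measurable_fun [set: R] (K t).
Proof. exact: measurable_imE1. Qed.

Let mK' t : measurable_fun [set: R] (K' t).
Proof.
have cz x : ccont (fun x => cexp 1 x theta * Q x) x.
  exact: ccontM (holo_ccont (holo_cexp _ _ _)) (ccont_Q x).
by apply: measurable_imE1; apply: continuous_measurable_fun => x; have [] := cz x.
Qed.

Let iK t : 0 < t -> mu.-integrable setT (EFin \o K t).
Proof.
move=> t0; apply: (@le_integrable_fct _ _ _ mu setT measurableT (K t) (fun x => M * t `^ (- (2 * alpha - 1)) * expR (- 1 * `|x - (- ln t)|)) (mK t)).
  by move=> x _; exact: K_le.
exact: integrable_expM_norm.
Qed.

Let iK' t : 0 < t -> mu.-integrable setT (EFin \o K' t).
Proof.
move=> t0; apply: (@le_integrable_fct _ _ _ mu setT measurableT (K' t) (fun x => M * t `^ (- (2 * alpha)) * expR (- 1 * `|x - (- ln t)|)) (mK' t)).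
  by move=> x _; exact: K'_le.
exact: integrable_expM_norm.
Qed.

Definition hankel t := - (lambda * pi)^-1 * \int[mu]_x K t x.
Definition hankel' t := - (lambda * pi)^-1 * \int[mu]_x K' t x.

Let Rintegral_le (k : R -> R) (C m : R) : mu.-integrable setT (EFin \o k) ->
  (forall x, `|k x| <= C * expR (- 1 * `|x - m|)) -> `|\int[mu]_x k x| <= C * 2.
Proof.
move=> ik kC; apply: le_trans (le_normr_Rintegral measurableT ik) _.
have := @Rintegral_expM_norm R 1 m C ltr01; rewrite divr1 => <-.
apply: le_Rintegral => //; first exact: integrable_norm.
exact: integrable_expM_norm.
Qed.

Let normc1 : `|- (lambda * pi)^-1| = (lambda * pi)^-1.
Proof. by rewrite normrN ger0_norm// invr_ge0 mulr_ge0 ?pi_ge0 ?(ltW lambda0). Qed.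

Lemma hankel_le t : 0 < t -> `|hankel t| <=
  (1 + (5 / kappa) ^+ 5) * 2 / (q * pi) * t `^ (1 - 2 * alpha) / lambda ^+ 2.
Proof.
move=> t0; rewrite /hankel normrM normc1.
have h := Rintegral_le (iK t0) (fun x => K_le x t0).
have -> : (1 + (5 / kappa) ^+ 5) * 2 / (q * pi) * t `^ (1 - 2 * alpha) / lambda ^+ 2 =
   (lambda * pi)^-1 * (M * t `^ (- (2 * alpha - 1)) * 2).
  rewrite opprB /M; have := @pi_gt0 R; move: (pi : R) (5 / kappa) hankel_q_gt0 => P w q0 P0; field.
  by rewrite !gt_eqF.
by rewrite ler_wpM2l// invr_ge0 mulr_ge0 ?pi_ge0 ?(ltW lambda0).
Qed.

Lemma hankel'_le t : 0 < t -> `|hankel' t| <=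
  (1 + (5 / kappa) ^+ 5) * 2 / (q * pi) * t `^ (- (2 * alpha)) / lambda ^+ 2.
Proof.
move=> t0; rewrite /hankel' normrM normc1.
have h := Rintegral_le (iK' t0) (fun x => K'_le x t0).
have -> : (1 + (5 / kappa) ^+ 5) * 2 / (q * pi) * t `^ (- (2 * alpha)) / lambda ^+ 2 =
   (lambda * pi)^-1 * (M * t `^ (- (2 * alpha)) * 2).
  rewrite /M; have := @pi_gt0 R; move: (pi : R) (5 / kappa) hankel_q_gt0 => P w q0 P0; field.
  by rewrite !gt_eqF.
by rewrite ler_wpM2l// invr_ge0 mulr_ge0 ?pi_ge0 ?(ltW lambda0).
Qed.

Lemma is_derive_hankel t : 0 < t -> is_derive t 1 hankel (hankel' t).
Proof.
move=> t0; have t2 : 0 < t / 2 by rewrite divr_gt0.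
have h : is_derive t 1 (fun z => \int[mu]_x K z x) (\int[mu]_x K' t x).
  apply: (@is_derive_under_Rintegral R K K' setT t (t / 2) (2 * t)
    (fun x => M * (t / 2) `^ (- (2 * alpha)) * expR (- 1 * `|x - (- ln (t / 2))|))) => //.
  - by apply/andP; split; lra.
  - by move=> z /andP[z1 _]; apply: iK; exact: lt_trans z1.
  - by move=> x; apply: mulr_ge0; [apply: mulr_ge0; [exact: M0|exact: powR_ge0]|exact: expR_ge0].
  - exact: integrable_expM_norm.
  - move=> z x /andP[z1 _] _; apply: le_decay p2 t2 _.
    apply: le_trans (K'_exp z x) _.
    rewrite ler_wpM2r ?invr_ge0 ?mulr_ge0 ?(ltW lambda0) ?(ltW hankel_q_gt0)//.
    rewrite ler_wpM2l ?expR_ge0// ler_expR lerN2 ler_wpM2r ?expR_ge0//.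
    by rewrite ler_wpM2l ?(ltW hankel_kappa_gt0)// ltW.
by rewrite /hankel /hankel'; exact: is_derive_eq.
Qed.

Let sin_theta_gt0 : 0 < sin theta. Proof. by rewrite sin_gt0_pi// theta0. Qed.

Let resolvent_neq0 s x : s%:C%C - cexp 1 x theta != 0.
Proof.
rewrite eq_complex negb_and; apply/orP; right => /=.
by rewrite !mul1r sub0r oppr_eq0 mulf_neq0// gt_eqF// expR_gt0.
Qed.

(* e^(-s t) multiplies e^(t z) into e^(t (z - s)). *)
Let expM_K s t x : expR (- s * t) * K t x =
  im (cexp t (expR x * cos theta - s) (expR x * sin theta) * Q x).
Proof.
rewrite /K; move: (Q x) => w; rewrite /E /cexp !imM/= mulrBr expRD.
by rewrite (_ : - (t * s) = - s * t); ring.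
Qed.

Let expM_K_le s t x : `|expR (- s * t) * K t x| <= cabs (Q x) * expR (- (s + kappa * expR x) * t).
Proof.
rewrite expM_K; apply: le_trans (normr_Im_le _) _.
rewrite cabsM cabs_cexp mulrC ler_wpM2l ?cabs_ge0// ler_expR le_eqVlt; apply/orP; left.
by apply/eqP; rewrite /kappa; ring.
Qed.

Let rate_gt0 s x : 0 < s -> 0 < s + kappa * expR x.
Proof. by move=> s0; rewrite addr_gt0// mulr_gt0 ?expR_gt0// hankel_kappa_gt0. Qed.

Let integral_half_expM (d C : R) : 0 < d -> 0 <= C ->
  (\int[mu]_(t in `]0%R, +oo[) (C * expR (- d * t))%:E = (C / d)%:E)%E.
Proof.
move=> d0 C0; rewrite integral_itv_obnd_cbnd; last first.
  by apply/measurable_EFinP; apply: measurable_funM => //; exact: measurable_expM.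
under eq_integral do rewrite EFinM.
rewrite ge0_integralZl//.
- by rewrite integral_expM.
- by apply/measurable_EFinP; exact: measurable_expM.
Qed.

Let integrable_half_expM (d C : R) : 0 < d -> 0 <= C ->
  mu.-integrable `]0, +oo[ (EFin \o (fun t => C * expR (- d * t))).
Proof.
move=> d0 C0; apply: (ge0_integrable_fct (M := C / d)) => //.
- by apply: measurable_funM => //; exact: measurable_expM.
- by move=> x _; rewrite mulr_ge0 ?expR_ge0.
- by rewrite integral_half_expM.
Qed.

Let cont_expM_K s x : continuous (fun t => expR (- s * t) * K t x).
Proof.
by move=> t; apply: cvgM; [exact: continuous_expM|exact: is_derive_continuous (derive_K t x)].
Qed.

(** e^(t (z - s)) / (z - s) is a primitive that vanishes at +oo. *)
Let laplace_K s x : 0 < s -> laplace_integrable (K ^~ x) s /\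
  laplace (K ^~ x) s = im (Q x / (s%:C%C - cexp 1 x theta)).
Proof.
move=> s0; pose a := expR x * cos theta - s; pose b := expR x * sin theta.
have a0 : a < 0.
  have := rate_gt0 x s0; rewrite (_ : kappa * expR x = - (expR x * cos theta)); last by rewrite /kappa; ring.
  by rewrite /a; lra.
have iL : laplace_integrable (K ^~ x) s.
  apply: (@le_integrable_fct _ _ _ mu _ (measurable_itv _) _ (fun t => cabs (Q x) * expR (- (s + kappa * expR x) * t))).
  - by apply: measurable_funTS; apply: continuous_measurable_fun; exact: cont_expM_K.
  - by move=> t _; exact: expM_K_le.
  - by apply: integrable_half_expM; [exact: rate_gt0|exact: cabs_ge0].
split => //; rewrite /laplace.
pose W := Q x / (cexp 1 x theta - s%:C%C).
have zs0 : cexp 1 x theta - s%:C%C != 0.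
  by rewrite -oppr_eq0 opprB; exact: resolvent_neq0.
have abE : (a +i* b)%C = cexp 1 x theta - s%:C%C.
  by rewrite zE /a /b; apply/eqP; rewrite eq_complex/= oppr0 addr0 !eqxx.
have dF t : is_derive t 1 (fun t => im (cexp t a b * W)) (expR (- s * t) * K t x).
  have h := derive_cexp t a b W.
  apply: (@is_derive_eq _ _ _ _ _ _ _ _ h).
  rewrite expM_K -/a -/b abE /W; congr im.
  by move: (cexp t a b) (Q x) (cexp 1 x theta - s%:C%C) zs0 => u v w w0; field.
rewrite (@Rintegral_is_derive_infty R (fun t => im (cexp t a b * W)) _ dF (@cont_expM_K s x) iL).
  rewrite cexp0 mul1r -imN; congr im; rewrite /W -mulrN -invrN opprB//.
apply/norm_cvg0P; apply: (@squeeze_cvgr _ _ _ _ (cst 0) (fun t => expR (- (- a) * t) * cabs W)).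
- apply: nearW => t; apply/andP; split; first exact: normr_ge0.
  apply: (le_trans (normr_Im_le (cexp t a b * W))).
  by rewrite cabsM cabs_cexp opprK [t * a]mulrC.
- exact: cvg_cst.
- rewrite -[X in _ --> X](mul0r (cabs W)); apply: cvgM; last exact: cvg_cst.
  by apply: expM_cvgy; rewrite oppr_gt0.
Qed.

Let d := Num.min (alpha - 1) (2 - alpha).
Let d0 : 0 < d.
Proof. by rewrite /d lt_min; move: a1 a2 => ? ?; apply/andP; split; lra. Qed.

(* The powers e^((alpha - 1) x) / s for x <= 0 and e^((alpha - 2) x) / kappa for
   x >= 0 both decay, as 1 < alpha < 2. *)
Let rate_le s x : 0 < s -> cabs (Q x) / (s + kappa * expR x) <=
  q^-1 * (s^-1 + kappa^-1) * expR (- d * `|x - 0|).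
Proof.
move=> s0; have k0 := hankel_kappa_gt0; have q0 := hankel_q_gt0.
rewrite subr0; apply: (@le_trans _ _ (expR ((alpha - 1) * x) / q / (s + kappa * expR x))).
  by rewrite ler_wpM2r ?invr_ge0 ?(ltW (rate_gt0 _ _))// cabs_hankel_le'.
rewrite mulrAC mulrC -[leRHS]mulrA ler_wpM2l ?invr_ge0 ?(ltW q0)//.
have e0 := expR_gt0 x.
have [x0|x0] := leP 0 x.
  rewrite (ger0_norm x0).
  apply: (@le_trans _ _ (kappa^-1 * expR (- d * x))).
    rewrite ler_pdivrMr ?rate_gt0// -mulrA.
    apply: (@le_trans _ _ (kappa^-1 * (expR (- d * x) * (kappa * expR x)))).
      rewrite [leRHS](_ : _ = expR (- d * x) * expR x); last by field; rewrite gt_eqF.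
      rewrite -expRD ler_expR.
      have : d * x <= (2 - alpha) * x by rewrite ler_wpM2r// ge_min lexx orbT.
      lra.
    by rewrite ler_wpM2l ?invr_ge0 ?(ltW k0)// ler_wpM2l ?expR_ge0// lerDr ltW.
  by rewrite ler_wpM2r ?expR_ge0// lerDr invr_ge0 ltW.
rewrite (ltr0_norm x0) mulrNN.
apply: (@le_trans _ _ (s^-1 * expR (d * x))); last first.
  by rewrite ler_wpM2r ?expR_ge0// lerDl invr_ge0 ltW.
rewrite [leLHS]mulrC ler_pM ?invr_ge0 ?expR_ge0 ?(ltW (rate_gt0 _ _))//.
  by rewrite lef_pV2 ?posrE ?rate_gt0// lerDl mulr_ge0 ?ltW.
by rewrite ler_expR ler_wnM2r ?(ltW x0)// ge_min lexx.
Qed.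

Lemma integral_resolvent s Y : 0 < s -> theta < Y -> alpha * Y < pi -> Y < pi -> cos (alpha * Y) <= 0 ->
  mu.-integrable setT (EFin \o (fun x => im (Q x / (s%:C%C - cexp 1 x theta)))) /\
  \int[mu]_x (im (Q x / (s%:C%C - cexp 1 x theta))) =
    pi * (s `^ (2 * alpha - 2) / (s `^ alpha + lambda)).
Proof.
move=> s0 tY aY Yp cY.
have eE p : s `^ p = expR (p * ln s) by rewrite /powR gt_eqF.
have Y0 : 0 < Y by exact: lt_trans tY.
have t0Y : 0 < theta < Y by rewrite theta0.
have [i1 i2] := @mittag_leffler_contour R alpha Y (ln s) lambda alpha12 Y0 aY cY lambda0 theta t0Y Yp.
rewrite lnK ?posrE// in i1 i2.
rewrite !eE -i2.
pose g := (fun x => im (Q x / (s%:C%C - cexp 1 x theta))).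
have mg : measurable_fun setT g.
  apply: continuous_measurable_fun => x.
  have hC := holo_add (@holo_cst R s%:C%C x theta) (holo_mul (@holo_cst R (-1) x theta) (@holo_cexp R 1 x theta)).
  have n0 : s%:C%C + -1 * cexp 1 x theta != 0 by rewrite mulN1r; exact: resolvent_neq0.
  have [_] := ccontM (ccont_Q x) (holo_ccont (holo_inv n0 hC)).
  rewrite (_ : (fun u => im (Q u * (s%:C%C + -1 * cexp 1 u theta)^-1)) = g)//.
  by apply/funext => u; rewrite mulN1r.
have mag : measurable_fun setT (fun x => `|g x|%:E) by apply/measurable_EFinP; exact: measurableT_comp.
have mg' : measurable_fun setT (fun x => (g x)%:E) by exact/measurable_EFinP.
split.
  apply/integrableP; split => //.
  have ag0 x : (0 <= `|g x|%:E)%E by rewrite lee_fin.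
  have /integrableP[_] := i1.
  by rewrite -(@ge0_integral_shift R (ln s) _ mag ag0).
by rewrite /Rintegral -(@integral_shift R (ln s) _ mg').
Qed.

(** Fubini: the transform of the integrand at x is the residue integrand of
    [integral_resolvent]. *)
Lemma laplace_hankel s Y : 0 < s -> theta < Y -> alpha * Y < pi -> Y < pi -> cos (alpha * Y) <= 0 ->
  laplace_integrable hankel s /\
  laplace hankel s = - (s `^ (2 * alpha - 2) / (lambda * (s `^ alpha + lambda))).
Proof.
move=> s0 tY aY Yp cY.
pose h (z : plane) : R := \1_(`]0%R, +oo[%classic) (z.1 : R) * (expR (- s * z.1) * K z.1 z.2).
have mh : measurable_fun [set: plane] h.
  apply: measurable_funM.
    apply: (measurableT_comp _ measurable_fst).
    exact: measurable_indic.
  apply: measurable_funM; last exact: measurable_imE.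
  exact: (measurableT_comp (@measurable_expM R (- s) setT) measurable_fst).
have mh' : measurable_fun setT (EFin \o h) by exact/measurable_EFinP.
have hE t x : 0 < t -> h (t, x) = expR (- s * t) * K t x.
  by move=> t0; rewrite /h/= indicE mem_setE in_itv/= andbT t0 mul1r.
have h0 t x : ~ 0 < t -> h (t, x) = 0.
  by move=> /negP t0; rewrite /h/= indicE mem_setE in_itv/= andbT (negbTE t0) mul0r.
have int_abs x : (\int[mu]_t `|h (t, x)|%:E <= (cabs (Q x) / (s + kappa * expR x))%:E)%E.
  rewrite -integral_half_expM ?cabs_ge0 ?rate_gt0// [leRHS]integral_mkcond.
  apply: ge0_le_integral => //.
  - apply/measurable_EFinP; apply: measurableT_comp => //.
    exact: (measurableT_comp mh (pair2_measurable x)).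
  - apply/(measurable_restrictT _ _).1 => //; apply/measurable_EFinP.
    by apply: measurable_funM => //; exact: measurable_expM.
  - move=> t _; rewrite patchE mem_setE in_itv/= andbT; case: ifPn => t0.
      by rewrite lee_fin hE//; exact: expM_K_le.
    by rewrite h0 ?normr0//; exact/negP.
have ih : (mu \x mu)%E.-integrable setT (EFin \o h).
  apply/(integrable21ltyP _ _ mh').
  have /integrableP[mC finC] := @integrable_expM_norm R d 0 (q^-1 * (s^-1 + kappa^-1)) d0.
  apply: le_lt_trans finC; apply: ge0_le_integral => //.
  - by move=> x _; exact: integral_ge0.
  - have mah : measurable_fun setT (fun z => `|h z|%:E).
      by apply/measurable_EFinP; exact: measurableT_comp.
    have ah0 z : (0 <= `|h z|%:E)%E by rewrite lee_fin.
    exact: (@measurable_fun_fubini_tonelli_G _ _ _ _ R mu _ mah ah0).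
  - exact: measurableT_comp.
  - move=> x _; apply: le_trans (int_abs x) _; apply: le_trans (lee_abs _).
    by rewrite lee_fin; exact: rate_le.
have HF : fubini_F mu (EFin \o h) = EFin \o (fun t => \1_(`]0%R, +oo[%classic) t * (expR (- s * t) * \int[mu]_x K t x)).
  apply/funext => t; rewrite /fubini_F /=.
  have [t0|/negP t0] := boolP (0 < t).
    under eq_integral do rewrite hE//.
    rewrite indicE mem_setE in_itv/= andbT t0 mul1r -RintegralZl//; last exact: iK.
    rewrite /Rintegral fineK//; apply: integrable_fin_num => //.
    by apply: integrable_fctZ => //; exact: iK.
  under eq_integral do rewrite h0//.
  by rewrite integral0 indicE mem_setE in_itv/= andbT (negbTE (introN idP t0)) mul0r.
have GF : fubini_G mu (EFin \o h) = EFin \o (fun x => im (Q x / (s%:C%C - cexp 1 x theta))).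
  apply/funext => x; have [l1 l2] := laplace_K x s0.
  change ((\int[mu]_t (h (t, x))%:E)%E = (im (Q x / (s%:C%C - cexp 1 x theta)))%:E).
  rewrite -l2 /laplace /Rintegral fineK; last exact: integrable_fin_num.
  rewrite integral_mkcond [RHS]integral_mkcond; apply: eq_integral => t _.
  rewrite !patchE mem_setE in_itv/= andbT in_setT.
  by case: ifPn => t0; [rewrite hE|rewrite h0//; exact/negP].
have iH := integrable_fubini_F ih.
rewrite HF in iH.
have c0 : lambda * pi != 0 by rewrite mulf_neq0// gt_eqF// pi_gt0.
have iT : laplace_integrable (fun t => \int[mu]_x K t x) s.
  rewrite /laplace_integrable; apply/(integrable_mkcond _ _).2 => //.
  rewrite (_ : _ \_ _ = EFin \o (fun t => \1_(`]0%R, +oo[%classic) t * (expR (- s * t) * \int[mu]_x K t x)))//.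
  by apply/funext => t; rewrite patchE /= indicE; case: ifPn => _; rewrite ?mul1r ?mul0r.
have iT' := laplace_integrableZ (- (lambda * pi)^-1) iT.
split => //.
rewrite /hankel (laplaceZ _ iT).
have [_ iR] := integral_resolvent s0 tY aY Yp cY.
have -> : laplace (fun t => \int[mu]_x K t x) s = pi * (s `^ (2 * alpha - 2) / (s `^ alpha + lambda)).
  rewrite -iR /laplace /Rintegral; congr fine.
  have F : (\int[mu]_t fubini_F mu (EFin \o h) t = \int[mu]_x fubini_G mu (EFin \o h) x)%E := Fubini ih.
  rewrite GF in F; rewrite -[RHS]F HF integral_mkcond; apply: eq_integral => t _.
  by rewrite patchE /= indicE; case: ifPn => _; rewrite ?mul1r ?mul0r.
have al0 : s `^ alpha + lambda != 0 by rewrite gt_eqF// ltr_wpDl// powR_ge0.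
move: (s `^ alpha) (s `^ _) al0 => A B al0; move: c0; rewrite mulf_eq0 negb_or => /andP[l0].
move: (pi : R) => P P0; field; rewrite l0 P0 al0 //.
Qed.

End hankel_kernel.

Section hankel_bounds.
Context {R : realType}.

(** The angle theta of the ray and the half-width Y of the strip are chosen with
    pi/2 < theta < Y < pi/alpha; they depend on alpha only, and so does the
    constant. *)
Lemma relaxation_correction (alpha : R) : 1 < alpha < 2 ->
  exists2 C : R, 0 <= C & forall lambda : R, 0 < lambda ->
  exists rho rho' : R -> R,
  [/\ forall t : R, 0 < t -> is_derive t 1 rho (rho' t),
      forall t : R, 0 < t -> `|rho t| <= C * t `^ (1 - 2 * alpha) / lambda ^+ 2,
      forall t : R, 0 < t -> `|rho' t| <= C * t `^ (- (2 * alpha)) / lambda ^+ 2 &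
      forall s : R, 0 < s -> laplace_integrable rho s /\
        laplace rho s = - (s `^ (2 * alpha - 2) / (lambda * (s `^ alpha + lambda)))].
Proof.
move=> a12; have /andP[a1 a2] := a12; have pi0 := @pi_gt0 R.
have a0 : 0 < alpha by exact: lt_trans a1.
pose Y := (pi / 2 + pi / alpha) / 2 : R.
pose theta := (pi / 2 + Y) / 2 : R.
have aY : alpha * Y = (alpha * (pi / 2) + pi) / 2.
  by rewrite /Y; move: (pi : R) => P; field; rewrite gt_eqF.
have ap : alpha * (pi / 2) < pi.
  have : alpha * (pi / 2) < 2 * (pi / 2) by rewrite ltr_pM2r ?divr_gt0.
  lra.
have pa : pi / 2 < pi / alpha by rewrite ltr_pdivlMr// mulrC.
have pY : pi / 2 < Y by rewrite /Y; lra.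
have pth : pi / 2 < theta by rewrite /theta; lra.
have thY : theta < Y by rewrite /theta; lra.
have aYpi : alpha * Y < pi by rewrite aY; lra.
have ath : alpha * theta < pi by apply: lt_trans aYpi; rewrite ltr_pM2l.
have Y0 : 0 < Y by lra.
have Ypi : Y < pi by apply: le_lt_trans aYpi; rewrite -[leLHS]mul1r ler_wpM2r ?ltW.
have cY : cos (alpha * Y) <= 0.
  have -> : alpha * Y = pi / 2 + (alpha * Y - pi / 2) by ring.
  rewrite cosD cos_pihalf sin_pihalf mul0r mul1r sub0r oppr_le0.
  have : 1 * Y <= alpha * Y by rewrite ler_wpM2r ?ltW.
  by move=> ?; apply: sin_ge0_pi; apply/andP; split; lra.
exists ((1 + (5 / - cos theta) ^+ 5) * 2 / ((1 + cos (alpha * theta)) * pi)).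
  have k0 := hankel_kappa_gt0 a12 pth ath; have q0 := hankel_q_gt0 a12 pth ath.
  rewrite divr_ge0 ?mulr_ge0 ?(ltW q0) ?(ltW pi0)// addr_ge0// exprn_ge0// divr_ge0// ltW//.
move=> lambda l0; exists (hankel alpha theta lambda), (hankel' alpha theta lambda); split.
- by move=> t t0; exact: is_derive_hankel.
- by move=> t t0; exact: hankel_le.
- by move=> t t0; exact: hankel'_le.
- by move=> s s0; exact: (laplace_hankel _ _ _ _ s0 thY).
Qed.

End hankel_bounds.

(** * The scalar Volterra equation *)
Section laplace_inversion.
Context {R : realType}.
Local Notation mu := (@lebesgue_measure R).
Implicit Types (f g : R -> R) (s t : R).

Lemma eq_pos_is_derive f g t (f' : R) : 0 < t -> (forall x : R, 0 < x -> f x = g x) ->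
  is_derive t 1 f f' -> is_derive t 1 g f'.
Proof.
move=> t0 fg; apply: near_eq_is_derive.
by near=> x; apply: fg; near: x; exact: lt_nbhsr.
Unshelve. all: end_near. Qed.

Lemma is_derive_primitive f t :
  (forall T : R, 0 < T -> mu.-integrable `]0, T[ (EFin \o f)) ->
  0 < t -> {for t, continuous f} ->
  is_derive t 1 (fun x => \int[mu]_(r in `]0, x[) f r) (f t).
Proof.
move=> intf t0 ct.
have t1 : t < t + 1 by rewrite ltrDl.
have i1 : mu.-integrable [set` Interval (BRight 0) (BRight (t + 1))] (EFin \o f).
  apply: integrableS (intf (t + 2) _) => //; last by lra.
  by move=> x; rewrite /= !in_itv/= => /andP[-> /=]; lra.
have [d1 d2] := @continuous_FTC1 R f (BRight 0) t (t + 1) t1 i1 t0 ct.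
have h : is_derive t 1 (fun x => \int[mu]_(r in `]0, x]) f r) (f t).
  by split; [exact: d1|rewrite -derive1E].
apply: eq_pos_is_derive h => // x x0.
rewrite -Rintegral_itv_bndo_bndc//.
apply: integrableS (intf (x + 1) _) => //; last by lra.
by move=> z; rewrite /= !in_itv/= => /andP[-> /=]; lra.
Qed.

Lemma laplace_integrable_segment f s t : laplace_integrable f s -> 0 < t ->
  mu.-integrable `]0, t[ (EFin \o f).
Proof.
move=> iff t0; have sub : `]0, t[%classic `<=` (`]0%R, +oo[%classic : set R).
  by move=> x; rewrite /= !in_itv/= andbT => /andP[].
have i1 : mu.-integrable `]0, t[ (EFin \o (fun x => expR (- s * x) * f x)).
  by apply: integrableS iff.
have E x : f x = expR (s * x) * (expR (- s * x) * f x).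
  by rewrite mulrA -expRD mulNr subrr expR0 mul1r.
have i1n : mu.-integrable `]0, t[ (EFin \o (fun x => `|expR (- s * x) * f x|)) := integrable_norm i1.
have i2 : mu.-integrable `]0, t[ (EFin \o (fun x => expR (`|s| * t) * `|expR (- s * x) * f x|)).
  exact: integrable_fctZ.
apply: le_integrable_fct i2 => //.
  rewrite (funext E); apply: measurable_funM; first exact: measurable_expM.
  exact: measurable_integrable i1.
move=> x; rewrite /= in_itv/= => /andP[x0 xt].
rewrite {1}E normrM ler_wpM2r// ger0_norm ?expR_ge0// ler_expR.
apply: (@le_trans _ _ (`|s| * x)); first by rewrite ler_wpM2r ?(ltW x0)// ler_norm.
by rewrite ler_wpM2l// ltW.
Qed.

(** The difference h of the two functions, weighted by e^(-sigma t), has vanishing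
    integrals over (0, tau) for all tau by [laplace_eq0_primitive], and h is their
    derivative. *)
Lemma laplace_inj f g sigma :
  (forall t : R, 0 < t -> {for t, continuous f}) ->
  (forall t : R, 0 < t -> {for t, continuous g}) ->
  laplace_integrable f sigma -> laplace_integrable g sigma ->
  (forall s : R, sigma <= s -> laplace f s = laplace g s) ->
  forall t : R, 0 < t -> f t = g t.
Proof.
move=> cf cg iff ig fg t t0.
have iN := laplace_integrableZ (-1) ig.
have iD := laplace_integrableD iff iN.
pose h x := expR (- sigma * x) * (f x + -1 * g x).
have ch x : 0 < x -> {for x, continuous h}.
  move=> x0; apply: cvgM; first exact: continuous_expM.
  by apply: cvgD; [exact: cf|apply: cvgM; [exact: cvg_cst|exact: cg]].
have h0 s : 0 <= s -> laplace h s = 0.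
  move=> s0; have ss : sigma <= sigma + s by rewrite lerDl.
  transitivity (laplace (fun x => f x + -1 * g x) (sigma + s)).
    apply: eq_Rintegral => x _; rewrite /h mulrA -expRD; congr (expR _ * _); ring.
  rewrite laplaceD; [|exact: laplace_integrableW iff|exact: laplace_integrableW iN].
  rewrite laplaceZ; last exact: laplace_integrableW ig.
  by rewrite fg// mulN1r subrr.
have prim0 x : 0 < x -> \int[mu]_(r in `]0, x[) h r = 0.
  by move=> x0; exact: laplace_eq0_primitive.
have d1 : is_derive t 1 (fun x => \int[mu]_(r in `]0, x[) h r) (h t).
  apply: is_derive_primitive => //; last exact: ch.
  move=> T T0; apply: integrableS iD => // x.
  by rewrite /= !in_itv/= andbT => /andP[].
have d2 : is_derive t 1 (fun x => \int[mu]_(r in `]0, x[) h r) 0.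
  exact: (@eq_pos_is_derive (cst 0) _ t 0 t0 (fun x x0 => esym (prim0 x x0)) (is_derive_cst _ _ _)).
have ht : h t = 0.
  by rewrite -(@derive_val _ _ _ _ _ _ _ d1) (@derive_val _ _ _ _ _ _ _ d2).
move/eqP: ht; rewrite mulf_eq0 gt_eqF ?expR_gt0//= mulN1r subr_eq0.
by move/eqP.
Qed.

Lemma laplace_cst1 s : 0 < s -> laplace_integrable (fun=> 1) s /\ laplace (fun=> 1) s = s^-1.
Proof.
move=> s0.
have E : (\int[mu]_(t in `]0%R, +oo[) (expR (- s * t) * 1)%:E = (s^-1)%:E)%E.
  rewrite integral_itv_obnd_cbnd; last first.
    by apply/measurable_EFinP; apply: measurable_funM => //; exact: measurable_expM.
  by under eq_integral do rewrite mulr1; exact: integral_expM.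
split; last by rewrite /laplace /Rintegral E.
apply: (ge0_integrable_fct (M := s^-1)) => //.
- by apply: measurable_funM => //; exact: measurable_expM.
- by rewrite E.
Qed.

Lemma laplace_primitive f s : 0 < s -> laplace_integrable f s ->
  laplace_integrable (fun t => \int[mu]_(r in `]0, t[) f r) s /\
  laplace (fun t => \int[mu]_(r in `]0, t[) f r) s = s^-1 * laplace f s.
Proof.
move=> s0 iff; have [i1 <-] := laplace_cst1 s0.
apply: laplace_convolution => //.
- move=> t t0; have := laplace_integrable_segment iff t0.
  by rewrite (_ : (fun tau => 1 * f tau) = f)//; apply/funext => x; rewrite mul1r.
- by move=> t t0; apply: eq_Rintegral => x _; rewrite mul1r.
Qed.

Lemma laplace_id s : 0 < s -> laplace_integrable id s /\ laplace id s = s^-1 * s^-1.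
Proof.
move=> s0; have [i1 e1] := laplace_cst1 s0.
have [i2 e2] := laplace_primitive s0 i1.
have E (t : R) : 0 < t -> \int[mu]_(r in `]0, t[) 1 = t.
  by move=> t0; rewrite Rintegral_cst//= (_ : mu `]0, t[%classic = t%:E) ?mul1r//; rewrite lebesgue_measure_itv/= lte_fin t0 sube0.
split; first exact: laplace_integrable_eq E i2.
by rewrite -[s^-1 in X in _ * X]e1 -e2; apply: eq_laplace => t /E.
Qed.

End laplace_inversion.

Section volterra.
Context {R : realType}.
Local Notation mu := (@lebesgue_measure R).
Variables (alpha lambda a b : R) (c : R -> R).
Hypotheses (alpha12 : 1 < alpha < 2) (lambda0 : 0 < lambda).
Hypothesis continuous_c : forall t : R, 0 < t -> {for t, continuous c}.
Hypothesis integrable_c : forall T : R, 0 < T -> mu.-integrable `]0, T[ (EFin \o c).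
Hypothesis volterra_c : {ae mu, forall t : R, 0 < t ->
  c t = a + b * t - lambda * ((Gamma_integral alpha)^-1 *
    \int[mu]_(r in `]0, t[) ((t - r) `^ (alpha - 1) * c r))}.
Implicit Types s t T : R.

Let a1 : 1 < alpha. Proof. by case/andP: alpha12. Qed.
Let a2 : alpha < 2. Proof. by case/andP: alpha12. Qed.
Let al02 : 0 < alpha <= 2. Proof. by rewrite (lt_trans _ a1)//= ltW. Qed.
Let g : R := Gamma_integral alpha.
Let g0 : 0 < g. Proof. exact: Gamma_integral_gt0. Qed.

(* J^alpha f without the factor 1 / Gamma alpha. *)
Let J (f : R -> R) t := \int[mu]_(r in `]0, t[) ((t - r) `^ (alpha - 1) * f r).

Let integrable_J (f : R -> R) t : mu.-integrable `]0, t[ (EFin \o f) -> 0 < t ->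
  mu.-integrable `]0, t[ (EFin \o (fun r => (t - r) `^ (alpha - 1) * f r)).
Proof.
move=> iff t0.
have iN : mu.-integrable `]0, t[ (EFin \o (fun r => `|f r|)) := integrable_norm iff.
have iZ : mu.-integrable `]0, t[ (EFin \o (fun r => t `^ (alpha - 1) * `|f r|)).
  exact: integrable_fctZ.
apply: le_integrable_fct iZ => //.
  apply: measurable_funM; last exact: measurable_integrable iff.
  apply: (measurableT_comp (measurable_powR _)).
  by apply: measurable_funB => //; exact: measurable_cst.
move=> r; rewrite /= in_itv/= => /andP[r0 rt].
rewrite normrM ler_wpM2r// ger0_norm ?powR_ge0//.
by rewrite ge0_ler_powR ?nnegrE ?subr_ge0 ?(ltW rt) ?(ltW t0) ?(ltW a1)// gerBl ltW.
Qed.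

Let laplace_J (f : R -> R) s : 0 < s -> laplace_integrable f s ->
  laplace_integrable (J f) s /\ laplace (J f) s = g * s `^ (- alpha) * laplace f s.
Proof.
move=> s0 iff; have [i1 <-] := laplace_powR al02 s0.
apply: laplace_convolution => //.
by move=> t t0; apply: integrable_J => //; exact: laplace_integrable_segment iff t0.
Qed.

Let affine t := a + b * t.

Let laplace_affine s : 0 < s -> laplace_integrable affine s /\
  laplace affine s = a * s^-1 + b * (s^-1 * s^-1).
Proof.
move=> s0; have [i1 e1] := laplace_cst1 s0; have [i2 e2] := laplace_id s0.
have E t : a * 1 + b * t = affine t by rewrite mulr1.
have ia := laplace_integrableZ a i1; have ib := laplace_integrableZ b i2.
rewrite -(funext E); split; first exact: laplace_integrableD.
by rewrite laplaceD// (laplaceZ _ i1) (laplaceZ _ i2) e1 e2.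
Qed.

(** The transform of J^alpha at s is the factor s^(-alpha) <= 1 / (2 lambda).  Hence
    the integral W of e^(-s t) |c| over (0, T) satisfies W <= A + W / 2 with A
    independent of T. *)
Let laplace_integrable_c s : 0 < s -> 2 * lambda <= s `^ alpha -> laplace_integrable c s.
Proof.
move=> s0 sl.
have mc : measurable_fun (`]0, +oo[%classic : set R) c.
  apply: open_continuous_measurable_fun; first exact: interval_open.
  by move=> t; rewrite inE/= in_itv/= andbT => t0; exact: continuous_c.
pose w t := expR (- s * t) * `|c t|.
have w0 t : 0 <= w t by rewrite mulr_ge0 ?expR_ge0.
have mw : measurable_fun (`]0, +oo[%classic : set R) w.
  by apply: measurable_funM; [exact: measurable_expM|exact: measurableT_comp].
have [iaff _] := laplace_affine s0.
pose A := \int[mu]_(t in `]0, +oo[) `|expR (- s * t) * affine t|.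
have sub T : `]0, T[%classic `<=` (`]0%R, +oo[%classic : set R).
  by move=> x; rewrite /= !in_itv/= andbT => /andP[].
have bound T : 0 < T -> (\int[mu]_(t in `]0%R, T[) (w t)%:E <= (2 * A)%:E)%E.
  move=> T0; pose cT := (fun t => `|c t|) \_ `]0, T[.
  have cT0 t : 0 <= cT t by rewrite /cT patchE; case: ifP.
  have cTE t : 0 < t < T -> cT t = `|c t|.
    by move=> tT; rewrite /cT patchE mem_setE in_itv/= tT.
  have inT : mu.-integrable `]0, T[ (EFin \o (fun t => `|c t|)) := integrable_norm (integrable_c T0).
  have icT : laplace_integrable cT s.
    have i1 : mu.-integrable setT (EFin \o cT).
      by rewrite /cT -restrict_EFin; apply/(integrable_mkcond _ _).1.
    have i2 : mu.-integrable `]0, +oo[ (EFin \o cT) by apply: integrableS i1.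
    apply: le_integrable_fct i2 => //.
      apply: measurable_funM; first exact: measurable_expM.
      exact: measurable_funS (measurable_integrable i1).
    move=> t; rewrite /= in_itv/= andbT => t0.
    rewrite normrM (ger0_norm (cT0 t)) ler_piMl// ger0_norm ?expR_ge0//.
    by rewrite -[leRHS]expR0 ler_expR mulNr oppr_le0 mulr_ge0 ?ltW.
  have eqL : (laplace cT s)%:E = (\int[mu]_(t in `]0%R, T[) (w t)%:E)%E.
    rewrite /laplace /Rintegral fineK; last exact: integrable_fin_num.
    rewrite integral_mkcond [RHS]integral_mkcond; apply: eq_integral => t _.
    rewrite !patchE !mem_setE !in_itv/= andbT.
    case: (ltP 0 t) => //= t0; case: (ltP t T) => tT; first by rewrite cTE ?t0.
    by rewrite /cT patchE mem_setE in_itv/= (leNgt T) in tT * ; rewrite (negbTE tT) andbF mulr0.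
  have AT0 : 0 <= laplace cT s by apply: Rintegral_ge0 => t _; rewrite mulr_ge0 ?expR_ge0.
  have [iJ eJ] := laplace_J s0 icT.
  pose B t := `|expR (- s * t) * affine t| + lambda / g * (expR (- s * t) * J cT t).
  have iaff' : mu.-integrable `]0, +oo[ (EFin \o (fun t => `|expR (- s * t) * affine t|)) := integrable_norm iaff.
  have iJ' : mu.-integrable `]0, +oo[ (EFin \o (fun t => lambda / g * (expR (- s * t) * J cT t))).
    exact: integrable_fctZ.
  have iB : mu.-integrable `]0, +oo[ (EFin \o B) by exact: integrable_fctD.
  have J0 t : 0 <= J cT t by apply: Rintegral_ge0 => r _; rewrite mulr_ge0 ?powR_ge0.
  have B0 t : 0 <= B t.
    by rewrite addr_ge0// mulr_ge0 ?divr_ge0 ?(ltW lambda0) ?(ltW g0)// mulr_ge0 ?expR_ge0.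
  have intB : (\int[mu]_(t in `]0%R, +oo[) (B t)%:E = (A + lambda * s `^ (- alpha) * laplace cT s)%:E)%E.
    rewrite -(fineK (integrable_fin_num _ iB))//; congr EFin.
    rewrite -/(Rintegral _ _ _) RintegralD// -/A; congr (_ + _).
    rewrite RintegralZl//; rewrite -/(laplace (J cT) s) eJ; field.
    by rewrite gt_eqF.
  have le1 : (\int[mu]_(t in `]0%R, T[) (w t)%:E <= \int[mu]_(t in `]0%R, T[) (B t)%:E)%E.
    apply: ae_ge0_le_integral => //.
    - by move=> t _; rewrite lee_fin.
    - by apply/measurable_EFinP; exact: measurable_funS mw.
    - by move=> t _; rewrite lee_fin.
    - apply/measurable_EFinP; apply: measurable_funS (measurable_integrable iB) => //.
    move: volterra_c; apply: filterS; first exact: (ae_filter_ringOfSetsType mu).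
    move=> t ct; rewrite /= in_itv/= => /andP[t0 tT].
    rewrite lee_fin /w /B ct// -/(affine t) normrM [`|expR _|]ger0_norm ?expR_ge0//.
    rewrite [X in _ <= _ + X]mulrCA -mulrDr ler_wpM2l ?expR_ge0//.
    apply: le_trans (ler_normB _ _) _; rewrite lerD2l.
    rewrite normrM (gtr0_norm lambda0) -mulrA ler_wpM2l ?(ltW lambda0)//.
    rewrite normrM gtr0_norm ?invr_gt0// ler_wpM2l ?invr_ge0 ?(ltW g0)//.
    have it := integrable_J (integrable_c t0) t0.
    apply: le_trans (le_normr_Rintegral _ it) _ => //.
    rewrite le_eqVlt; apply/orP; left; apply/eqP; apply: eq_Rintegral => r.
    rewrite inE/= in_itv/= => /andP[r0 rt].
    by rewrite normrM ger0_norm ?powR_ge0// cTE// r0 (lt_trans rt).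
  have le2 : (\int[mu]_(t in `]0%R, T[) (B t)%:E <= \int[mu]_(t in `]0%R, +oo[) (B t)%:E)%E.
    apply: ge0_subset_integral => //.
    - by apply/measurable_EFinP; exact: measurable_integrable iB.
    - by move=> t _; rewrite lee_fin.
  have := le_trans le1 le2; rewrite intB -eqL !lee_fin => h.
  have h2 : lambda * s `^ (- alpha) <= 2^-1.
    rewrite powRN ler_pdivrMr ?powR_gt0//; lra.
  have := ler_wpM2r AT0 h2; lra.
have F n : measurable (`]0%R, n.+1%:R[%classic : set R) by exact: measurable_itv.
have FT : \bigcup_n (`]0%R, n.+1%:R[%classic : set R) = `]0%R, +oo[%classic.
  apply/seteqP; split => t /=.
    by move=> [n _]; rewrite /= !in_itv/= andbT => /andP[].
  rewrite in_itv/= andbT => t0; exists (Num.truncn t) => //=.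
  by rewrite in_itv/= t0 truncnS_gt.
have iw : mu.-integrable `]0, +oo[ (EFin \o w).
  apply: (ge0_integrable_fct (M := 2 * A)) => //.
  rewrite -FT; apply: ge0_integral_bigcup_le => //; last by move=> n; exact: bound.
    move=> n m nm; apply/subsetPset => t; rewrite /= !in_itv/= => /andP[-> /=] tn.
    by apply: lt_le_trans tn _; rewrite ler_nat.
  by rewrite FT.
apply: le_integrable_fct iw => //.
  by apply: measurable_funM => //; exact: measurable_expM.
by move=> t _; rewrite normrM ger0_norm ?expR_ge0.
Qed.

Let laplace_c s : 0 < s -> 2 * lambda <= s `^ alpha ->
  laplace c s * (s `^ alpha + lambda) = s `^ alpha * (a * s^-1 + b * (s^-1 * s^-1)).
Proof.
move=> s0 sl; have ic := laplace_integrable_c s0 sl.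
have [iaff eaff] := laplace_affine s0; have [iJ eJ] := laplace_J s0 ic.
have iJ' := laplace_integrableZ (- (lambda / g)) iJ.
have E : laplace c s = laplace (fun t => affine t + - (lambda / g) * J c t) s.
  rewrite /laplace /Rintegral; congr fine; apply: ae_eq_integral => //.
  - by case/integrableP: ic.
  - by have /integrableP[] := laplace_integrableD iaff iJ'.
  move: volterra_c; apply: filterS; first exact: (ae_filter_ringOfSetsType mu).
  move=> t ct; rewrite /= in_itv/= andbT => /ct {1}->; congr (_ * _)%:E.
  by rewrite mulNr -mulrA.
have {}E : laplace c s = a * s^-1 + b * (s^-1 * s^-1) - lambda / g * (g * s `^ (- alpha) * laplace c s).
  by rewrite {1}E laplaceD// eaff laplaceZ// eJ mulNr.
have p0 : s `^ alpha != 0 by rewrite gt_eqF// powR_gt0.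
rewrite mulrDr {1}E powRN; move: (laplace c s) (s `^ alpha) p0 => L p p0; field.
by rewrite p0 !gt_eqF.
Qed.

Variables (rho rho' : R -> R) (C : R).
Hypothesis derive_rho : forall t : R, 0 < t -> is_derive t 1 rho (rho' t).
Hypothesis laplace_rho : forall s : R, 0 < s -> laplace_integrable rho s /\
  laplace rho s = - (s `^ (2 * alpha - 2) / (lambda * (s `^ alpha + lambda))).

Let g2 : R := Gamma_integral (2 - alpha).
Let al2 : 0 < 2 - alpha <= 2. Proof. by move: a1 a2 => ? ?; apply/andP; split; lra. Qed.
Let g20 : 0 < g2. Proof. exact: Gamma_integral_gt0. Qed.

(* This is t E_(alpha,2)(- lambda t^alpha), characterized by its transform. *)
Let G t := (lambda * g2)^-1 * t `^ (1 - alpha) + rho t.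

Let derive_G t : 0 < t -> is_derive t 1 G ((lambda * g2)^-1 * ((1 - alpha) * t `^ (- alpha)) + rho' t).
Proof.
move=> t0; have h1 := derive_rho t0; have h2 := is_derive1_powR (1 - alpha) t0.
rewrite (_ : 1 - alpha - 1 = - alpha) in h2; last by ring.
have h3 : is_derive t 1 (fun t : R => (lambda * g2)^-1 * t `^ (1 - alpha)) ((lambda * g2)^-1 * ((1 - alpha) * t `^ (- alpha))).
  by have := @is_deriveZ R R^o R^o (fun t : R => t `^ (1 - alpha)) (lambda * g2)^-1 t 1 _ h2.
exact: is_deriveD h3 h1.
Qed.

Let continuous_G t : 0 < t -> {for t, continuous G}.
Proof. by move=> t0; exact: is_derive_continuous (derive_G t0). Qed.

Let laplace_G s : 0 < s -> laplace_integrable G s /\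
  laplace G s * (s `^ alpha + lambda) = s `^ alpha * (s^-1 * s^-1).
Proof.
move=> s0; have [i1 e1] := laplace_rho s0; have [i2 e2] := laplace_powR al2 s0.
rewrite (_ : 2 - alpha - 1 = 1 - alpha) in i2 e2; last by ring.
have i3 := laplace_integrableZ (lambda * g2)^-1 i2.
split; first exact: laplace_integrableD.
rewrite laplaceD// (laplaceZ _ i2) e1 e2 -/g2.
have pE p q : s `^ (p + q) = s `^ p * s `^ q by apply: powRD; rewrite (gt_eqF s0) implybT.
have p0 : s `^ alpha != 0 by rewrite gt_eqF// powR_gt0.
have -> : s `^ (- (2 - alpha)) = s `^ alpha * (s^-1 * s^-1).
  by rewrite opprB pE powRN -[2]/(1 + 1) pE powRr1 ?ltW// invfM.
have -> : s `^ (2 * alpha - 2) = s `^ alpha * (s `^ alpha * (s^-1 * s^-1)).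
  rewrite (_ : 2 * alpha - 2 = alpha + (alpha + - (1 + 1))); last by ring.
  by rewrite !pE powRN pE powRr1 ?ltW// invfM.
have q0 : s `^ alpha + lambda != 0 by rewrite gt_eqF// ltr_wpDl// powR_ge0.
move: (s `^ alpha) p0 q0 => p p0 q0; field.
by rewrite q0 !gt_eqF.
Qed.

(** The primitive of c and a G + b (primitive of G) have the same transform; passing
    to primitives avoids G', whose singularity t^(-alpha) at 0 is not integrable. *)
Lemma volterra_solution t : 0 < t ->
  c t = a * ((lambda * g2)^-1 * ((1 - alpha) * t `^ (- alpha)) + rho' t) +
        b * ((lambda * g2)^-1 * t `^ (1 - alpha) + rho t).
Proof.
move=> t0; pose sigma := (2 * lambda) `^ alpha^-1.
have l20 : 0 < 2 * lambda by rewrite mulr_gt0.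
have s0 : 0 < sigma by exact: powR_gt0.
have al0 : alpha != 0 by rewrite gt_eqF// (lt_trans _ a1).
have sl s : sigma <= s -> 2 * lambda <= s `^ alpha.
  move=> ss; apply: (@le_trans _ _ (sigma `^ alpha)).
    by rewrite /sigma -powRrM mulVf// powRr1// ltW.
  by rewrite ge0_ler_powR ?nnegrE ?(ltW s0) ?(le_trans _ ss) ?(ltW s0)//; move: a1; lra.
pose Pc t := \int[mu]_(r in `]0, t[) c r.
pose PG t := \int[mu]_(r in `]0, t[) G r.
have iGs T : 0 < T -> mu.-integrable `]0, T[ (EFin \o G).
  by move=> T0; apply: (laplace_integrable_segment (s := sigma)) => //; case: (laplace_G s0).
have dPc (x : R) : 0 < x -> is_derive x 1 Pc (c x).
  by move=> x0; apply: is_derive_primitive => //; exact: continuous_c.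
have dPG (x : R) : 0 < x -> is_derive x 1 PG (G x).
  by move=> x0; apply: is_derive_primitive => //; exact: continuous_G.
have dR (x : R) : 0 < x -> is_derive x 1 (fun x => a * G x + b * PG x)
    (a * ((lambda * g2)^-1 * ((1 - alpha) * x `^ (- alpha)) + rho' x) + b * G x).
  move=> x0; have h1 := derive_G x0; have h2 := dPG _ x0.
  have h3 := @is_deriveZ R R^o R^o G a x 1 _ h1.
  have h4 := @is_deriveZ R R^o R^o PG b x 1 _ h2.
  exact: is_deriveD h3 h4.
have key (x : R) : 0 < x -> Pc x = a * G x + b * PG x.
  apply: (@laplace_inj R Pc (fun x => a * G x + b * PG x) sigma).
  - by move=> y y0; exact: is_derive_continuous (dPc _ y0).
  - by move=> y y0; exact: is_derive_continuous (dR _ y0).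
  - by have [] := laplace_primitive s0 (laplace_integrable_c s0 (sl _ (lexx _))).
  - have [iG _] := laplace_G s0; have [iPG _] := laplace_primitive s0 iG.
    by apply: laplace_integrableD; exact: laplace_integrableZ.
  move=> s ss; have s1 : 0 < s by exact: lt_le_trans ss.
  have ic := laplace_integrable_c s1 (sl _ ss).
  have [iG eG] := laplace_G s1; have [iPG ePG] := laplace_primitive s1 iG.
  have [_ ->] := laplace_primitive s1 ic.
  rewrite laplaceD; [|exact: laplace_integrableZ|exact: laplace_integrableZ].
  rewrite (laplaceZ _ iG) (laplaceZ _ iPG) ePG.
  have ec := laplace_c s1 (sl _ ss).
  have q0 : s `^ alpha + lambda != 0 by rewrite gt_eqF// ltr_wpDl// powR_ge0.
  apply: (mulIf q0); rewrite -mulrA ec mulrDl -!mulrA eG; ring.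
have h : is_derive t 1 Pc (a * ((lambda * g2)^-1 * ((1 - alpha) * t `^ (- alpha)) + rho' t) + b * G t).
  exact: (eq_pos_is_derive t0 (fun x x0 => esym (key x x0)) (dR t t0)).
by rewrite -(@derive_val _ _ _ _ _ _ _ (dPc t t0)) (@derive_val _ _ _ _ _ _ _ h).
Qed.

End volterra.

Section relaxation.
Context {R : realType}.
Local Notation mu := (@lebesgue_measure R).

Lemma Gamma_gt0E (x : R) : 0 < x -> Gamma x = Gamma_integral x.
Proof. by move=> x0; rewrite /Gamma x0/= big_ord0 divr1 addr0. Qed.

(** The functional equation, which defines Gamma on (-1, 0). *)
Lemma Gamma_1N (alpha : R) : 1 < alpha < 2 -> Gamma (1 - alpha) = Gamma_integral (2 - alpha) / (1 - alpha).
Proof.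
move=> /andP[a1 a2]; rewrite /Gamma (_ : 0 < 1 - alpha = false); last by apply/negbTE; lra.
have -> : Num.truncn (- (1 - alpha)) = 0%N.
  by apply: truncn_def; apply/andP; split; rewrite ?mulr1n; lra.
by rewrite big_ord1 addr0; congr (Gamma_integral _ / _); ring.
Qed.

(** The leading part of a G' + b G is exactly the expected one, because
    (1 - alpha) / Gamma(2 - alpha) = 1 / Gamma(1 - alpha); the error is
    a rho' + b rho. *)
Theorem relaxation_asymptotics (alpha : R) : 1 < alpha < 2 ->
  exists2 C : R, 0 <= C & forall (lambda a b : R) (c : R -> R), 0 < lambda ->
  (forall t : R, 0 < t -> {for t, continuous c}) ->
  (forall T : R, 0 < T -> mu.-integrable `]0, T[ (EFin \o c)) ->
  {ae mu, forall t : R, 0 < t -> c t = a + b * t - lambda * ((Gamma alpha)^-1 *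
    \int[mu]_(r in `]0, t[) ((t - r) `^ (alpha - 1) * c r))} ->
  forall t : R, 0 < t ->
  `|c t - (a / lambda * (t `^ (- alpha) / Gamma (1 - alpha)) +
           b / lambda * (t `^ (1 - alpha) / Gamma (2 - alpha)))| <=
    C * (`|a| * t `^ (- (2 * alpha)) + `|b| * t `^ (1 - 2 * alpha)) / lambda ^+ 2.
Proof.
move=> a12; have /andP[a1 a2] := a12.
have [C C0 HC] := relaxation_correction a12; exists C => // lambda a b c l0 cc ic.
rewrite Gamma_gt0E; last by exact: lt_trans a1.
move=> vc t t0; have [rho [rho' [dr lr lr' Lr]]] := HC _ l0.
rewrite (volterra_solution a12 l0 cc ic vc dr Lr t0) Gamma_1N// Gamma_gt0E; last by rewrite subr_gt0.
have g20 : 0 < Gamma_integral (2 - alpha) by apply: Gamma_integral_gt0; apply/andP; split; lra.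
have n1 : 1 - alpha != 0 by rewrite lt_eqF// subr_lt0.
rewrite [X in `|X|](_ : _ = a * rho' t + b * rho t); last first.
  by move: (Gamma_integral _) g20 => g g0; field; rewrite n1 !gt_eqF.
apply: le_trans (ler_normD _ _) _; rewrite !normrM.
have h1 := ler_wpM2l (normr_ge0 a) (lr' _ t0).
have h2 := ler_wpM2l (normr_ge0 b) (lr _ t0).
apply: le_trans (lerD h1 h2) _; rewrite le_eqVlt; apply/orP; left; apply/eqP; ring.
Qed.

End relaxation.

(** * Square integrable functions and coefficients *)
Section open_sets.
Context {R : realType} {d : nat}.
Implicit Types (U : set 'rV[R]_d).

Let box (q : 'rV[rat]_d) (k : nat) : set 'rV[R]_d :=
  [set x | forall i, `|ratr (q ord0 i) - x ord0 i| < k.+1%:R^-1].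

Let measurable_box q k : measurable (box q k).
Proof.
rewrite (_ : box q k = \bigcap_(i in [set: 'I_d])
   ((fun x : 'rV[R]_d => x ord0 i) @^-1` [set y : R | `|ratr (q ord0 i) - y| < k.+1%:R^-1])).
  apply: fin_bigcap_measurable; first exact: finite_finset.
  move=> i _; rewrite -[X in measurable X]setTI.
  apply: measurable_coord_rV => //.
  rewrite (_ : [set y | _] = `]ratr (q ord0 i) - k.+1%:R^-1, ratr (q ord0 i) + k.+1%:R^-1[%classic); first exact: measurable_itv.
  by apply/seteqP; split => y /=; rewrite in_itv/= ltr_distlC.
by apply/seteqP; split => x h; [move=> i _; exact: h|move=> i; exact: (h i Logic.I)].
Qed.

(** The sigma-algebra on rows is generated by the coordinates; an open set is the
    union of those boxes with rational centre and radius 1 / (k + 1) that it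
    contains. *)
Lemma open_measurable_rV U : open U -> measurable U.
Proof.
move=> oU.
pose F n : set 'rV[R]_d :=
  if unpickle n is Some (q, k) then if `[< box q k `<=` U >] then box q k else set0 else set0.
have -> : U = \bigcup_n F n.
  apply/seteqP; split => x; last first.
    move=> [n _]; rewrite /F; case: unpickle => [[q k]|//].
    by case: asboolP => // h; exact: h.
  move=> Ux; have /nbhs_ballP[e /= e0 eU] : nbhs x U by exact: open_nbhs_nbhs.
  pose k := Num.truncn (2 / e).
  have ke : 2 * k.+1%:R^-1 < e.
    by rewrite ltr_pdivrMr// mulrC -ltr_pdivrMr// truncnS_gt.
  have kp : 0 < k.+1%:R^-1 :> R by rewrite invr_gt0.
  have qi (i : 'I_d) : exists q : rat, `|ratr q - x ord0 i| < k.+1%:R^-1.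
    have ne : ball (x ord0 i) k.+1%:R^-1 !=set0 by exists (x ord0 i); exact: ballxx.
    have [z [hz [q _ qz]]] := @dense_rat R _ ne (ball_open _ _).
    by exists q; rewrite qz distrC; exact: hz.
  have [q hq] := choice qi.
  pose Q : 'rV[rat]_d := \row_i q i.
  exists (pickle (Q, k)) => //; rewrite /F pickleK.
  have xb : box Q k x by move=> i; rewrite mxE.
  case: asboolP => //; case => y yb; apply: eU; split => // i j.
  rewrite (ord1 i); have h1 := xb j; have h2 := yb j; rewrite /ball/=.
  apply: le_lt_trans (ler_distD (ratr (Q ord0 j)) _ _) _; apply: lt_trans ke.
  rewrite (_ : 2 * _ = k.+1%:R^-1 + k.+1%:R^-1); last by ring.
  by apply: ltrD; [rewrite distrC; exact: h1|exact: h2].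
apply: bigcupT_measurable => n; rewrite /F; case: unpickle => [[q k]|] //.
by case: asboolP.
Qed.

End open_sets.

Section square_integrable.
Context {R : realType} {d : nat}.
Local Notation mu := (@lebesgue_rV R d).
Variables (Omega : set 'rV[R]_d) (mOmega : measurable Omega).
Implicit Types (f g phi : 'rV[R]_d -> R).

Local Notation pairable f phi := (mu.-integrable Omega (EFin \o (fun x => f x * phi x))).

Lemma L2norm_fin f : L2 Omega f -> mu.-integrable Omega (EFin \o (fun x => f x ^+ 2)).
Proof.
move=> [mf]; rewrite /L2norm => /lty_poweRy; rewrite invr_eq0 pnatr_eq0 => /(_ isT) h.
apply/integrableP; split.
  by apply/measurable_EFinP; exact: measurable_funX.
by under eq_integral do rewrite /= ger0_norm ?sqr_ge0//.
Qed.

Lemma L2_pairable f g : L2 Omega f -> L2 Omega g -> pairable f g.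
Proof.
move=> Lf Lg; have i1 := L2norm_fin Lf; have i2 := L2norm_fin Lg.
have i3 := integrable_fctD mOmega i1 i2.
apply: le_integrable_fct i3 => //.
  by apply: measurable_funM; [case: Lf|case: Lg].
move=> x _; rewrite ler_norml.
have h1 := sqr_ge0 (f x + g x); have h2 := sqr_ge0 (f x - g x); have h3 := sqr_ge0 (f x).
have h4 := sqr_ge0 (g x).
rewrite sqrrD in h1; rewrite sqrrB in h2; apply/andP; split; lra.
Qed.

Lemma L2dotD f g phi : pairable f phi -> pairable g phi ->
  L2dot Omega (f + g) phi = L2dot Omega f phi + L2dot Omega g phi.
Proof.
move=> i1 i2; rewrite /L2dot -RintegralD//; apply: eq_Rintegral => x _.
by rewrite mulrDl.
Qed.

Lemma L2dotZ k f phi : pairable f phi -> L2dot Omega (k *: f) phi = k * L2dot Omega f phi.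
Proof.
move=> i1; rewrite /L2dot -RintegralZl//; apply: eq_Rintegral => x _.
by rewrite mulrA.
Qed.

Lemma pairableD f g phi : pairable f phi -> pairable g phi -> pairable (f + g) phi.
Proof.
move=> i1 i2; have := integrable_fctD mOmega i1 i2.
by apply: eq_integrable => // x _; rewrite /= mulrDl.
Qed.

Lemma pairableZ k f phi : pairable f phi -> pairable (k *: f) phi.
Proof.
move=> i1; have := integrable_fctZ mOmega k i1.
by apply: eq_integrable => // x _; rewrite /= mulrA.
Qed.

Lemma L2dot_sum (I : eqType) (s : seq I) (F : I -> 'rV[R]_d -> R) (k : I -> R) phi :
  (forall i, i \in s -> pairable (F i) phi) ->
  pairable (\sum_(i <- s) k i *: F i) phi /\
  L2dot Omega (\sum_(i <- s) k i *: F i) phi = \sum_(i <- s) k i * L2dot Omega (F i) phi.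
Proof.
elim: s => [|i s IH] H.
  rewrite !big_nil; split.
    have := integrable0 mu Omega; apply: eq_integrable => // x _.
    by rewrite /= mul0r.
  by rewrite /L2dot; under eq_Rintegral do rewrite mul0r; rewrite /Rintegral integral0.
have [i1 e1] : pairable (\sum_(i <- s) k i *: F i) phi /\
  L2dot Omega (\sum_(i <- s) k i *: F i) phi = \sum_(i <- s) k i * L2dot Omega (F i) phi.
  by apply: IH => j js; apply: H; rewrite in_cons js orbT.
have i2 : pairable (F i) phi by apply: H; rewrite mem_head.
rewrite !big_cons; split; first by apply: pairableD => //; exact: pairableZ.
by rewrite L2dotD ?L2dotZ ?e1//; exact: pairableZ.
Qed.

(** Cauchy-Schwarz from |f phi| <= f^2 / (2 e) + e phi^2 / 2, with e the norm of f, or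
    e tending to 0 when f vanishes almost everywhere. *)
Lemma L2dot_le_L2norm f phi : measurable_fun Omega f -> L2 Omega phi ->
  L2dot Omega phi phi = 1 -> (`|L2dot Omega f phi|%:E <= L2norm Omega f)%E.
Proof.
move=> mf Lphi phi1.
have [foo|fin] := eqVneq (L2norm Omega f) +oo%E; first by rewrite foo leey.
have Lf : L2 Omega f by split => //; rewrite ltey.
have i1 := L2norm_fin Lf; have i2 := L2norm_fin Lphi; have i3 := L2_pairable Lf Lphi.
pose S := \int[mu]_(x in Omega) (f x ^+ 2).
have S0 : 0 <= S by apply: Rintegral_ge0 => x _; exact: sqr_ge0.
have NE : L2norm Omega f = (Num.sqrt S)%:E.
  rewrite /L2norm -(fineK (integrable_fin_num mOmega i1)) poweR_EFin.
  by rewrite powR12_sqrt.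
rewrite NE lee_fin.
have est (e : R) : 0 < e -> `|L2dot Omega f phi| <= e^-1 / 2 * S + e / 2.
  move=> e0; apply: le_trans (le_normr_Rintegral mOmega i3) _.
  have ia : mu.-integrable Omega (EFin \o (fun x => e^-1 / 2 * f x ^+ 2)) by exact: integrable_fctZ.
  have ib : mu.-integrable Omega (EFin \o (fun x => e / 2 * phi x ^+ 2)) by exact: integrable_fctZ.
  have -> : e^-1 / 2 * S + e / 2 = \int[mu]_(x in Omega) (e^-1 / 2 * f x ^+ 2 + e / 2 * phi x ^+ 2).
    rewrite RintegralD// !RintegralZl// -/S.
    have -> : \int[mu]_(x in Omega) phi x ^+ 2 = 1.
      transitivity (L2dot Omega phi phi); last exact: phi1.
      by apply: eq_Rintegral => x _; rewrite expr2.
    by rewrite mulr1.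
  apply: le_Rintegral => //; first exact: integrable_norm.
    exact: integrable_fctD.
  move=> x _; have e1 : e^-1 / 2 * f x ^+ 2 + e / 2 * phi x ^+ 2 =
     (e^-1 / 2) * (f x ^+ 2 + (e * phi x) ^+ 2) by field; rewrite gt_eqF.
  rewrite e1; have e2 : `|f x * phi x| = (e^-1 / 2) * (2 * `|f x| * `|e * phi x|).
    by rewrite !normrM (gtr0_norm e0); field; rewrite gt_eqF.
  rewrite e2 ler_wpM2l ?divr_ge0 ?invr_ge0 ?(ltW e0)//.
  have := sqr_ge0 (`|f x| - `|e * phi x|); rewrite sqrrB !real_normK ?num_real//; lra.
have [Sp|Sp] := ltP 0 (Num.sqrt S).
  have := est _ Sp; rewrite -{2}(sqr_sqrtr S0).
  by rewrite (_ : _ + _ = Num.sqrt S)//; field; rewrite gt_eqF.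
have s0 : Num.sqrt S = 0 by apply/eqP; rewrite eq_le Sp sqrtr_ge0.
have S00 : S = 0 by rewrite -(sqr_sqrtr S0) s0 expr0n.
rewrite s0; apply/ler_addgt0Pr => e e0; rewrite add0r.
by have := est _ e0; rewrite S00 mulr0 add0r; move=> h; apply: le_trans h _; lra.
Qed.

Lemma eq_L2dot f g phi : measurable_fun Omega f -> measurable_fun Omega g ->
  measurable_fun Omega phi -> {ae mu, forall x, Omega x -> f x = g x} ->
  L2dot Omega f phi = L2dot Omega g phi.
Proof.
move=> mf mg mphi fg; rewrite /L2dot /Rintegral; congr fine; apply: ae_eq_integral => //.
- by apply/measurable_EFinP; exact: measurable_funM.
- by apply/measurable_EFinP; exact: measurable_funM.
by apply: filterS fg => x fgx /fgx ->.
Qed.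

End square_integrable.

Section approximation.
Context {R : realType}.
Local Notation mu := (@lebesgue_measure R).

(** Convergence in mean, with the error dominated by a multiple of the error [e] of
    a Bochner approximation: [f] is the image of the approximated function under a
    bounded functional and [sig k] the image of a step function. *)
Lemma approx_integrable (D : set R) (f : R -> R) (sig : nat -> R -> R)
    (e : nat -> R -> \bar R) (M : R) :
  measurable D -> measurable_fun D f -> 0 <= M ->
  (forall k, mu.-integrable D (EFin \o sig k)) ->
  (forall k, measurable_fun D (e k)) ->
  (forall k, \forall t \ae mu, D t -> (0 <= e k t)%E /\ (`|f t - sig k t|%:E <= M%:E * e k t)%E) ->
  (\int[mu]_(t in D) e k t)%E @[k --> \oo] --> 0%E ->
  mu.-integrable D (EFin \o f) /\
  \int[mu]_(t in D) sig k t @[k --> \oo] --> \int[mu]_(t in D) f t.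
Proof.
move=> mD mf M0 isig me fe e0.
have msig k : measurable_fun D (sig k) by exact: measurable_integrable (isig k).
have mB k : measurable_fun D (fun t => f t - sig k t) by exact: measurable_funB.
have mE k : measurable_fun D (fun t => `|e k t|%E) by exact: measurableT_comp.
have absE k : (\int[mu]_(t in D) `|e k t| = \int[mu]_(t in D) e k t)%E.
  apply: ae_eq_integral => //; [exact: mE|exact: me|].
  move: (fe k); apply: filterS; first exact: (ae_filter_ringOfSetsType mu).
  by move=> t h /h[h1 _]; rewrite gee0_abs.
have le1 k : (\int[mu]_(t in D) `|f t - sig k t|%:E <= M%:E * \int[mu]_(t in D) e k t)%E.
  rewrite -absE -ge0_integralZl//; last exact: mE.
  apply: ae_ge0_le_integral => //.
  - by apply/measurable_EFinP; exact: (measurableT_comp (@normr_measurable R setT) (mB k)).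
  - by move=> t _; rewrite mule_ge0.
  - exact: (measurable_funeM M%:E (mE k)).
  move: (fe k); apply: filterS; first exact: (ae_filter_ringOfSetsType mu).
  by move=> t h /h[h1 h2]; rewrite gee0_abs.
have cv : (M%:E * \int[mu]_(t in D) e k t)%E @[k --> \oo] --> 0%E.
  by rewrite -(mule0 M%:E); apply: cvgeZl.
have fk : \forall k \near \oo, ((\int[mu]_(t in D) e k t) < 1)%E.
  move/fine_cvgP : e0 => [] h1 h2; near=> k.
  have h3 : (\int[mu]_(t in D) e k t)%E \is a fin_num by near: k.
  rewrite -(fineK h3) lte_fin; near: k.
  exact: (cvgr_lt _ h2).
have intf : mu.-integrable D (EFin \o f).
  have [k _ /(_ k (leqnn k)) ek] := fk.
  have i1 : mu.-integrable D (EFin \o (fun t => f t - sig k t)).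
    apply/integrableP; split.
      by apply/measurable_EFinP; exact: mB.
    apply: le_lt_trans (le1 k) _.
    apply: (@le_lt_trans _ _ (M%:E * 1)%E); first by rewrite lee_wpmul2l// ltW.
    by rewrite mule1 ltry.
  rewrite (_ : f = (fun t => (f t - sig k t) + sig k t)); last first.
    by apply/funext => t; rewrite subrK.
  exact: integrable_fctD.
split => //; apply/subr_cvg0/norm_cvg0P.
have /fine_cvgP[_ cvr] := cv.
apply: (@squeeze_cvgr _ _ _ _ (cst 0) (fine \o (fun k => (M%:E * \int[mu]_(t in D) e k t)%E)) _ _ _ _ cvr); last exact: cvg_cst.
near=> k; rewrite normr_ge0/=.
have ik : mu.-integrable D (EFin \o (fun t => sig k t - f t)) by exact: integrable_fctB.
have h : `|\int[mu]_(t in D) (sig k t - f t)| <= \int[mu]_(t in D) `|sig k t - f t|.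
  exact: le_normr_Rintegral.
rewrite RintegralB// in h; apply: (le_trans h).
have fk1 : (\int[mu]_(t in D) e k t < 1)%E by near: k.
have fin : (M%:E * \int[mu]_(t in D) e k t)%E \is a fin_num.
  rewrite fin_numM// ge0_fin_numE; first by rewrite (lt_trans fk1)// ltry.
  by rewrite -absE integral_ge0.
rewrite -lee_fin (fineK fin); apply: le_trans (le1 k).
rewrite /Rintegral fineK; last by apply: integrable_fin_num => //; exact: integrable_norm.
by rewrite le_eqVlt; apply/orP; left; apply/eqP; apply: eq_integral => t _; rewrite distrC.
Unshelve. all: end_near. Qed.

End approximation.

Section spectral.
Context {R : realType} {d : nat}.
Local Notation mu := (@lebesgue_rV R d).
Variables (Omega : set 'rV[R]_d) (lam : nat -> R) (phi : nat -> 'rV[R]_d -> R).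
Hypothesis mOmega : measurable Omega.
Hypothesis lam0 : forall n, 0 < lam n.
Hypothesis L2phi : forall n, L2 Omega (phi n).
Hypothesis ortho : forall m n, L2dot Omega (phi m) (phi n) = (m == n)%:R.

Lemma coefficient_le_spectral_norm beta (b : nat -> R) n :
  (`|lam n `^ beta * b n|%:E <= spectral_norm lam beta b)%E.
Proof.
rewrite /spectral_norm.
have h : ((`|lam n `^ beta * b n| ^+ 2)%:E <= \sum_(0 <= k <oo) (`|lam k `^ beta * b k| ^+ 2)%:E)%E.
  have h0 k : (0 <= (`|lam k `^ beta * b k| ^+ 2)%:E)%E by rewrite lee_fin sqr_ge0.
  have := @nneseries_lim_ge R _ xpredT 0%N n.+1 (fun k _ _ => h0 k).
  apply: le_trans; rewrite big_nat_recr//= leeDr//.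
  by apply: sume_ge0.
have -> : `|lam n `^ beta * b n|%:E = ((`|lam n `^ beta * b n| ^+ 2)%:E `^ 2^-1)%E.
  by rewrite poweR_EFin powR12_sqrt ?sqr_ge0// sqrtr_sqr normr_id.
by rewrite gt0_ler_poweR ?invr_ge0// in_itv/= leey ?lee_fin ?sqr_ge0// nneseries_ge0.
Qed.

(** By orthonormality the partial sums of the series are eventually constant. *)
Lemma coefficient_A_ext g n : A_ext Omega lam phi g (phi n) = lam n * L2dot Omega g (phi n).
Proof.
apply/cvg_lim => //; apply: cvg_near_cst; near=> k.
rewrite /series/= (bigD1_seq n)//=; last 2 first.
- by rewrite mem_index_iota leq0n/=; near: k; exact: nbhs_infty_gt.
- exact: iota_uniq.
rewrite ortho eqxx mulr1 big1 ?addr0// => i ni.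
by rewrite ortho (negbTE ni) mulr0.
Unshelve. all: end_near. Qed.

Lemma domA1_eigenfunction n : domA Omega lam phi 1 (phi n).
Proof.
split; first exact: L2phi.
rewrite /domA_norm /spectral_norm poweR_lty//.
rewrite (@nneseriesD1 _ _ n)//.
rewrite eseries0 ?adde0 ?ltry// => k _ kn.
by rewrite ortho (eq_sym n) (negbTE kn) mulr0 normr0 expr0n.
Qed.

Lemma coefficient_A_inv g w n : L2 Omega g -> is_A_inv Omega lam phi g w ->
  L2dot Omega w (phi n) = (lam n)^-1 * L2dot Omega g (phi n).
Proof.
move=> Lg [Lw cv].
pose S m := \sum_(k < m) ((lam k)^-1 * L2dot Omega g (phi k)) *: phi k.
have dotS m : (n < m)%N -> L2dot Omega (w - S m) (phi n) =
   L2dot Omega w (phi n) - (lam n)^-1 * L2dot Omega g (phi n).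
  move=> nm.
  have [iS eS] := @L2dot_sum R d Omega mOmega _ (index_enum 'I_m)
     (fun k => phi (val k)) (fun k => (lam k)^-1 * L2dot Omega g (phi k)) (phi n)
     (fun k _ => L2_pairable mOmega (L2phi k) (L2phi n)).
  rewrite -scaleN1r L2dotD//; last 2 first.
  - exact: L2_pairable.
  - exact: pairableZ.
  rewrite L2dotZ// eS mulN1r; congr (_ - _).
  rewrite (bigD1 (Ordinal nm))//= ortho eqxx mulr1 big1 ?addr0// => i ni.
  rewrite ortho (_ : (val i == n) = false) ?mulr0//.
  by apply/negbTE; apply: contra ni => /eqP E; apply/eqP/val_inj.
have mS m : measurable_fun Omega (w - S m).
  apply: measurable_funB; first by case: Lw.
  rewrite /S; elim/big_rec: _ => [|i x _ mx]; first exact: measurable_cst.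
  apply: measurable_funD => //; apply: measurable_funM; first exact: measurable_cst.
  by case: (L2phi i).
apply/eqP; rewrite -subr_eq0 -normr_eq0 eq_le normr_ge0 andbT -lee_fin.
apply: (cvge_ge _ cv).
near=> m; rewrite -(dotS m); last by near: m; exact: nbhs_infty_gt.
by apply: L2dot_le_L2norm => //; rewrite ortho eqxx.
Unshelve. all: end_near. Qed.

End spectral.

Section bochner.
Context {R : realType}.
Local Notation mu := (@lebesgue_measure R).

Lemma step_eval (T : Type) (s : seq (set R * (T -> R))) (t : R) (x : T) :
  step s t x = \sum_(p <- s) \1_(p.1) t * p.2 x.
Proof. elim: s => [|p s IH]; first by rewrite /step !big_nil.
by rewrite big_cons -IH /step big_cons. Qed.

Lemma Rintegral_step (V : lmodType R) (s : seq (set R * V)) (r : V -> R) (a b : R) :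
  {in s, forall p, measurable p.1} ->
  mu.-integrable `]a, b[ (EFin \o (fun t => \sum_(p <- s) \1_(p.1) t * r p.2)) /\
  \int[mu]_(t in `]a, b[) (\sum_(p <- s) \1_(p.1) t * r p.2) =
    \sum_(p <- s) fine (mu (p.1 `&` `]a, b[%classic)) * r p.2.
Proof.
elim: s => [|p s IH] ms.
  split.
    have := integrable0 mu `]a, b[%classic; apply: eq_integrable => // x _.
    by rewrite /= big_nil.
  rewrite big_nil; under eq_Rintegral do rewrite big_nil.
  by rewrite /Rintegral integral0.
have [i1 e1] : mu.-integrable `]a, b[ (EFin \o (fun t => \sum_(p <- s) \1_(p.1) t * r p.2)) /\
  \int[mu]_(t in `]a, b[) (\sum_(p <- s) \1_(p.1) t * r p.2) =
    \sum_(p <- s) fine (mu (p.1 `&` `]a, b[%classic)) * r p.2.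
  by apply: IH => q qs; apply: ms; rewrite in_cons qs orbT.
have mp : measurable p.1 by apply: ms; rewrite mem_head.
have fin : (mu (`]a, b[%classic : set R) < +oo)%E.
  by rewrite lebesgue_measure_itv/=; case: ifP => // _; rewrite -EFinB ltry.
have ip : mu.-integrable `]a, b[ (EFin \o (\1_(p.1) : R -> R)).
  apply: (ge0_integrable_fct (M := fine (mu (`]a, b[%classic : set R)))) => //.
  rewrite integral_indic// fineK; last by rewrite ge0_fin_numE.
  by apply: le_measure; rewrite ?inE//; exact: measurableI.
have ir : mu.-integrable `]a, b[ (EFin \o (fun t => \1_(p.1) t * r p.2)).
  rewrite (_ : (fun t => _) = (fun t => r p.2 * \1_(p.1) t)); last first.
    by apply/funext => t; rewrite mulrC.
  exact: integrable_fctZ.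
have E t : \sum_(q <- p :: s) \1_(q.1) t * r q.2 = \1_(p.1) t * r p.2 + \sum_(q <- s) \1_(q.1) t * r q.2.
  by rewrite big_cons.
rewrite (funext E); split; first exact: integrable_fctD.
rewrite RintegralD// e1 big_cons; congr (_ + _).
rewrite RintegralZr//; congr (_ * _).
by rewrite /Rintegral integral_indic// setIC.
Qed.

End bochner.

Section coefficients.
Context {R : realType} {d : nat}.
Local Notation mu := (@lebesgue_measure R).
Variables (Omega : set 'rV[R]_d) (lam : nat -> R) (phi : nat -> 'rV[R]_d -> R).
Hypothesis mOmega : measurable Omega.
Hypothesis lam0 : forall n, 0 < lam n.
Hypothesis L2phi : forall n, L2 Omega (phi n).
Hypothesis ortho : forall m n, L2dot Omega (phi m) (phi n) = (m == n)%:R.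

(** The error of each step function at t bounds the error of its coefficient by
    Cauchy-Schwarz. *)
Lemma bochner_coefficient_integrable (T : R) (u : R -> 'rV[R]_d -> R) (c : R -> R) n :
  bochner_integrable (L2 Omega) (L2norm Omega) 0 T u ->
  measurable_fun `]0, T[ c ->
  {ae mu, forall t, t \in `]0, T[ -> L2dot Omega (u t) (phi n) = c t} ->
  mu.-integrable `]0, T[ (EFin \o c).
Proof.
move=> [uL2 [s_ [st [e [me ue e0]]]]] mc uc.
have is_ k := @Rintegral_step R _ (s_ k) (fun v => L2dot Omega v (phi n)) 0 T
  (fun p ps => proj1 (st k p ps)).
apply: (proj1 (@approx_integrable R `]0, T[%classic c
  (fun k t => \sum_(p <- s_ k) \1_(p.1) t * L2dot Omega p.2 (phi n)) e 1 _ mc _ _ me _ e0)) => //.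
  by move=> k; have [] := is_ k.
move=> k; move: uL2 (ue k) uc; apply: filterS3; first exact: (ae_filter_ringOfSetsType mu).
move=> t ut uek uct tT; have {}tT : t \in `]0, T[ by [].
have Lu := ut tT; rewrite -(uek tT); split; first exact: poweR_ge0.
have pair_p p : p \in s_ k -> (lebesgue_rV d).-integrable Omega (EFin \o (fun x => p.2 x * phi n x)).
  by move=> ps; apply: L2_pairable => //; exact: (proj2 (st k p ps)).
have [iS eS] := @L2dot_sum R d Omega mOmega _ (s_ k) snd (fun p => \1_(p.1) t) (phi n) pair_p.
rewrite mul1e -(uct tT) -eS.
have -> : L2dot Omega (u t) (phi n) - L2dot Omega (\sum_(i <- s_ k) \1_(i.1) t *: i.2) (phi n)
   = L2dot Omega (u t - step (s_ k) t) (phi n).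
  rewrite /step -scaleN1r L2dotD ?L2dotZ ?mulN1r//; first exact: L2_pairable.
  exact: pairableZ.
apply: L2dot_le_L2norm => //; last by rewrite ortho eqxx.
apply: measurable_funB; first by case: Lu.
rewrite /step big_seq; elim/big_rec: _ => [|p x ps mx]; first exact: measurable_cst.
apply: measurable_funD => //; apply: measurable_funM; first exact: measurable_cst.
by case: (proj2 (st k p ps)).
Qed.

(** The norm of D(A^(-1)) dominates lambda_n^(-1) times the n-th coefficient, both in
    the approximation of the integrand and in the convergence of the integrals of
    the step functions. *)
Lemma frac_integral_coefficient (alpha t : R) (u : R -> 'rV[R]_d -> R) v (c : R -> R) n :
  0 < t ->
  frac_integral (domA_dual Omega lam phi (- 1)) (domA_dual_norm lam phi (- 1)) alpha
    (fun s => A_ext Omega lam phi (u s)) t v ->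
  measurable_fun `]0, t[ c ->
  {ae mu, forall s, s \in `]0, t[ -> L2dot Omega (u s) (phi n) = c s} ->
  v (phi n) = lam n * ((Gamma alpha)^-1 * \int[mu]_(s in `]0, t[) ((t - s) `^ (alpha - 1) * c s)).
Proof.
move=> t0 [w [Sw _ [s_ [st [e [me ue e0]]] cvw]] ->] mc uc.
pose f s := (t - s) `^ (alpha - 1) * (lam n * c s).
pose sig k s := \sum_(p <- s_ k) \1_(p.1) s * p.2 (phi n).
have is_ k := @Rintegral_step R _ (s_ k) (fun v => v (phi n)) 0 t
  (fun p ps => proj1 (st k p ps)).
have mpow : measurable_fun `]0%R, t[ (fun s : R => (t - s) `^ (alpha - 1)).
  apply: (measurableT_comp (measurable_powR _)).
  by apply: measurable_funB => //; exact: measurable_cst.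
have mf : measurable_fun `]0, t[ f.
  by apply: measurable_funM => //; apply: measurable_funM => //; exact: measurable_cst.
have norm_ge F : (`|F (phi n)|%:E <= (lam n)%:E * domA_dual_norm lam phi (- 1) F)%E.
  have := coefficient_le_spectral_norm lam (- 1) (fun k => F (phi k)) n.
  rewrite -(@lee_pmul2l _ (lam n)%:E)//; last by rewrite lte_fin.
  apply: le_trans; rewrite -EFinM lee_fin normrM [`|lam n `^ _|]ger0_norm ?powR_ge0//.
  by rewrite powRN powRr1 ?(ltW (lam0 n))// mulrA divff ?mul1r// gt_eqF.
have fE s : s \in `]0, t[ -> L2dot Omega (u s) (phi n) = c s ->
    f s = ((t - s) `^ (alpha - 1) *: A_ext Omega lam phi (u s)) (phi n).
  move=> _ us; rewrite /f -us -(coefficient_A_ext lam ortho (u s) n)//.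
have [intf cvf] : mu.-integrable `]0, t[ (EFin \o f) /\
    \int[mu]_(s in `]0, t[) sig k s @[k --> \oo] --> \int[mu]_(s in `]0, t[) f s.
  apply: (@approx_integrable R `]0, t[%classic f sig e (lam n) _ mf _ _ me _ e0) => //.
  - exact: ltW.
  - by move=> k; have [] := is_ k.
  move=> k; move: (ue k) uc; apply: filterS2; first exact: (ae_filter_ringOfSetsType mu).
  move=> s uek us sT; have {}sT : s \in `]0, t[ by [].
  rewrite -(uek sT); split; first exact: poweR_ge0.
  rewrite (fE _ sT (us sT)) /sig -step_eval.
  exact: norm_ge (_ - _).
have cvw2 : step_integral 0 t (s_ k) (phi n) @[k --> \oo] --> w (phi n).
  apply/subr_cvg0/norm_cvg0P.
  have lfin : (lam n)%:E \is a fin_num by [].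
  have := cvgeZl lfin cvw; rewrite mule0 => cv.
  have /fine_cvgP[fin cvr] := cv.
  apply: (@squeeze_cvgr _ _ _ _ (cst 0) _ _ _ _ _ cvr); last exact: cvg_cst.
  move: fin; apply: filterS => k fk; rewrite normr_ge0/= -lee_fin fineK//.
  exact: norm_ge (_ - _).
have E k : \int[mu]_(s in `]0, t[) sig k s = step_integral 0 t (s_ k) (phi n).
  have [_ ->] := is_ k; rewrite /step_integral.
  by rewrite fct_sumE.
have -> : ((Gamma alpha)^-1 *: w) (phi n) = (Gamma alpha)^-1 * w (phi n) by [].
rewrite mulrCA; congr (_ * _).
rewrite -(cvg_lim (@Rhausdorff R) cvw2) -(funext E) (cvg_lim (@Rhausdorff R) cvf).
have lam_neq0 : lam n != 0 by rewrite gt_eqF.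
have intg : mu.-integrable `]0, t[ (EFin \o (fun s => (t - s) `^ (alpha - 1) * c s)).
  rewrite (_ : (fun s => _) = (fun s => (lam n)^-1 * f s)); last first.
    by apply/funext => s; rewrite /f mulrCA mulKf.
  exact: integrable_fctZ.
rewrite -RintegralZl//; apply: eq_Rintegral => s _.
by rewrite /f mulrCA.
Qed.

End coefficients.

(** * The asymptotic estimate *)
Section eigensystem.
Context {R : realType} {d : nat}.
Variables (Omega : set 'rV[R]_d) (a : 'rV[R]_d -> 'M[R]_d) (c : 'rV[R]_d -> R)
  (lam : nat -> R) (phi : nat -> 'rV[R]_d -> R).
Hypothesis eigen : eigensystem Omega a c lam phi.

Lemma eigenvalue_gt0 n : 0 < lam n.
Proof.
case: n => [|n]; first exact: lam_gt0 eigen.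
elim: n => [|n IH]; first exact: lt_trans (lam_gt0 eigen) (lam_simple eigen).
exact: lt_le_trans IH (lam_nondecreasing eigen _).
Qed.

Lemma eigenfunction_L2 n : L2 Omega (phi n).
Proof. by case: (eigenpair eigen n) => -[]. Qed.

End eigensystem.

(** The constant comes from 2 C^2 <= (2 (C + 1))^2 and f^2 + g^2 <= (f + g)^2 for
    f, g >= 0; the 1 keeps it positive when C = 0. *)
Lemma sqrte_le_combination {R : realType} (p q C : R) (S A B : \bar R) :
  0 < p -> 0 < q -> 0 <= C -> (0 <= S)%E -> (0 <= A)%E -> (0 <= B)%E ->
  (S <= (2 * C ^+ 2 * p ^+ 2)%:E * A + (2 * C ^+ 2 * q ^+ 2)%:E * B)%E ->
  (S `^ 2^-1 <= (2 * (C + 1))%:E * (A `^ 2^-1 * p%:E + B `^ 2^-1 * q%:E))%E.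
Proof.
move=> p0 q0 C0 S0 A0 B0 leS.
have K0 : 0 < 2 * (C + 1) by lra.
have [Aoo|Afin] := eqVneq A +oo%E.
  have -> : (A `^ 2^-1 = +oo)%E by apply: eqy_poweR; rewrite ?invr_gt0.
  rewrite gt0_mulye ?lte_fin// addye; last by rewrite -ltNye (lt_le_trans (@ltNy0 R))// mule_ge0 ?poweR_ge0 ?lee_fin ?(ltW q0).
  by rewrite gt0_muley ?lte_fin// leey.
have [Boo|Bfin] := eqVneq B +oo%E.
  have -> : (B `^ 2^-1 = +oo)%E by apply: eqy_poweR; rewrite ?invr_gt0.
  rewrite gt0_mulye ?lte_fin// addey; last by rewrite -ltNye (lt_le_trans (@ltNy0 R))// mule_ge0 ?poweR_ge0 ?lee_fin ?(ltW p0).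
  by rewrite gt0_muley ?lte_fin// leey.
have fA : A \is a fin_num by rewrite ge0_fin_numE// ltey.
have fB : B \is a fin_num by rewrite ge0_fin_numE// ltey.
have fS : S \is a fin_num.
  rewrite ge0_fin_numE//; apply: (le_lt_trans leS).
  by rewrite -(fineK fA) -(fineK fB) -!EFinM -EFinD ltry.
move: leS; rewrite -(fineK fA) -(fineK fB) -(fineK fS) -!EFinM -EFinD lee_fin.
have := fine_ge0 A0; have := fine_ge0 B0; have := fine_ge0 S0.
move: (fine S) (fine A) (fine B) => s al be s0 be0 al0 les.
rewrite !poweR_EFin !powR12_sqrt// lee_fin.
set r := (_ * (_ + _)).
have r0 : 0 <= r by rewrite /r mulr_ge0 ?(ltW K0)// addr_ge0// mulr_ge0 ?sqrtr_ge0 ?ltW.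
rewrite -(ger0_norm r0) -sqrtr_sqr ler_sqrt ?sqr_ge0//.
apply: le_trans les _; rewrite /r.
have -> : al = Num.sqrt al ^+ 2 by rewrite sqr_sqrtr.
have -> : be = Num.sqrt be ^+ 2 by rewrite sqr_sqrtr.
rewrite !sqrtr_sqr !ger0_norm ?sqrtr_ge0//.
have := sqrtr_ge0 al; have := sqrtr_ge0 be; move: (Num.sqrt al) (Num.sqrt be) => f g g0 f0.
have fp : 0 <= f * p by rewrite mulr_ge0// ltW.
have gq : 0 <= g * q by rewrite mulr_ge0// ltW.
rewrite exprMn.
have -> : 2 * C ^+ 2 * p ^+ 2 * f ^+ 2 + 2 * C ^+ 2 * q ^+ 2 * g ^+ 2 = 2 * C ^+ 2 * ((f * p) ^+ 2 + (g * q) ^+ 2) by ring.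
have h1 : 2 * C ^+ 2 <= (2 * (C + 1)) ^+ 2.
  have := sqr_ge0 C; rewrite exprMn sqrrD expr1n; lra.
have h2 : (f * p) ^+ 2 + (g * q) ^+ 2 <= (f * p + g * q) ^+ 2.
  by have := mulr_ge0 fp gq; rewrite sqrrD; lra.
apply: ler_pM => //; first by rewrite mulr_ge0// sqr_ge0.
by rewrite addr_ge0// sqr_ge0.
Qed.

Section spectral_estimates.
Context {R : realType}.
Variables (lam : nat -> R).
Hypothesis lam0 : forall n, 0 < lam n.

(** Here (x + y)^2 <= 2 x^2 + 2 y^2 replaces the triangle inequality in l^2. *)
Lemma spectral_norm_le (beta p q C : R) (X x y : nat -> R) : 0 < p -> 0 < q -> 0 <= C ->
  (forall n, `|X n| <= C * (`|x n| * p + `|y n| * q) / lam n ^+ 2) ->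
  (spectral_norm lam (beta + 1)%R X <=
    (2 * (C + 1))%:E * (spectral_norm lam (beta - 1)%R x * p%:E +
                        spectral_norm lam (beta - 1)%R y * q%:E))%E.
Proof.
move=> p0 q0 C0 leX; rewrite /spectral_norm.
set S := (\sum_(0 <= n <oo) (`|lam n `^ (beta + 1) * X n| ^+ 2)%:E)%E.
set A := (\sum_(0 <= n <oo) (`|lam n `^ (beta - 1) * x n| ^+ 2)%:E)%E.
set B := (\sum_(0 <= n <oo) (`|lam n `^ (beta - 1) * y n| ^+ 2)%:E)%E.
have S0 : (0 <= S)%E by apply: nneseries_ge0 => n _ _; rewrite lee_fin sqr_ge0.
have A0 : (0 <= A)%E by apply: nneseries_ge0 => n _ _; rewrite lee_fin sqr_ge0.
have B0 : (0 <= B)%E by apply: nneseries_ge0 => n _ _; rewrite lee_fin sqr_ge0.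
have cst0 (r : R) : 0 <= 2 * C ^+ 2 * r ^+ 2.
  by apply: mulr_ge0; [apply: mulr_ge0; [|exact: sqr_ge0]|exact: sqr_ge0].
have leS : (S <= (2 * C ^+ 2 * p ^+ 2)%:E * A + (2 * C ^+ 2 * q ^+ 2)%:E * B)%E.
  rewrite /A /B -!nneseriesZl//.
  rewrite -nneseriesD; last 2 first.
  - by move=> n _ _; rewrite lee_fin; apply: mulr_ge0; [exact: cst0|exact: sqr_ge0].
  - by move=> n _ _; rewrite lee_fin; apply: mulr_ge0; [exact: cst0|exact: sqr_ge0].
  apply: lee_nneseries => [n _ _|n _]; first by rewrite lee_fin sqr_ge0.
  rewrite lee_fin !normrM ![`|lam n `^ _|]ger0_norm ?powR_ge0//.
  have l0 := lam0 n; set w := lam n `^ (beta - 1).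
  have w0 : 0 <= w by exact: powR_ge0.
  have -> : lam n `^ (beta + 1) = w * lam n ^+ 2.
    rewrite -(@powR_mulrn _ (lam n) 2 (ltW l0)) -powRD; last by rewrite (gt_eqF l0) implybT.
    by congr (_ `^ _); ring.
  have h : w * lam n ^+ 2 * `|X n| <= C * (w * `|x n| * p + w * `|y n| * q).
    have := ler_wpM2l (mulr_ge0 w0 (sqr_ge0 (lam n))) (leX n).
    move=> h; apply: le_trans h _; rewrite le_eqVlt; apply/orP; left; apply/eqP; field.
    by rewrite gt_eqF.
  have h0 : 0 <= w * lam n ^+ 2 * `|X n| by rewrite mulr_ge0// mulr_ge0// sqr_ge0.
  have h1 : (w * lam n ^+ 2 * `|X n|) ^+ 2 <= (C * (w * `|x n| * p + w * `|y n| * q)) ^+ 2.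
    by rewrite ler_pXn2r// nnegrE (le_trans h0).
  apply: le_trans h1 _.
  have := sqr_ge0 (C * (w * `|x n| * p - w * `|y n| * q)).
  rewrite !exprMn; move: (C ^+ 2) => CC; nra.
exact: sqrte_le_combination.
Qed.

End spectral_estimates.

Section solution_coefficients.
Context {R : realType} {d : nat}.
Local Notation mu := (@lebesgue_measure R).
Variables (Omega : set 'rV[R]_d) (lam : nat -> R) (phi : nat -> 'rV[R]_d -> R).
Hypothesis mOmega : measurable Omega.
Hypothesis lam0 : forall n, 0 < lam n.
Hypothesis L2phi : forall n, L2 Omega (phi n).
Hypothesis ortho : forall m n, L2dot Omega (phi m) (phi n) = (m == n)%:R.
Variables (alpha beta : R) (u0 u1 : 'rV[R]_d -> R) (u v : R -> 'rV[R]_d -> R).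
Hypothesis usol : solution Omega lam phi alpha u0 u1 u.
Hypothesis vrep : continuous_representative Omega lam phi beta u v.

(** Countably many intervals (0, k + 1) exhaust the half-line. *)
Lemma ae_pos (P : R -> Prop) :
  (forall k : nat, {ae mu, forall t : R, 0 < t < k.+1%:R -> P t}) ->
  {ae mu, forall t : R, 0 < t -> P t}.
Proof.
move=> /ae_foralln; apply: filterS => t Pt t0; apply: (Pt (Num.truncn t)).
by rewrite t0 truncnS_gt.
Qed.

Lemma ae_solution_L2 : {ae mu, forall t : R, 0 < t -> L2 Omega (u t)}.
Proof.
apply: ae_pos => k; have [[uL2 _] _] := usol (ltr0Sn R k).
move: uL2; apply: filterS; first exact: (ae_filter_ringOfSetsType mu).
by move=> t h tk; apply: h; rewrite in_itv.
Qed.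

Lemma ae_coefficient n :
  {ae mu, forall t : R, 0 < t -> L2dot Omega (u t) (phi n) = L2dot Omega (v t) (phi n)}.
Proof.
have [uv vD _] := vrep; move: uv ae_solution_L2.
apply: filterS2; first exact: (ae_filter_ringOfSetsType mu).
move=> t uvt ut t0; have [mut _] := ut t0; have [[mvt _] _] := vD t t0.
apply: eq_L2dot => //; last exact: uvt.
by case: (L2phi n).
Qed.

(** The norm of D(A^beta) dominates lambda_n^beta times the n-th coefficient. *)
Lemma continuous_coefficient n (t : R) : 0 < t ->
  {for t, continuous (fun s => L2dot Omega (v s) (phi n))}.
Proof.
move=> t0; have [_ vD cv] := vrep.
have wfin : ((lam n `^ beta)^-1)%:E \is a fin_num by [].
have h := cvgeZl wfin (cv t t0); rewrite mule0 in h.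
have /fine_cvgP[fin cvr] := h.
apply/subr_cvg0/norm_cvg0P.
apply: (@squeeze_cvgr _ _ _ _ (cst 0) _ _ _ _ _ cvr); last exact: cvg_cst.
near=> s; have s0 : 0 < s by near: s; exact: lt_nbhsr.
rewrite normr_ge0/= -lee_fin fineK; last by near: s.
have [Ls _] := vD s s0; have [Lt _] := vD t t0.
have -> : L2dot Omega (v s) (phi n) - L2dot Omega (v t) (phi n) = L2dot Omega (v s - v t) (phi n).
  rewrite -[in RHS]scaleN1r L2dotD//; first by rewrite L2dotZ ?mulN1r//; exact: L2_pairable.
    exact: L2_pairable.
  by apply: pairableZ => //; exact: L2_pairable.
have p0 : 0 < lam n `^ beta by exact: powR_gt0.
rewrite -(@lee_pmul2l _ (lam n `^ beta)%:E)//.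
rewrite muleA -[(_%:E * _%:E)%E in leRHS]EFinM divff ?gt_eqF// mul1e -EFinM.
apply: le_trans (coefficient_le_spectral_norm lam beta (fun k => L2dot Omega (v s - v t) (phi k)) n).
by rewrite lee_fin normrM gtr0_norm.
Unshelve. all: end_near. Qed.

Lemma integrable_coefficient n (T : R) : 0 < T ->
  mu.-integrable `]0, T[ (EFin \o (fun s => L2dot Omega (v s) (phi n))).
Proof.
move=> T0; have [bu _] := usol T0.
apply: (bochner_coefficient_integrable mOmega L2phi ortho bu (n := n)).
  apply: (@measurable_funS _ _ _ _ (`]0, +oo[%classic : set R)) => //.
    by move=> x; rewrite /= !in_itv/= andbT => /andP[].
  apply: open_continuous_measurable_fun; first exact: interval_open.
  by move=> t; rewrite inE/= in_itv/= andbT => t0; exact: continuous_coefficient.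
move: (ae_coefficient n); apply: filterS; first exact: (ae_filter_ringOfSetsType mu).
by move=> t h; rewrite in_itv/= => /andP[t0 _]; exact: h.
Qed.

(** The weak form of the equation is tested with phi_n; the values of u may be
    replaced by those of v almost everywhere, also under the integral. *)
Lemma coefficient_volterra n :
  {ae mu, forall t : R, 0 < t -> L2dot Omega (v t) (phi n) =
    L2dot Omega u0 (phi n) + L2dot Omega u1 (phi n) * t - lam n * ((Gamma alpha)^-1 *
      \int[mu]_(s in `]0, t[) ((t - s) `^ (alpha - 1) * L2dot Omega (v s) (phi n)))}.
Proof.
apply: ae_pos => k; have [_ eqn] := usol (ltr0Sn R k).
move: eqn (ae_coefficient n); apply: filterS2; first exact: (ae_filter_ringOfSetsType mu).
move=> t eqt uvt tk; have /andP[t0 _] := tk; have [F Fint Fpsi] := eqt tk.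
rewrite -(uvt t0) (Fpsi _ (domA1_eigenfunction lam L2phi ortho n)) [t * _]mulrC; congr (_ - _).
apply: (frac_integral_coefficient lam0 ortho t0 Fint (n := n)).
  exact: measurable_integrable (integrable_coefficient n t0).
move: (ae_coefficient n); apply: filterS; first exact: (ae_filter_ringOfSetsType mu).
by move=> s h; rewrite in_itv/= => /andP[s0 _]; exact: h.
Qed.

End solution_coefficients.

Theorem theorem1 (R : realType) (alpha : R) (halpha : 1 < alpha < 2) :
  exists2 C : R, 0 < C &
  forall (d : nat) (Omega : set 'rV[R]_d)
    (a : 'rV[R]_d -> 'M[R]_d) (c : 'rV[R]_d -> R)
    (lam : nat -> R) (phi : nat -> 'rV[R]_d -> R)
    (beta : R) (u_ w_ : 'I_2 -> 'rV[R]_d -> R) (u v : R -> 'rV[R]_d -> R),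
  (0 < d)%N ->
  smooth_bounded_domain Omega ->
  elliptic_coefficients Omega a c ->
  eigensystem Omega a c lam phi ->
  0 <= beta ->
  (forall j, domA Omega lam phi beta (u_ j)) ->
  (forall j, is_A_inv Omega lam phi (u_ j) (w_ j)) ->
  solution Omega lam phi alpha (u_ ord0) (u_ ord_max) u ->
  continuous_representative Omega lam phi (beta + 1) u v ->
  exists2 t0 : R, 0 < t0 & forall t : R, t0 <= t ->
    (domA_norm Omega lam phi (beta + 1)%R
       (v t - \sum_(j < 2) (t `^ (j%:R - alpha) / Gamma (j%:R + 1 - alpha))
                             *: w_ j)%R
     <= C%:E * \sum_(j < 2) domA_norm Omega lam phi (beta - 1)%R (u_ j)
                            * (t `^ (j%:R - 2 * alpha))%:E)%E.
Proof.
have [C C0 HC] := relaxation_asymptotics halpha.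
exists (2 * (C + 1)); first by lra.
move=> d Omega a c lam phi beta u_ w_ u v _ domain _ eigen _ uD wA usol vrep.
exists 1 => // t t1; have t0 : 0 < t by exact: lt_le_trans t1.
have mOmega : measurable Omega by apply: open_measurable_rV; exact: domain_open domain.
have lam0 := eigenvalue_gt0 eigen; have L2phi := eigenfunction_L2 eigen.
have ortho := phi_orthonormal eigen.
rewrite !big_ord_recl !big_ord0 !addr0.
have Lu j : L2 Omega (u_ j) by case: (uD j).
have Lw j : L2 Omega (w_ j) by case: (wA j).
have [_ vD _] := vrep; have [Lv _] := vD t t0.
apply: (@spectral_norm_le R lam lam0 beta _ _ C) => //; [exact: powR_gt0|exact: powR_gt0|].
move=> n.
have h := HC (lam n) (L2dot Omega (u_ ord0) (phi n)) (L2dot Omega (u_ ord_max) (phi n))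
  (fun s => L2dot Omega (v s) (phi n)) (lam0 n).
have {}h := h (fun s s0 => continuous_coefficient mOmega lam0 L2phi vrep s0)
  (fun T T0 => integrable_coefficient mOmega lam0 L2phi ortho usol vrep n T0) (coefficient_volterra mOmega lam0 L2phi ortho usol vrep n) t t0.
rewrite (_ : lift ord0 ord0 = ord_max :> 'I_2); last exact: val_inj.
have pv := L2_pairable mOmega Lv (L2phi n).
have pw j k : (lebesgue_rV d).-integrable Omega (EFin \o (fun x => (k *: w_ j) x * phi n x)).
  by apply: pairableZ => //; exact: L2_pairable.
have dotw j k : L2dot Omega (k *: w_ j) (phi n) = k * ((lam n)^-1 * L2dot Omega (u_ j) (phi n)).
  rewrite L2dotZ//; last exact: L2_pairable.
  by rewrite (coefficient_A_inv mOmega L2phi ortho n (Lu j) (wA j)).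
set k0 := _ / Gamma _; set k1 := (X in _ + X *: _).
have -> : L2dot Omega (v t - (k0 *: w_ ord0 + k1 *: w_ ord_max)) (phi n) =
    L2dot Omega (v t) (phi n) - (k0 * ((lam n)^-1 * L2dot Omega (u_ ord0) (phi n)) +
                                 k1 * ((lam n)^-1 * L2dot Omega (u_ ord_max) (phi n))).
  rewrite -[in LHS]scaleN1r L2dotD//; last by apply: pairableZ => //; exact: pairableD.
  by rewrite L2dotZ ?mulN1r ?L2dotD ?dotw//; exact: pairableD.
rewrite (_ : (@ord_max 1)%:R = 1 :> R)// sub0r.
have -> : k0 = t `^ (- alpha) / Gamma (1 - alpha) by rewrite /k0 sub0r add0r.
have -> : k1 = t `^ (1 - alpha) / Gamma (2 - alpha).
  by rewrite /k1 (_ : (@ord_max 1)%:R = 1 :> R)// -[in RHS](natr1 1).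
move: h; rewrite [X in `|_ - X|](_ : _ = t `^ (- alpha) / Gamma (1 - alpha) * ((lam n)^-1 * L2dot Omega (u_ ord0) (phi n)) +
  t `^ (1 - alpha) / Gamma (2 - alpha) * ((lam n)^-1 * L2dot Omega (u_ ord_max) (phi n)))//; ring.
Qed.
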